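(* Let $s \geq 2$ be an integer, $Q \simeq \mathbb{Z}^s$, and $Q_0$ a subgroup of finite index in $Q$. Let $A$ be a $\mathbb{Z}Q$-module and $A_0$ a subgroup of finite index in $A$ that is a $\mathbb{Z}Q_0$-submodule. Let $f : A_0 \to A$ be a homomorphism of abelian groups such that $$f(a_0 q_0) = f(a_0) f_0(q_0) \quad \text{for } a_0 \in A_0,\ q_0 \in Q_0,$$ where $f_0 : Q_0 \to Q$ is an injective homomorphism of groups. Assume furthermore that 1) $A = \mathbb{Z}Q/I$ is a $\mathbb{Z}$-torsion-free integral domain of Krull dimension $2$; 2) for every prime number $p$ the ring $A/pA$ is an infinite domain; 3) if $Q = \langle x_1, \ldots, x_s \rangle$ and if there are positive integers $\widetilde{n}, \widetilde{c}_1, \ldots, \widetilde{c}_s$ and a ring homomorphism $$\mathbb{Z}\langle x_1^{\widetilde{n}}, \ldots, x_s^{\widetilde{n}} \rangle / (\mathbb{Z}\langle x_1^{\widetilde{n}}, \ldots, x_s^{\widetilde{n}} \rangle \cap I) \to \mathbb{Z}\langle x_1^{\widetilde{c}_1}, \ldots, x_s^{\widetilde{c}_s} \rangle / (\mathbb{Z}\langle x_1^{\widetilde{c}_1}, \ldots, x_s^{\widetilde{c}_s} \rangle \cap I)$$ that sends (the class of) $x_i^{\widetilde{n}}$ to (the class of) $x_i^{\widetilde{c}_i}$ for $1 \leq i \leq s$, then $\widetilde{n} = \widetilde{c}_1 = \cdots = \widetilde{c}_s$; 4) the image of a non-trivial element of $Q$ in the field of fractions of $A$ is never algebraic over $\mathbb{Q}$;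 5) $\Sigma_A^c(Q)$ does not contain a one-dimensional circle $S^1$ obtained by intersecting a two-dimensional subspace of $\mathrm{Hom}(Q,\mathbb{R}) \simeq \mathbb{R}^s$ with the unit sphere $S^{s-1}$. Then there is a $\mathbb{Z}Q$-submodule $M = mA + \mu A$ of $A_0$, where $m$ is a positive integer and $\mu \in A$, such that a) $M$ is an abelian subgroup of $A_0$ of finite index; and either b1) $f(M) = 0_A$, or b2) there is a positive integer $k$ and some finite index subgroup $Q_1$ of $Q_0$ such that $f_0^k : Q_1 \to Q$ is (defined and equal to) the inclusion map, and $f(mA) \subseteq mA$, $f(\mu A) \subseteq \mu A$.
   Context: For a subgroup $H \leq Q$, $\mathbb{Z}H$ denotes its integral group ring, viewed as a subring of $\mathbb{Z}Q$; for example $\mathbb{Z}\langle x_1^{n},\dots,x_s^{n}\rangle$ is the group ring of the subgroup generated by $x_1^{n},\dots,x_s^{n}$. $f_0^k$ denotes the $k$-fold composition of $f_0$ with itself, wherever it is defined. The module operation is written multiplicatively on the right ($a q$ is the action of $q$ on $a$). $0_A$ is the zero element of $A$. The Krull dimension of a commutative ring is the maximal length $k$ of a chain of prime ideals $P_0 \subsetneq \dots \subsetneq P_k$. Bieri–Strebel invariant: for a finitely generated abelian group $Q$, the character sphere is $S(Q) = (\mathrm{Hom}(Q,\mathbb{R}) \setminus \{0\})/\sim$, where $\chi_1 \sim \chi_2$ iff $\chi_1 = r\chi_2$ for some real $r>0$; $[\chi]$ denotes the class of $\chi$. For $Q\simeq\mathbb{Z}^s$, $S(Q)$ is identified with the unit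 sphere $S^{s-1}$ in $\mathrm{Hom}(Q,\mathbb{R})\simeq\mathbb{R}^s$. Put $Q_\chi = \{q \in Q : \chi(q) \geq 0\}$. For a finitely generated $\mathbb{Z}Q$-module $A$, $\Sigma_A(Q) = \{[\chi] \in S(Q) : A \text{ is finitely generated as a } \mathbb{Z}Q_\chi\text{-module}\}$ and $\Sigma_A^c(Q) = S(Q) \setminus \Sigma_A(Q)$. *)

(* Defs.v *)
From HB Require Import structures.
From mathcomp Require Import all_boot all_order all_algebra.
From mathcomp Require Import ring_quotient generic_quotient fraction.
From mathcomp Require Import finmap.
From mathcomp Require Import boolp classical_sets cardinality reals.
From mathcomp Require Import multinomials.monalg.

Set Implicit Arguments.
Unset Strict Implicit.
Unset Printing Implicit Defensive.

Import GRing.Theory Num.Theory.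
Local Open Scope fset_scope.
Local Open Scope ring_scope.

(* The abelian group Q is written additively, so that <<q>> * <<r>> = <<q + r>>
   in ZQ. The ring structure that monalg puts on {malg int[Q]} needs a monoid
   in which only 1 is invertible; hence it is rebuilt here, on an alias, from
   the additive structure of {malg int[Q]}. *)
Definition grpring (Q : zmodType) : Type := {malg int[Q]}.
HB.instance Definition _ (Q : zmodType) := GRing.Zmodule.on (grpring Q).

Definition gelt (Q : zmodType) (q : Q) : grpring Q := mkmalgU q 1.

Section GroupRing.
Variable Q : zmodType.
Implicit Types g h : {malg int[Q]}.

Definition gmul g h : {malg int[Q]} :=
  \sum_(k <- msupp g) \sum_(l <- msupp h) mkmalgU (k + l) (g@_k * h@_l).

Lemma gmulw (d e : {fset Q}) g h : msupp g `<=` d -> msupp h `<=` e ->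
  gmul g h = \sum_(k <- d) \sum_(l <- e) mkmalgU (k + l) (g@_k * h@_l).
Proof.
move=> le_d le_e; rewrite /gmul (big_fset_incl _ le_d) /=.
  apply/eq_bigr=> k _; apply/big_fset_incl => // l _ /mcoeff_outdom ->.
  by rewrite mulr0 monalgU0.
move=> k _ /mcoeff_outdom gk.
by rewrite big1 => // l _; rewrite gk mul0r monalgU0.
Qed.

Lemma gmulC : commutative gmul.
Proof.
move=> g h; rewrite /gmul exchange_big /=; apply/eq_bigr=> k _.
by apply/eq_bigr=> l _; rewrite addrC mulrC.
Qed.

Lemma gmulUU (k l : Q) (c d : int) :
  gmul (mkmalgU k c) (mkmalgU l d) = mkmalgU (k + l) (c * d).
Proof. by rewrite (gmulw msuppU_le msuppU_le) !big_seq_fset1 !mcoeffUU. Qed.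

Lemma gmul0 : left_zero 0 gmul.
Proof. by move=> g; rewrite /gmul msupp0 big_seq_fset0. Qed.

Lemma gmulr0 : right_zero 0 gmul.
Proof. by move=> g; rewrite gmulC gmul0. Qed.

Lemma gmulDl : left_distributive gmul +%R.
Proof.
move=> g1 g2 g.
rewrite (gmulw (msuppD_le g1 g2) (fsubset_refl (msupp g))).
rewrite (gmulw (fsubsetUl (msupp g1) (msupp g2)) (fsubset_refl (msupp g))).
rewrite (gmulw (fsubsetUr (msupp g1) (msupp g2)) (fsubset_refl (msupp g))).
rewrite -big_split /=; apply/eq_bigr=> k _.
rewrite -big_split /=; apply/eq_bigr=> l _.
by rewrite mcoeffD mulrDl monalgUD.
Qed.

Lemma gmulDr : right_distributive gmul +%R.
Proof. by move=> g g1 g2; rewrite ![gmul g _]gmulC gmulDl. Qed.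

Lemma gmul_suml (J : Type) (r : seq J) (F : J -> {malg int[Q]}) h :
  gmul (\sum_(j <- r) F j) h = \sum_(j <- r) gmul (F j) h.
Proof. exact: (big_morph (gmul^~ h) (fun _ _ => gmulDl _ _ _) (gmul0 h)). Qed.

Lemma gmul_sumr (J : Type) (r : seq J) (F : J -> {malg int[Q]}) h :
  gmul h (\sum_(j <- r) F j) = \sum_(j <- r) gmul h (F j).
Proof. exact: (big_morph (gmul h) (fun _ _ => gmulDr _ _ _) (gmulr0 h)). Qed.

Lemma gmulA : associative gmul.
Proof.
move=> g1 g2 g3; rewrite [g1]monalgE !gmul_suml; apply/eq_bigr=> k1 _.
rewrite [g2]monalgE gmul_suml !gmul_sumr gmul_suml; apply/eq_bigr=> k2 _.
rewrite [g3]monalgE !gmul_sumr; apply/eq_bigr=> k3 _.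
by rewrite !gmulUU mulrA addrA.
Qed.

Lemma gmul1 : left_id (mkmalgU 0 1) gmul.
Proof.
move=> g; rewrite (gmulw msuppU_le (fsubset_refl _)) big_seq_fset1 [RHS]monalgE.
by apply/eq_bigr=> k _; rewrite mcoeffUU mul1r add0r.
Qed.

Lemma goner_neq0 : mkmalgU 0 1 != 0 :> {malg int[Q]}.
Proof. by rewrite monalgU_eq0 oner_eq0. Qed.

Lemma msupp_gmul g h k : k \in msupp (gmul g h) ->
  exists i j, [/\ i \in msupp g, j \in msupp h & k = i + j].
Proof.
move=> kgh; apply: contrapT => nex; move: kgh; rewrite -mcoeff_neq0 => /negP; apply.
rewrite /gmul raddf_sum big_seq big1 //= => i ig.
rewrite raddf_sum big_seq big1 //= => j jh; rewrite mcoeffU.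
by case: eqP => // kE; case: nex; exists i, j.
Qed.
End GroupRing.

HB.instance Definition _ (Q : zmodType) :=
  GRing.Zmodule_isComNzRing.Build (grpring Q)
    (@gmulA Q) (@gmulC Q) (@gmul1 Q) (@gmulDl Q) (@goner_neq0 Q).

Lemma geltD (Q : zmodType) (q r : Q) : gelt (q + r) = gelt q * gelt r.
Proof. by rewrite [RHS]gmulUU mulr1. Qed.

(* For a submonoid H of Q, the elements of ZQ which lie in the subring ZH. *)
Definition grpring_on (Q : zmodType) (H : {pred Q}) : {pred grpring Q} :=
  [pred u : grpring Q | all [in H] (msupp u)].

Section SubgroupRing.
Variables (Q : zmodType) (H : zmodClosed Q).

Lemma grpring_on_subring : subring_closed (grpring_on H).
Proof.
split=> [|u v uH vH|u v uH vH]; apply/allP=> k /=.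
- by rewrite [msupp _]msuppU /= inE => /eqP ->; exact: rpred0.
- move=> /(fsubsetP (msuppB_le _ _)); rewrite in_fsetU.
  by case/orP=> [/(allP uH)|/(allP vH)].
- by case/msupp_gmul=> i [j [/(allP uH) iH /(allP vH) jH ->]]; exact: rpredD.
Qed.

HB.instance Definition _ :=
  GRing.isSubringClosed.Build (grpring Q) (grpring_on H) grpring_on_subring.

Record subgrpring : Type :=
  SubGrpring { sgval : grpring Q; sgvalP : sgval \in grpring_on H }.

HB.instance Definition _ := [isSub for sgval].
HB.instance Definition _ := [Choice of subgrpring by <:].
HB.instance Definition _ := [SubChoice_isSubComNzRing of subgrpring by <:].

Lemma gelt_on q : q \in H -> gelt q \in grpring_on H.
Proof. by move=> qH; apply/allP=> k; rewrite [msupp _]msuppU /= inE => /eqP ->. Qed.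

Variable I : idealr (grpring Q).

Definition restr_ideal : {pred subgrpring} := [pred u | sgval u \in I].

Lemma restr_ideal_closed : idealr_closed restr_ideal.
Proof.
split; rewrite ?inE ?rmorph0 ?rmorph1 ?rpred0 ?idealr1 //.
move=> a u v; rewrite !inE => uI vI; rewrite -[sgval]/(val) rmorphD rmorphM.
by rewrite rpredD // idealMr.
Qed.

HB.instance Definition _ :=
  isIdealr.Build subgrpring restr_ideal restr_ideal_closed.

(* The ring ZH / (ZH \cap I). *)
Definition subquot : Type := {ideal_quot restr_ideal}.
HB.instance Definition _ := GRing.ComNzRing.on subquot.

Definition subquot_elt (q : Q) (qH : q \in H) : subquot :=
  \pi_({ideal_quot restr_ideal})%qT (SubGrpring (gelt_on qH)).
End SubgroupRing.

Definition gen_subgroup (Q : zmodType) (n : nat) (y : 'I_n -> Q) : {pred Q} :=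
  [pred q | `[< exists k : 'I_n -> int, q = \sum_i y i *~ k i >]].

Section GenSubgroup.
Variables (Q : zmodType) (n : nat) (y : 'I_n -> Q).

Lemma gen_subgroupP q :
  reflect (exists k : 'I_n -> int, q = \sum_i y i *~ k i) (q \in gen_subgroup y).
Proof. exact: asboolP. Qed.

Lemma gen_subgroup_closed : zmod_closed (gen_subgroup y).
Proof.
split=> [|q r /gen_subgroupP[k ->] /gen_subgroupP[l ->]]; apply/gen_subgroupP.
  by exists (fun=> 0); rewrite big1 // => i _; rewrite mulr0z.
exists (fun i => k i - l i).
by rewrite -sumrB; apply/eq_bigr=> i _; rewrite mulrzBr.
Qed.

HB.instance Definition _ :=
  GRing.isZmodClosed.Build Q (gen_subgroup y) gen_subgroup_closed.

Lemma mem_gen_subgroup i : y i \in gen_subgroup y.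
Proof.
apply/gen_subgroupP; exists (fun j => (j == i)%:Z).
rewrite (bigD1 i) //= eqxx mulr1z big1 ?addr0 // => j /negbTE ->.
by rewrite mulr0z.
Qed.
End GenSubgroup.

(* The class of x_i ^ (m i) in Z<x_1 ^ (m 1), .., x_s ^ (m s)> modulo I. *)
Definition power_class (Q : zmodType) (I : idealr (grpring Q)) (s : nat)
    (x : 'I_s -> Q) (m : 'I_s -> nat) (i : 'I_s) :
    subquot (gen_subgroup (fun j => x j *+ m j)) I :=
  subquot_elt I (@mem_gen_subgroup Q s (fun j => x j *+ m j) i).

(* The ring morphism g presents B as S / J: it is onto, with kernel J. *)
Definition is_quotient (S B : nzRingType) (J : set S) (g : {rmorphism S -> B}) :=
  (forall b, exists a, g a = b) /\ (forall a, g a = 0 <-> J a).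

Definition finite_index (V : zmodType) (H K : {pred V}) : Prop :=
  {subset H <= K} /\
  exists r : seq V, {in K, forall x, exists2 y, y \in r & x - y \in H}.

(* Subsets are boolean predicates as in ring_quotient; the choice axioms of
   boolp make every Prop-valued predicate of this form, so nothing is lost. *)
Definition prime_chain (S : comNzRingType) (P : nat -> {pred S}) (k : nat) :=
  (forall i, (i <= k)%N -> idealr_closed (P i) /\ prime_idealr_closed (P i)) /\
  (forall i, (i < k)%N ->
     {subset P i <= P i.+1} /\ ~ {subset P i.+1 <= P i}).

Definition krull_dim (S : comNzRingType) (k : nat) : Prop :=
  (exists P, @prime_chain S P k) /\
  (forall P l, @prime_chain S P l -> (l <= k)%N).

(* A ring morphism pi : ZQ -> A makes A a ZQ-module, with a u := a * pi u. *)
Section Modules.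
Variables (Q : zmodType) (A : comNzRingType) (pi : {rmorphism grpring Q -> A}).

Definition is_submodule (T : {pred grpring Q}) (M : {pred A}) : Prop :=
  zmod_closed M /\ (forall a u, a \in M -> u \in T -> a * pi u \in M).

Definition fin_gen_over (T : {pred grpring Q}) : Prop :=
  exists (n : nat) (g : 'I_n -> A), forall a, exists u : 'I_n -> grpring Q,
    (forall i, u i \in T) /\ a = \sum_i g i * pi (u i).

Variable R : realType.
Local Open Scope classical_set_scope.

Definition nonzero_chars : set (Q -> R) :=
  [set chi | {morph chi : q r / q + r} /\ exists q, chi q != 0].

(* The class of chi modulo positive real scalars. *)
Definition ray (chi : Q -> R) : set (Q -> R) :=
  [set psi | exists2 r : R, 0 < r & forall q, psi q = r * chi q].

Definition char_sphere : set (set (Q -> R)) := ray @` nonzero_chars.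

Definition Sigma : set (set (Q -> R)) :=
  ray @` [set chi | nonzero_chars chi /\
                    fin_gen_over (grpring_on [pred q | 0 <= chi q])].

Definition Sigma_c : set (set (Q -> R)) := char_sphere `\` Sigma.

(* Through coordinates on Q, a vector v of R^s is the character
   q |-> <v, coord q>; a point of the unit sphere of R^s stands for the
   class of its character in S(Q). *)
Variables (s : nat) (coord : Q -> 'rV[int]_s).

Definition char_of (v : 'rV[R]_s) (q : Q) : R :=
  \sum_i v ord0 i * (coord q ord0 i)%:~R.

Definition great_circle (V : {vspace 'rV[R]_s}) : set (set (Q -> R)) :=
  [set ray (char_of v) | v in
    [set v : 'rV[R]_s | v \in V /\ \sum_i v ord0 i ^+ 2 = 1]].
End Modules.

Arguments char_sphere Q R : clear implicits.
Arguments Sigma {Q A} pi R.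
Arguments Sigma_c {Q A} pi R.

Definition two_gen_ideal (A : comNzRingType) (m : nat) (mu : A) : {pred A} :=
  [pred a | `[< exists b c : A, a = b *+ m + mu * c >]].

(* Main.v *)
Require Import Defs.
From HB Require Import structures.
From mathcomp Require Import all_boot all_order all_algebra.
From mathcomp Require Import fingroup perm separable polyXY polydiv.
From mathcomp Require Import ring_quotient generic_quotient fraction.
From mathcomp Require Import finmap.
From mathcomp Require Import boolp classical_sets cardinality reals.
From mathcomp Require Import multinomials.monalg.
From mathcomp Require Import lra zify.

Set Implicit Arguments.
Unset Strict Implicit.
Unset Printing Implicit Defensive.

Import Order.TTheory GRing.Theory Num.Theory.
Local Open Scope classical_set_scope.
Local Open Scope ring_scope.

(* Let K be the field of fractions of A. Two elements of A are algebraically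
   dependent over Z, because A has Krull dimension 2 (via Zariski's lemma),
   while every x <> 1 in Q is transcendental; so [K : Q(x)] is finite.
   Set |x| = [K : Q(x)] and |1| = 0. Then |x^n| = n |x|, and the relation
   P(x, y) = 0 given by Gauss' lemma has degrees [Q(x, y) : Q(x)] and
   [Q(x, y) : Q(y)], whence |x y| <= |x| + |y| on substituting y = z / x.

   If f is not 0 on A_0, semilinearity makes x |-> f_0(x) extend to an embedding
   of a subfield of finite index into K, so f_0 multiplies |.| by a constant
   ratio. A norm with integral values on Z^s is a maximum of finitely many
   integral functionals; f_0 permutes those that are exposed, up to the ratio, so
   that a power of f_0 is a scalar, equal to 1 by hypothesis 3.

   Finally M = m A + mu A with m A inside A_0 and mu the product of x^N - 1 over
   the f_0-orbit of some x. Avoiding finitely many isolated subgroups, x is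
   chosen so that no factor of mu is divisible by a prime p dividing m. As A has
   dimension 2, the images of Q in A/(p, mu) then have finite order, and A/M is
   finite. *)

(** * Prime ideals and Zariski's lemma *)

(** The obstacle is that f and f_0 are only partially defined; three exponents repair this. If N_0
    kills Q/Q_0, then g(q) = f_0(N_0 q) is an endomorphism of Q. The ring morphisms [thN] and [thg]
    from ZQ to A induced by multiplication by N_0 and by g have the same kernel: f(a thN(u)) = f(a)
    thg(u) with f(a) nonzero gives one inclusion, and dimension 2 the other. So one field has two
    embeddings in K, of degrees a and b, and comparing degrees gives a |g(x)| = N_0 b |x|. A power
    g^k is then the scalar (N_0 b / a)^k; hypothesis 3 turns it into N_0^k, so that f_0^k is the
    identity on N_0^k Q. If m kills A/A_0, then m A lies in A_0. Finally N is such that A (x^N - 1)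
    lies in A_0 for all x in Q_0: f can then be applied to b (x^N - 1) for every b in A, and f(m b)
    (f_0(x)^N - 1) = m f(b (x^N - 1)), which is the source of the inclusion of f(m A) in m A. *)

Section PrimeIdeals.
Variable A : comNzRingType.
Implicit Types (J D : set A).

(** Unlike [idealr_closed], this allows the unit ideal, so that ideals can be formed before they are
    known to be proper. *)
Definition ideal_set J := J 0 /\ forall a u v, J u -> J v -> J (a * u + v).

Lemma ideal_setM J a u : ideal_set J -> J u -> J (a * u).
Proof. by case=> J0 JM Ju; rewrite -[a * u]addr0; exact: JM. Qed.

Lemma ideal_setD J u v : ideal_set J -> J u -> J v -> J (u + v).
Proof. by case=> _ JM Ju Jv; rewrite -[u]mul1r; exact: JM. Qed.

Lemma ideal_setB J u v : ideal_set J -> J u -> J v -> J (u - v).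
Proof. by case=> _ JM Ju Jv; rewrite addrC -mulN1r; exact: JM. Qed.

(** An ideal M maximal among those that contain J and avoid D is prime: for u and v outside M, both
    M + uA and M + vA meet D, and so does their product, which lies in M if u v does. *)
Lemma prime_avoiding J D : ideal_set J -> D 1 ->
  (forall u v, D u -> D v -> D (u * v)) -> (forall u, J u -> ~ D u) ->
  exists P : {pred A}, [/\ idealr_closed P, prime_idealr_closed P,
    forall u, J u -> u \in P & forall u, D u -> u \notin P].
Proof.
move=> idJ D1 DM JD.
(* The condition bears on the union of J and X, so that the union of the empty chain is good too. *)
pose good (X : set A) := ideal_set (J `|` X) /\ forall u, (J `|` X) u -> ~ D u.
have [|X [[idX XD] maxX]] := @Zorn_bigcup _ good.
  move=> F Fgood Ftot; split; last first.
    move=> u [Ju|[X FX Xu]]; first exact: JD.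
    by have [_] := Fgood X FX; apply; right.
  split; first by left; case: idJ.
  have inX X u a v : F X -> (J `|` X) u -> (J `|` X) v ->
      (J `|` \bigcup_(X in F) X) (a * u + v).
    move=> FX Xu Xv; have [[_ XM] _] := Fgood X FX.
    by case: (XM a u v Xu Xv) => [?|?]; [left|right; exists X].
  move=> a u v [Ju|[X FX Xu]] [Jv|[Y FY Yv]].
  - by left; case: idJ => _; apply.
  - by apply: (inX Y) => //; [left|right].
  - by apply: (inX X) => //; [right|left].
  - have [XY|YX] := Ftot X Y FX FY.
      by apply: (inX Y) => //; right => //; exact: XY.
    by apply: (inX X) => //; right => //; exact: YX.
set M := J `|` X in idX XD.
have ext u : ~ M u -> exists m a, M m /\ D (m + u * a).
  move=> nMu; apply: contrapT => nD.
  pose B : set A := [set w | exists m a, M m /\ w = m + u * a].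
  have MB : M `<=` B by move=> m Mm; exists m, 0; rewrite mulr0 addr0.
  have JB : J `|` B = B by apply/setUidPr => m Jm; apply: MB; left.
  apply: (maxX B).
    split; first by move=> m Xm; apply: MB; right.
    move=> BX; apply: nMu; right; apply: BX.
    by exists 0, 1; rewrite mulr1 add0r; split=> //; case: idX.
  rewrite /good JB; split.
    split; first by apply: MB; case: idX.
    move=> a _ _ [m [b [Mm ->]]] [m' [b' [Mm' ->]]].
    exists (a * m + m'), (a * b + b'); split; first by case: idX => _; apply.
    by rewrite !mulrDr addrACA mulrCA.
  by move=> _ [m [a [Mm ->]]] Dm; apply: nD; exists m, a.
exists (fun u => `[< M u >]); split.
- split; [by apply/asboolP; case: idX | |].
    by apply/negP => /asboolP /XD.
  move=> a u v /asboolP Mu /asboolP Mv; apply/asboolP.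
  by case: idX => _; apply.
- move=> u v /asboolP Muv; apply/orP; apply: contrapT => /not_orP[].
  move=> nu nv.
  have [|m [a [Mm Dm]]] := ext u; first by move/asboolP.
  have [|m' [b [Mm' Dm']]] := ext v; first by move/asboolP.
  apply: (XD _ _ (DM _ _ Dm Dm')).
  rewrite mulrDl [u * a * _]mulrDr.
  apply: (ideal_setD idX); first by rewrite mulrC; apply: ideal_setM.
  apply: (ideal_setD idX); first exact: ideal_setM.
  by rewrite mulrACA mulrC; apply: ideal_setM.
- by move=> u Ju; apply/asboolP; left.
- by move=> u Du; apply/negP => /asboolP /XD.
Qed.

(** An [idomainType] carries a boolean set of units and an inverse function; both are supplied
    classically. *)
Lemma comring_idomain : (forall x y : A, x * y = 0 -> (x == 0) || (y == 0)) ->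
  exists (B : idomainType) (g : {rmorphism A -> B}), bijective g.
Proof.
move=> idA; pose unit x := `[< exists y : A, y * x = 1 >].
pose inv x := if pselect (exists y : A, y * x = 1) is left e then sval (cid e) else x.
have mulV : {in unit, left_inverse 1 inv *%R}.
  move=> x /asboolP xu; rewrite /inv; case: pselect => // e.
  exact: (svalP (cid e)).
have unitP x y : y * x = 1 -> unit x by move=> xy; apply/asboolP; exists y.
have inv_out : {in [predC unit], inv =1 id}.
  move=> x xu; rewrite /inv; case: pselect => // e.
  by case/negP: xu; apply/asboolP.
pose m1 := GRing.ComNzRing_hasMulInverse.Build A mulV unitP inv_out.
pose B1 : comUnitRingType := HB.pack (GRing.ComNzRing.sort A) m1.
pose m2 := GRing.ComUnitRing_isIntegral.Build B1 idA.
pose B : idomainType := HB.pack (GRing.ComNzRing.sort A) m1 m2.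
exists B, (idfun : {rmorphism A -> A}); exact: (Bijective (g := id)).
Qed.

End PrimeIdeals.

Lemma prime_quotient (A : comNzRingType) (P : {pred A}) :
  idealr_closed P -> prime_idealr_closed P ->
  exists (B : idomainType) (g : {rmorphism A -> B}),
    (forall b, exists a, g a = b) /\ forall a, (g a == 0) = (a \in P).
Proof.
move=> idP prP.
pose I := isIdealr.Build A P idP.
pose PI : prime_idealr A := HB.pack P I (isPrimeIdealrClosed.Build A P prP).
have [B [g bij_g]] := comring_idomain (@Quotient.rquot_IdomainAxiom A PI).
exists B, (g \o \pi_({ideal_quot PI})%qT).
split=> [b|a /=].
  case: bij_g => h _ gh; exists (repr (h b)) => /=.
  by have -> := reprK (h b); rewrite gh.
rewrite -[RHS]/(a \in (PI : {pred A})) -[a in RHS]subr0.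
by rewrite (Quotient.idealrBE PI) raddf_eq0 ?rmorph0 //; exact: bij_inj.
Qed.

Section Adjunction.
Variable S : idomainType.

Lemma comm_adj (R : comNzRingType) (rho : {rmorphism R -> S}) (a : S) :
  commr_rmorph rho a.
Proof. by move=> x; exact: mulrC. Qed.

Definition adj (R : comNzRingType) (rho : {rmorphism R -> S}) (a : S) :=
  GRing.RMorphism.clone {poly R} S (horner_morph (comm_adj rho a)) _.

Lemma adjE (R : comNzRingType) (rho : {rmorphism R -> S}) (a : S) p :
  adj rho a p = (map_poly rho p).[a].
Proof. by []. Qed.

Lemma adjC (R : comNzRingType) (rho : {rmorphism R -> S}) (a : S) c :
  adj rho a c%:P = rho c.
Proof. exact: horner_morphC. Qed.

Lemma adjX (R : comNzRingType) (rho : {rmorphism R -> S}) (a : S) :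
  adj rho a 'X = a.
Proof. exact: horner_morphX. Qed.

(* Adjoining the generators one at a time makes Zariski's lemma an induction on
   gens. *)
Fixpoint ingen (R : comNzRingType) (rho : {rmorphism R -> S}) (gens : seq S)
    (z : S) : Prop :=
  if gens is a :: gens' then ingen (adj rho a) gens' z else exists u, rho u = z.

(** The iterated polynomial ring on [gens] is a single source for the generated subring, whose
    closure under ring operations then comes from [rho'] being a morphism. *)
Lemma ingen_image gens : forall (R : comNzRingType) (rho : {rmorphism R -> S}),
  exists (R' : comNzRingType) (rho' : {rmorphism R' -> S}),
    [/\ forall z, ingen rho gens z <-> exists u, rho' u = z,
        forall u, exists u', rho' u' = rho u &
        forall a, a \in gens -> exists u, rho' u = a].
Proof.
elim: gens => [|a gens IH] R rho; first by exists R, rho; split=> // u; exists u.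
have [R' [rho' [H1 H2 H3]]] := IH _ (adj rho a); exists R', rho'.
split=> [|u|b]; [exact: H1 | |].
  by have [u' Eu'] := H2 u%:P; exists u'; rewrite Eu' adjC.
rewrite inE => /orP[/eqP ->|/H3 //].
by have [u' Eu'] := H2 'X; exists u'; rewrite Eu' adjX.
Qed.

Lemma ingen_incl gens (R R' : comNzRingType) (rho : {rmorphism R -> S})
    (rho' : {rmorphism R' -> S}) :
  (forall u, exists u', rho' u' = rho u) ->
  forall z, ingen rho gens z -> ingen rho' gens z.
Proof.
elim: gens R R' rho rho' => [|a gens IH] R R' rho rho' inc z /=.
  by case=> u <-; exact: inc.
apply: IH; elim/poly_ind => [|p c [p' Ep]]; first by exists 0; rewrite !rmorph0.
have [c' Ec] := inc c; exists (p' * 'X + c'%:P).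
by rewrite !rmorphD !rmorphM !adjX !adjC Ep Ec.
Qed.

(** The condition bears on [map_poly rho p] and not on p, as [rho] need not be injective: this is
    transcendence over the image of [rho]. *)
Definition transcendental (R : comNzRingType) (rho : {rmorphism R -> S}) (t : S) :=
  forall p : {poly R}, map_poly rho p != 0 -> (map_poly rho p).[t] != 0.

(* 1 + X r' becomes a unit as soon as r' and the constants are inverted. *)
Lemma transcendental_not_inverted (R : comNzRingType) (rho : {rmorphism R -> S})
    (t : S) (r : {poly R}) (D : set S) :
  transcendental rho t -> adj rho t r != 0 ->
  (forall d, D d -> d != 0 /\ exists c, rho c = d) ->
  ~ (forall u, adj rho t u != 0 -> exists n u' d,
       D d /\ adj rho t u * adj rho t u' = adj rho t r ^+ n * d).
Proof.
move=> tr r0 Dc inv.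
pose u : {poly R} := 1 + 'X * r.
have R0 : map_poly rho r != 0.
  by apply: contraNneq r0; rewrite adjE => ->; rewrite horner0.
have EU : map_poly rho u = 1 + 'X * map_poly rho r.
  by rewrite rmorphD rmorphM rmorph1 /= map_polyX.
have sU : (1 < size (map_poly rho u))%N.
  have sXr : (1 < size ('X * map_poly rho r)%R)%N.
    by rewrite mulrC size_mulX // ltnS size_poly_gt0.
  by rewrite EU addrC size_polyDl // size_poly1.
have U0 : map_poly rho u != 0 by rewrite -size_poly_gt0 (leq_trans _ sU).
have [n [u' [d [Dd Ed]]]] := inv u (tr _ U0).
have [d0 [c Ec]] := Dc d Dd; subst d.
have Epoly : map_poly rho u * map_poly rho u' = map_poly rho r ^+ n * (rho c)%:P.
  apply/eqP; rewrite -subr_eq0; apply: contraT.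
  have -> : map_poly rho u * map_poly rho u' - map_poly rho r ^+ n * (rho c)%:P =
    map_poly rho (u * u' - r ^+ n * c%:P).
    by rewrite rmorphB !rmorphM rmorphXn /= map_polyC.
  move/tr; rewrite -adjE rmorphB !rmorphM rmorphXn /= adjC => /negP[].
  by rewrite Ed subrr.
(* As u - 1 = X r, multiplying u u' = r^n d by X^n gives u X^n u' = (u - 1)^n d, and (u - 1)^n is
   (-1)^n modulo u. So u divides the nonzero constant (-1)^n d, against [sU]. *)
have := subrXX (map_poly rho u - 1) (-1) n.
rewrite opprK subrK; set W := \sum_(i < n) _ => EW.
have EU1 : map_poly rho u - 1 = 'X * map_poly rho r by rewrite EU addrC addKr.
have key : map_poly rho u * ('X ^+ n * map_poly rho u' - W * (rho c)%:P) =
    (-1) ^+ n * (rho c)%:P.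
  rewrite mulrBr mulrCA Epoly mulrA -exprMn -EU1 mulrA -mulrBl -EW.
  by rewrite opprB addrC subrK.
have := congr1 (fun p : {poly S} => size p) key => /=.
have c0 : (-1) ^+ n * (rho c)%:P != 0 by rewrite mulf_eq0 signr_eq0 polyC_eq0.
have V0 : ('X ^+ n * map_poly rho u' - W * (rho c)%:P) != 0.
  by apply: contraNneq c0 => V0; rewrite -key V0 mulr0.
rewrite size_mul // size_Msign size_polyC d0 => Es.
have : (0 < size ('X ^+ n * map_poly rho u' - W * (rho c)%:P)%R)%N.
  by rewrite size_poly_gt0.
by lia.
Qed.

End Adjunction.

Section Algebraic.
Variables (S : idomainType) (R : comNzRingType) (rho : {rmorphism R -> S}).

(** Since t is nonzero, powers of X can be divided out of the relation until its constant
    coefficient c is nonzero; then c = - t q(t). *)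
Lemma multiple_in_base (q : {poly R}) (t : S) :
  map_poly rho q != 0 -> (map_poly rho q).[t] = 0 -> t != 0 ->
  exists w c, rho c != 0 /\ t * adj rho t w = rho c.
Proof.
move=> q0 qt t0; elim/poly_ind: q q0 qt => [|q c IH].
  by rewrite rmorph0 eqxx.
rewrite rmorphD rmorphM /= map_polyX map_polyC hornerD hornerM hornerX hornerC.
have [c0|c0 _ /eqP] := eqVneq (rho c) 0; last first.
  rewrite addr_eq0 mulrC => /eqP E; exists (- q), c; split=> //.
  by rewrite rmorphN adjE mulrN E opprK.
move: c0 => /= c0; rewrite c0 polyC0 !addr0 mulf_eq0 polyX_eq0 orbF => q0 /eqP.
by rewrite mulf_eq0 (negbTE t0) orbF => /eqP; exact: IH.
Qed.

Lemma integral_lead (p : {poly R}) (a : S) (n : nat) :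
  (size p <= n.+2)%N -> (map_poly rho p).[a] = 0 ->
  integralOver rho (rho p`_n.+1 * a).
Proof.
move=> sp pa; pose c := p`_n.+1.
(* The coefficients are scaled so that q(c a) = c^n p(a). *)
pose q := \poly_(i < n.+2) (if i == n.+1 then 1 else p`_i * c ^+ (n - i)).
exists q.
  by rewrite monicE lead_coef_poly ?eqxx ?oner_eq0.
apply/rootP; rewrite (horner_coef_wide _ (n := n.+2)); last first.
  by rewrite (leq_trans (size_poly _ _)) // size_poly.
apply: (etrans (y := rho c ^+ n * (map_poly rho p).[a])); last first.
  by rewrite pa mulr0.
rewrite (horner_coef_wide _ (n := n.+2)); last first.
  exact: leq_trans (size_poly _ _) sp.
rewrite mulr_sumr; apply: eq_bigr => i _.
rewrite !coef_map coef_poly ltn_ord /=.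
case: eqP => [->|/eqP ni]; first by rewrite rmorph1 mul1r exprMn mulrA -exprSr.
have lein : (i <= n)%N by have := ltn_ord i; rewrite ltnS leq_eqVlt (negbTE ni).
rewrite rmorphM rmorphXn /= exprMn -/c.
have -> : rho c ^+ n = rho c ^+ (n - i) * rho c ^+ i by rewrite -exprD subnK.
by rewrite [RHS](AC (2*2) ((3*1)*(2*4))).
Qed.

Lemma integral_multiple (c : R) (a : S) (g : {poly R}) :
  integralOver rho (rho c * a) ->
  exists N, integralOver rho (rho c ^+ N * adj rho a g).
Proof.
move=> inta; elim/poly_ind: g => [|g k [N IH]].
  by exists 0%N; rewrite rmorph0 mulr0; exact: integral0.
exists N.+1; rewrite rmorphD rmorphM /= adjX adjC mulrDr.
apply: integral_add.
  by rewrite exprSr mulrACA; apply: integral_mul.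
by rewrite -rmorphXn -rmorphM; exact: integral_id.
Qed.

(** Multiplying the monic equation of y, of degree k, by u^k turns y^k into g^k, while every other
    term keeps a factor u with cofactor in the base. *)
Lemma integral_div_power (u g : R) (y : S) :
  integralOver rho y -> rho u * y = rho g ->
  exists k w, rho u * rho w = rho g ^+ k.
Proof.
case=> q mon_q /rootP qy Eg; exists (size q).-1.
have sq : size q = (size q).-1.+1.
  by rewrite prednK // size_poly_gt0 monic_neq0.
have lq : q`_(size q).-1 = 1 by apply/eqP; rewrite -/(lead_coef q) -monicE.
have smq : (size (map_poly rho q) <= (size q).-1.+1)%N by rewrite -sq size_poly.
move: qy; rewrite (horner_coef_wide _ smq) big_ord_recr /=.
rewrite coef_map /= lq rmorph1 mul1r; set k := (size q).-1 => qy.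
exists (- \sum_(i < k) q`_i * g ^+ i * u ^+ (k.-1 - i)).
have -> : rho g ^+ k = - (rho u ^+ k * \sum_(i < k) (map_poly rho q)`_i * y ^+ i).
  apply/eqP; rewrite -addr_eq0 -Eg exprMn -mulrDr addrC.
  by rewrite qy mulr0.
rewrite rmorphN mulrN rmorph_sum !mulr_sumr; congr (- _).
apply: eq_bigr => i _.
rewrite coef_map !rmorphM !rmorphXn /= -Eg exprMn.
have -> : rho u ^+ k = rho u * rho u ^+ i * rho u ^+ (k.-1 - i).
  by rewrite -exprS -exprD; congr (_ ^+ _); have := ltn_ord i; lia.
by rewrite [LHS](AC (1*(1*2*1)) ((1*3*5)*(2*4))).
Qed.
End Algebraic.

(* Zariski's lemma in Goldman's form. *)
Lemma inverted_base (S : idomainType) (D : set S) (gens : seq S) :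
  D 1 -> (forall d e, D d -> D e -> D (d * e)) ->
  (forall s, s != 0 -> exists s', D (s * s')) ->
  forall (R : comNzRingType) (rho : {rmorphism R -> S}),
  (forall d, D d -> d != 0 /\ exists c, rho c = d) ->
  (forall z, ingen rho gens z) ->
  exists r, rho r != 0 /\ forall u, rho u != 0 ->
    exists n u' d, D d /\ rho u * rho u' = rho r ^+ n * d.
Proof.
move=> D1 DM Dinv; elim: gens => [|a gens IH] R rho Dc gen_S.
  exists 1; rewrite rmorph1 oner_eq0; split=> // u /Dinv[s' Ds'].
  have [u' Eu'] := gen_S s'; exists 0%N, u', (rho u * s').
  by rewrite Eu' mul1r.
have Dc' d : D d -> d != 0 /\ exists c, adj rho a c = d.
  by case/Dc => d0 [c Ec]; split=> //; exists c%:P; rewrite adjC.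
have [r' [r'0 inv]] := IH _ (adj rho a) Dc' gen_S.
(* A transcendental [a] is excluded: R[a] cannot become a field by inverting a single element and
   constants. *)
have [tr|/existsNP[p /not_implyP[p0 /negP/negPn/eqP pa]]] :=
    pselect (transcendental rho a).
  by case: (transcendental_not_inverted tr r'0 Dc inv).
have DX d k : D d -> D (d ^+ k).
  by move=> Dd; elim: k => [|k IHk]; rewrite ?expr0 // exprS; apply: DM.
pose n := (size (map_poly rho p)).-2.
have sP : size (map_poly rho p) = n.+2.
  have : (1 < size (map_poly rho p))%N.
    rewrite ltnNge; apply/negP => /size1_polyC E.
    by move: pa p0; rewrite E hornerC => ->; rewrite polyC0 eqxx.
  by rewrite /n; case: (size _) => [|[|]].
pose p' := \poly_(i < n.+2) p`_i.
have Ep' : map_poly rho p' = map_poly rho p.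
  apply/polyP => i; rewrite !coef_map coef_poly /=; case: ltnP => // le_i.
  by rewrite rmorph0 -coef_map nth_default // sP.
pose c := p`_n.+1.
have c0 : rho c != 0 by rewrite -coef_map -[n.+1]/(n.+2.-1) -sP lead_coef_eq0.
have inta : integralOver rho (rho c * a).
  have -> : c = p'`_n.+1 by rewrite coef_poly ltnSn.
  by apply: integral_lead; rewrite ?size_poly // Ep'.
have [N [q mon_q /rootP qt]] := integral_multiple r' inta.
have t0 : rho c ^+ N * adj rho a r' != 0 by rewrite mulf_neq0 ?expf_neq0.
have q0 : map_poly rho q != 0 by rewrite monic_neq0 ?monic_map.
have [w [e [e0 Ee]]] := multiple_in_base q0 qt t0.
have [w' Ew'] : exists w', adj rho a r' * adj rho a w' = rho e.
  exists ((c ^+ N)%:P * (w \Po ((c ^+ N)%:P * r'))).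
  rewrite rmorphM adjC rmorphXn mulrCA mulrA -Ee; congr (_ * _).
  rewrite !adjE map_comp_poly horner_comp; congr (_.[_]).
  by rewrite -!adjE rmorphM adjC rmorphXn.
(* Inverting c makes [a] integral over the base, and inverting e makes r' a unit. Then u (u' w'^m) =
   e^m d, a multiple by c^M of u' w'^m is integral, and u divides a power of c^M e^m d in the base.
   The final witness pads the exponents of c and e to a common one. *)
exists (c * e); rewrite rmorphM mulf_neq0 //; split=> // u u0.
have [|m [u' [d [Dd Ed]]]] := inv u%:P; first by rewrite adjC.
rewrite adjC in Ed; have [_ [d' Ed']] := Dc d Dd; subst d.
have [M intM] := integral_multiple (u' * w' ^+ m) inta.
have Eg : rho u * (rho c ^+ M * adj rho a (u' * w' ^+ m)) =
    rho (c ^+ M * (e ^+ m * d')).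
  rewrite !rmorphM !rmorphXn /= mulrCA; congr (_ * _).
  by rewrite mulrA Ed mulrAC -exprMn Ew'.
have [k [v Ev]] := integral_div_power intM Eg.
exists ((M + m) * k)%N, (v * (c ^+ (m * k) * e ^+ (M * k))), (rho d' ^+ k).
split; first exact: DX.
rewrite rmorphM mulrA Ev !rmorphM !rmorphXn /= !exprMn -!exprM mulnDl !exprD.
move: (rho c) (rho e) (rho d') => x y z.
rewrite -!mulrA; congr (_ * _).
rewrite [RHS]mulrC -!mulrA [y ^+ (m * k) * _]mulrCA !mulrA.
by rewrite [LHS](ACl (4*2*1*3)).
Qed.

Notation intrm A := (GRing.RMorphism.clone int A (intmul 1) _).

Lemma map_polyZ_horner (A B : comNzRingType) (g : {rmorphism A -> B}) (f : {poly int}) (x : A) :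
  (map_poly (intrm B) f).[g x] = g (map_poly (intrm A) f).[x].
Proof.
rewrite -horner_map -map_poly_comp; congr (_.[_]).
by apply: eq_map_poly => n /=; rewrite rmorph_int.
Qed.

Section Transcendence.
Variable S : idomainType.

(** Otherwise inverting the nonzero base elements would make S a field, and [inverted_base] over
    R[t] would contradict [transcendental_not_inverted]. The element found allows a nonzero prime
    that meets the base only in 0. *)
Lemma transcendental_avoid (R : comNzRingType) (rho : {rmorphism R -> S}) t gens :
  transcendental rho t -> (forall z, ingen rho gens z) ->
  exists2 a : S, a != 0 & forall b r, a * b = rho r -> rho r = 0.
Proof.
move=> tr gen; apply: contrapT => nex.
pose D : set S := [set d | d != 0 /\ exists c, rho c = d].
have D1 : D 1 by split; [exact: oner_neq0 | exists 1; rewrite rmorph1].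
have DM d e : D d -> D e -> D (d * e).
  move=> [d0 [c Ec]] [e0 [c' Ec']]; split; first by rewrite mulf_neq0.
  by exists (c * c'); rewrite rmorphM Ec Ec'.
have Dinv s : s != 0 -> exists s', D (s * s').
  move=> s0; apply: contrapT => nD; apply: nex; exists s => // b r Esb.
  apply/eqP/negPn/negP => r0; apply: nD; exists b; rewrite Esb.
  by split=> //; exists r.
have [] // := inverted_base D1 DM Dinv (rho := adj rho t) (gens := gens).
- move=> d [d0 [c Ec]]; by split=> //; exists c%:P; rewrite adjC.
- move=> z; apply: ingen_incl (gen z) => u.
  by exists u%:P; rewrite adjC.
by move=> r [r0]; apply: (transcendental_not_inverted tr r0) => d.
Qed.

(** If S were a field, [inverted_base] would give an integer r such that each nonzero integer
    divides a power of r; but 1 + 3 r^2 is coprime to r and at least 4. *)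
Lemma char0_nonunit gens : (forall n, intrm S n = 0 -> n = 0) ->
  (forall z, ingen (intrm S) gens z) ->
  exists2 a : S, a != 0 & forall b, a * b != 1.
Proof.
move=> ch0 gen; apply: contrapT => nex.
have inj : injective (intrm S).
  move=> m n Emn; apply/eqP; rewrite -subr_eq0; apply/eqP/ch0.
  by rewrite rmorphB Emn subrr.
have [] // := @inverted_base S [set 1] gens _ _ _ _ (intrm S).
- by move=> d e -> ->; rewrite /= mulr1.
- move=> s s0; apply: contrapT => nD; apply: nex; exists s => // b.
  by apply/eqP => Eb; apply: nD; exists b.
- by move=> d ->; split; [exact: oner_neq0 | exists 1; rewrite rmorph1].
move=> r [r0 inv]; pose u : int := 1 + 3 * r ^+ 2.
have r00 : r != 0 by apply: contraNneq r0 => ->; rewrite rmorph0.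
have u4 : (4 <= u)%R.
  rewrite /u; have : 0 < r ^+ 2 by rewrite exprn_even_gt0.
  by lia.
have [|n [u' [d [-> Ed]]]] := inv u.
  by apply/eqP => /ch0 u0; move: u4; rewrite u0.
rewrite mulr1 -rmorphM -rmorphXn in Ed; have {}Ed := inj _ _ Ed.
have cop : coprimez u r.
  apply/coprimezP; exists (1, - (3 * r)) => /=.
  by rewrite /u mul1r mulNr -mulrA -expr2 addrK.
have : (u %| r ^+ n)%Z by apply/dvdzP; exists u'; rewrite -Ed mulrC.
rewrite -[r ^+ n]mulr1 (Gauss_dvdzr _ (coprimezXr n cop)) dvdz1.
by move: u4; case: u {Ed cop} => [[|[|k]]|k] //=; lia.
Qed.
End Transcendence.

Lemma ingen_map (S B : idomainType) (g : {rmorphism S -> B}) gens :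
  forall (R : comNzRingType) (rho : {rmorphism R -> S}) z,
  ingen rho gens z -> ingen (g \o rho) (map g gens) (g z).
Proof.
elim: gens => [|a gens IH] R rho z /=; first by case=> u <-; exists u.
move=> /IH; apply: ingen_incl => u; exists u.
by rewrite adjE /= map_poly_comp horner_map.
Qed.

Definition prime_ideal (A : comNzRingType) (P : {pred A}) :=
  idealr_closed P /\ prime_idealr_closed P.

Lemma prime_above (A : comNzRingType) (B : idomainType) (g : {rmorphism A -> B})
    (a : B) (D : set A) :
  (forall b, exists a, g a = b) -> a != 0 -> D 1 ->
  (forall u v, D u -> D v -> D (u * v)) ->
  (forall d b, D d -> a * b = g d -> False) ->
  exists P : {pred A}, [/\ prime_ideal P, forall u, g u = 0 -> u \in P,
    ~ (forall u, u \in P -> g u = 0) & forall u, D u -> u \notin P].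
Proof.
move=> gsurj a0 D1 DM Da; pose J : set A := [set z | exists b, g z = a * b].
have idJ : ideal_set J.
  split; first by exists 0; rewrite rmorph0 mulr0.
  move=> c u v [b Eb] [b' Eb']; exists (g c * b + b').
  by rewrite rmorphD rmorphM Eb Eb' mulrDr mulrCA.
have JD u : J u -> ~ D u by move=> [b Eb] Du; apply: (Da u b Du); rewrite Eb.
have [P [idP prP JP DP]] := prime_avoiding idJ D1 DM JD.
exists P; split=> //.
  by move=> u gu; apply: JP; exists 0; rewrite gu mulr0.
have [a' Ea'] := gsurj a => /(_ a') H; case/eqP: a0; rewrite -Ea'; apply: H.
by apply: JP; exists 1; rewrite mulr1.
Qed.

(** * Rings of Krull dimension 2 *)

Section KrullDim2.
Variables (A : idomainType) (gens : seq A).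
Hypothesis genA : forall z, ingen (intrm A) gens z.
Hypothesis dimA : forall P l, @prime_chain A P l -> (l <= 2)%N.

Lemma no_chain3 (P0 P1 P2 P3 : {pred A}) :
  prime_ideal P0 -> prime_ideal P1 -> prime_ideal P2 -> prime_ideal P3 ->
  {subset P0 <= P1} -> ~ {subset P1 <= P0} ->
  {subset P1 <= P2} -> ~ {subset P2 <= P1} ->
  {subset P2 <= P3} -> ~ {subset P3 <= P2} -> False.
Proof.
move=> p0 p1 p2 p3 s1 n1 s2 n2 s3 n3.
have : @prime_chain A (fun i => nth P0 [:: P0; P1; P2; P3] i) 3.
  by split=> [[|[|[|[|]]]]|[|[|[|]]]].
by move/dimA.
Qed.

Lemma prime_ideal0 : prime_ideal (pred1 (0 : A)).
Proof.
split; first split; rewrite ?inE ?oner_eq0 //.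
  by move=> a u v /eqP -> /eqP ->; rewrite inE mulr0 addr0.
by move=> u v; rewrite !inE mulf_eq0.
Qed.

Lemma gen_quotient (B : idomainType) (g : {rmorphism A -> B}) :
  (forall b, exists a, g a = b) ->
  forall (R : comNzRingType) (rho : {rmorphism R -> B}) z,
  ingen rho (map g gens) z.
Proof.
move=> gsurj R rho z; have [a <-] := gsurj z.
apply: ingen_incl (ingen_map g (genA a)) => n.
by exists n%:~R; rewrite /= !rmorph_int.
Qed.

(** Each use lengthens a chain of primes by one while keeping control of the base, so that the next
    use is possible over a smaller base. *)
Lemma transcendental_prime_above (R : comNzRingType) (rho : {rmorphism R -> A})
    (t : A) (B : idomainType) (g : {rmorphism A -> B}) :
  (forall b, exists a, g a = b) -> transcendental (g \o rho) (g t) ->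
  exists P : {pred A}, [/\ prime_ideal P, forall u, g u = 0 -> u \in P,
    ~ (forall u, u \in P -> g u = 0) &
    forall r, rho r \in P -> g (rho r) = 0].
Proof.
move=> gsurj tr.
have [a a0 Ha] := transcendental_avoid tr (gen_quotient gsurj (g \o rho)).
pose D : set A := [set d | g d != 0 /\ exists r, rho r = d].
have [|||P [prP gP ngP DP]] := @prime_above A B g a D gsurj a0.
- by rewrite /D /= rmorph1; split; [exact: oner_neq0 | exists 1; rewrite rmorph1].
- move=> u v [u0 [r Er]] [v0 [r' Er']]; rewrite /D /= rmorphM mulf_neq0 //.
  by split=> //; exists (r * r'); rewrite rmorphM Er Er'.
- by move=> d b [d0 [r Er]] E; case/eqP: d0; rewrite -Er; apply: (Ha b); rewrite E -Er.
exists P; split=> // r rP; apply/eqP/negPn/negP => r0.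
by have /negP[] := DP (rho r) (conj r0 (ex_intro _ r erefl)).
Qed.

Lemma nonunit_prime_above (B : idomainType) (g : {rmorphism A -> B}) :
  (forall b, exists a, g a = b) ->
  (exists2 a : B, a != 0 & forall b, a * b != 1) ->
  exists P : {pred A}, [/\ prime_ideal P, forall u, g u = 0 -> u \in P &
    ~ (forall u, u \in P -> g u = 0)].
Proof.
move=> gsurj [a a0 Ha].
have [|||P [prP gP ngP DP]] := @prime_above A B g a [set 1] gsurj a0 => //.
- by move=> u v -> ->; rewrite /= mulr1.
- by move=> d b -> E; have /eqP[] := Ha b; rewrite E rmorph1.
by exists P.
Qed.

(** Independent elements would give a chain 0 < P1 < P2 < P3. The prime P1 meets Z[x] in 0, so x
    stays transcendental modulo P1; P2 can then be chosen to meet Z in 0, so A/P2 is a finitely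
    generated ring of characteristic 0 and not a field. *)
Lemma algebraic_dependence (x y : A) :
  (forall n, intrm A n = 0 -> n = 0) ->
  transcendental (intrm A) x -> ~ transcendental (adj (intrm A) x) y.
Proof.
move=> ch0 trx tr_y.
have idsurj : forall b : A, exists a, idfun a = b by move=> b; exists b.
have [] := @transcendental_prime_above _ (adj (intrm A) x) y A idfun idsurj.
  move=> p; have -> : map_poly (idfun \o adj (intrm A) x) p =
    map_poly (adj (intrm A) x) p by exact: eq_map_poly.
  exact: tr_y.
move=> P1 [prP1 _ nP1 DP1].
have [B1 [g1 [g1surj kg1]]] := prime_quotient prP1.1 prP1.2.
have [] := @transcendental_prime_above _ (intrm A) x B1 g1 g1surj.
  move=> p p0; have p0' : map_poly (intrm A) p != 0.
    apply: contraNneq p0 => p0; rewrite map_poly_comp p0.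
    by rewrite rmorph0.
  rewrite map_poly_comp horner_map kg1; apply/negP => /DP1 /= E.
  by have /eqP[] := trx p p0'.
move=> P2 [prP2 P12 nP12 DP2].
have [B2 [g2 [g2surj kg2]]] := prime_quotient prP2.1 prP2.2.
have [] := @nonunit_prime_above B2 g2 g2surj.
  apply: (@char0_nonunit B2 (map g2 gens)); last exact: gen_quotient.
  move=> n En; apply: ch0; apply/eqP.
  have /DP2/eqP : n%:~R \in P2 by rewrite -kg2 rmorph_int; apply/eqP.
  rewrite kg1 => H.
  have := DP1 n%:P; rewrite adjC => /(_ H) /= ->.
  by rewrite eqxx.
move=> P3 [prP3 P23 nP23].
apply: (no_chain3 prime_ideal0 prP1 prP2 prP3).
- by move=> u; rewrite inE => /eqP ->; case: prP1 => -[].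
- by move=> H; apply: nP1 => u /H; rewrite inE => /eqP.
- by move=> u; rewrite -kg1 => /eqP /P12.
- by move=> H; apply: nP12 => u /H; rewrite -kg1 => /eqP.
- by move=> u; rewrite -kg2 => /eqP /P23.
- by move=> H; apply: nP23 => u /H; rewrite -kg2 => /eqP.
Qed.

End KrullDim2.

Lemma prime_ideal_ker (A : comNzRingType) (B : idomainType) (g : {rmorphism A -> B}) :
  prime_ideal (fun a => g a == 0).
Proof.
split; first split.
- by rewrite unfold_in rmorph0.
- by rewrite unfold_in rmorph1 oner_eq0.
- move=> a u v; rewrite !unfold_in => /eqP u0 /eqP v0.
  by rewrite rmorphD rmorphM u0 v0 mulr0 addr0.
- by move=> u v; rewrite !unfold_in rmorphM mulf_eq0.
Qed.

(** * Reduction modulo a prime number *)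

Section ModP.
Variable p : nat.
Hypothesis p_pr : prime p.

Lemma intr_Fp_eq0 n : (intrm 'F_p n == 0) = (p %| n)%Z.
Proof. by rewrite -(dvdz_pcharf (pchar_Fp p_pr)). Qed.

Lemma poly_Fp_eq0 (B : comNzRingType) (f : {poly int}) :
  p%:R = 0 :> B -> map_poly (intrm 'F_p) f = 0 -> map_poly (intrm B) f = 0.
Proof.
move=> pB f0; apply/polyP => i; rewrite coef_map coef0 /=.
have /eqP : (map_poly (intrm 'F_p) f)`_i = 0 by rewrite f0 coef0.
rewrite coef_map intr_Fp_eq0 => /dvdzP[k ->].
by rewrite rmorphM /= -[p%:~R]/(p%:R) pB mulr0.
Qed.

Section Relation.
Variables (A : idomainType) (gens : seq A).
Hypothesis genA : forall z, ingen (intrm A) gens z.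
Hypothesis dimA : forall P l, @prime_chain A P l -> (l <= 2)%N.
Variables (B0 : idomainType) (g0 : {rmorphism A -> B0}).
Hypothesis g0P : forall a, g0 a = 0 <-> exists b, a = b *+ p.
Hypothesis pA0 : p%:R != 0 :> A.

(** Otherwise x is transcendental over F_p modulo some prime P above (p, mu), whence a prime P3
    above P. The chain 0 < pA < P < P3 is too long: pA is prime by [g0P], and smaller than P, which
    contains mu. *)
Lemma algebraic_mod (x mu : A) : g0 mu != 0 ->
  exists f : {poly int}, map_poly (intrm 'F_p) f != 0 /\
    exists b c, adj (intrm A) x f = b *+ p + mu * c.
Proof.
move=> mu0; apply: contrapT => nex.
pose J : set A := [set a | exists b c, a = b *+ p + mu * c].
pose D : set A := [set a | exists f, map_poly (intrm 'F_p) f != 0 /\ adj (intrm A) x f = a].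
have idJ : ideal_set J.
  split; first by exists 0, 0; rewrite mul0rn mulr0 addr0.
  move=> a u v [b [c ->]] [b' [c' ->]]; exists (a * b + b'), (a * c + c').
  by rewrite mulrDr mulrnAr mulrnDl mulrDr addrACA mulrCA.
have [|||P [idP prP JP DP]] := prime_avoiding (J := J) (D := D) idJ.
- by exists 1; rewrite !rmorph1 oner_neq0.
- move=> u v [f [f0 <-]] [h [h0 <-]]; exists (f * h).
  by rewrite !rmorphM mulf_neq0.
- by move=> u Ju [f [f0 Ef]]; apply: nex; exists f; split=> //; rewrite Ef.
have [B [g [gsurj kg]]] := prime_quotient idP prP.
have pP : p%:R \in P by apply: JP; exists 1, 0; rewrite mulr0 addr0.
have pB : p%:R = 0 :> B by rewrite -(rmorph_nat g); apply/eqP; rewrite kg.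
have [] := @transcendental_prime_above A gens genA _ (intrm A) x B g gsurj.
  move=> f f0; rewrite map_poly_comp horner_map kg; apply: DP; exists f.
  split=> //; apply: contraNneq f0 => /(poly_Fp_eq0 pB) E.
  apply/eqP; rewrite -E; apply: eq_map_poly => n /=.
  by rewrite rmorph_int.
move=> P3 [prP3 PP3 nPP3 _].
apply: (no_chain3 dimA (prime_ideal0 A) (prime_ideal_ker g0) (conj idP prP) prP3).
- by move=> u; rewrite inE unfold_in => /eqP ->; rewrite rmorph0.
- move=> H; have : p%:R \in pred1 (0 : A).
    by apply: H; rewrite unfold_in; apply/eqP/g0P; exists 1.
  by rewrite inE (negbTE pA0).
- move=> u; rewrite unfold_in => /eqP/g0P[b Eb]; apply: JP; exists b, 0.
  by rewrite mulr0 addr0.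
- move=> H; have /H : mu \in P by apply: JP; exists 0, 1; rewrite mul0rn add0r mulr1.
  by rewrite unfold_in (negbTE mu0).
- by move=> u; rewrite -kg => /eqP /PP3.
- by move=> H; apply: nPP3 => u /H; rewrite -kg => /eqP.
Qed.
End Relation.

Section Order.
Variables (A : comNzRingType) (J : set A).
Hypotheses (idJ : ideal_set J) (Jp : J p%:R).

Lemma ideal_dvd n : (p %| n)%Z -> J n%:~R.
Proof.
case/dvdzP => k ->; rewrite rmorphM; apply: ideal_setM => //.
Qed.

(** Modulo J the powers of x reduce to polynomials in x of bounded degree over F_p, of which there
    are finitely many. Two powers coincide, and x can be cancelled. *)
Lemma finite_order_mod (x x' : A) (f : {poly int}) :
  x * x' = 1 -> map_poly (intrm 'F_p) f != 0 -> J (map_poly (intrm A) f).[x] ->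
  exists2 N, (0 < N)%N & J (x ^+ N - 1).
Proof.
move=> xx' f0 Jf; pose F := map_poly (intrm 'F_p) f; pose d := (size F).-1.
have sF : size F = d.+1 by rewrite prednK ?size_poly_gt0.
have Fd : intrm 'F_p f`_d != 0 by rewrite -coef_map -/F lead_coef_eq0.
have [u Eu] : exists u : int, intrm 'F_p (u * f`_d) = 1.
  exists (val (intrm 'F_p f`_d)^-1)%:Z; rewrite rmorphM /= -pmulrn natr_Zp.
  by rewrite mulVf.
(* T is a monic lift of u f modulo p, so that division by it takes place over the integers. *)
pose T := \poly_(i < d.+1) (if i == d then 1 else u * f`_i).
have monT : T \is monic by rewrite monicE lead_coef_poly ?eqxx ?oner_eq0.
have JT : J (map_poly (intrm A) T).[x].
  have -> : (map_poly (intrm A) T).[x] =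
      (map_poly (intrm A) (T - u *: f)).[x] + u%:~R * (map_poly (intrm A) f).[x].
    by rewrite rmorphB /= map_polyZ hornerD hornerN hornerZ subrK.
  apply: ideal_setD => //; last exact: ideal_setM.
  rewrite horner_coef; elim/big_rec: _ => [|i a _ Ja]; first by case: idJ.
  apply: ideal_setD => //; rewrite mulrC; apply: ideal_setM => //.
  rewrite coef_map; apply: ideal_dvd; rewrite -intr_Fp_eq0.
  rewrite coefB coefZ coef_poly rmorphB; case: ltnP => [|le_d].
    case: (eqVneq (i : nat) d) => [->|_]; first by rewrite Eu rmorph1 subrr.
    by rewrite subrr.
  rewrite rmorph0 sub0r oppr_eq0 rmorphM mulf_eq0; apply/orP; right.
  by rewrite -coef_map -/F nth_default // sF.
pose h n := Pdiv.Ring.rmodp 'X^n T.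
have sh n : (size (h n) <= d)%N.
  rewrite -ltnS; apply: leq_trans (_ : size T <= _)%N; last exact: size_poly.
  by apply: Pdiv.Ring.ltn_rmodpN0; rewrite monic_neq0.
have hx n : J (x ^+ n - (map_poly (intrm A) (h n)).[x]).
  have {1}-> : x ^+ n = (map_poly (intrm A) 'X^n).[x].
    by rewrite map_polyXn hornerXn.
  rewrite (Pdiv.RingMonic.rdivp_eq monT 'X^n) rmorphD rmorphM hornerD hornerM.
  by rewrite addrK; apply: ideal_setM.
pose c n : {ffun 'I_d -> 'F_p} := [ffun i : 'I_d => intrm 'F_p (h n)`_i].
have /injectivePn[n [m nm]] : ~~ injectiveb (fun n : 'I_(#|{ffun 'I_d -> 'F_p}|).+1 => c n).
  apply/negP => /injectiveP/leq_card; rewrite card_ord.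
  by rewrite ltnn.
wlog ltnm : n m nm / (n < m)%N.
  move=> W E; case: (ltngtP n m) => [l|l|/val_inj E']; first exact: (W n m).
    by apply: (W m n); rewrite // eq_sym.
  by rewrite E' eqxx in nm.
move=> Ec; exists (m - n)%N; first by rewrite subn_gt0.
have Jhh : J ((map_poly (intrm A) (h m - h n)).[x]).
  rewrite horner_coef; elim/big_rec: _ => [|i a _ Ja]; first by case: idJ.
  apply: ideal_setD => //; rewrite mulrC; apply: ideal_setM => //.
  rewrite coef_map; apply: ideal_dvd; rewrite -intr_Fp_eq0 coefB rmorphB.
  case: (ltnP i d) => [ltid|leid].
    have := congr1 (fun e : {ffun 'I_d -> 'F_p} => e (Ordinal ltid)) Ec.
    by rewrite !ffunE => ->; rewrite subrr.
  by rewrite !nth_default ?subrr // (leq_trans (sh _)).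
have Jmn : J (x ^+ m - x ^+ n).
  have -> : x ^+ m - x ^+ n = (x ^+ m - (map_poly (intrm A) (h m)).[x]) -
     (x ^+ n - (map_poly (intrm A) (h n)).[x]) + (map_poly (intrm A) (h m - h n)).[x].
    rewrite rmorphB hornerD hornerN.
    by rewrite opprB [RHS]addrAC [X in _ = X + _]addrA subrK addrA subrK.
  by apply: ideal_setD => //; apply: ideal_setB.
have -> : x ^+ (m - n) - 1 = x' ^+ n * (x ^+ m - x ^+ n).
  rewrite mulrBr -exprMn [x' * x]mulrC xx' expr1n; congr (_ - _).
  rewrite -{2}(subnK (ltnW ltnm)) exprD mulrCA -exprMn [x' * x]mulrC xx'.
  by rewrite expr1n mulr1.
exact: ideal_setM.
Qed.
End Order.
End ModP.

(** * Integer-valued norms on free abelian groups *)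

Lemma int_seq_min (u : nat -> int) (b : int) : (forall n, b <= u n) ->
  exists n, forall m, u n <= u m.
Proof.
move=> bu; pose P k := `[< exists n, `|u n - b|%N = k >].
have exP : exists k, P k by exists `|u 0 - b|%N; apply/asboolP; exists 0%N.
case: (ex_minnP exP) => k /asboolP[n En] kmin; exists n => m.
have := kmin `|u m - b|%N (introT (asboolP _) (ex_intro _ m erefl)).
by have := bu n; have := bu m; lia.
Qed.

Section IntegralNorm.
Variable Q : zmodType.
Implicit Types (h l : Q -> int) (x y z q : Q).

(** Homogeneity is for natural multiples only: directional derivatives of a norm are not symmetric
    in general. *)
Definition sublinear h :=
  (forall x y, h (x + y) <= h x + h y) /\ (forall n x, h (x *+ n) = h x *+ n).

Lemma sublinear0 h : sublinear h -> h 0 = 0.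
Proof. by case=> _ hn; rewrite -[in LHS](mulr0n 0) hn mulr0n. Qed.

Lemma sublinear_opp h x : sublinear h -> 0 <= h x + h (- x).
Proof. by move=> sh; have [hD _] := sh; rewrite -(sublinear0 sh) -{1}(subrr x). Qed.

(* The directional derivative of h at x; integrality turns the limit of
   h (n x + w) - n h x into a minimum. *)
Lemma directional_derivative h x : sublinear h ->
  exists h', [/\ sublinear h', forall w, h' w <= h w & h' (- x) <= - h x].
Proof.
move=> sh; have [hD hn] := sh.
have mins w : exists v, (exists n, v = h (x *+ n + w) - h x *+ n) /\
    forall n, v <= h (x *+ n + w) - h x *+ n.
  have [|n nmin] := @int_seq_min (fun n => h (x *+ n + w) - h x *+ n) (- h (- w)).
    by move=> n; have := hD (x *+ n + w) (- w); rewrite addrK hn; lia.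
  by exists (h (x *+ n + w) - h x *+ n); split=> //; exists n.
pose h' w := sval (cid (mins w)).
have h'P w : (exists n, h' w = h (x *+ n + w) - h x *+ n) /\
    forall n, h' w <= h (x *+ n + w) - h x *+ n := svalP (cid (mins w)).
have h'D y z : h' (y + z) <= h' y + h' z.
  have [[n ->] _] := h'P y; have [[m ->] _] := h'P z.
  have [_ /(_ (n + m)%N)] := h'P (y + z).
  have -> : x *+ (n + m) + (y + z) = (x *+ n + y) + (x *+ m + z).
    by rewrite mulrnDr addrACA.
  have := hD (x *+ n + y) (x *+ m + z); rewrite [h x *+ (n + m)]mulrnDr; lra.
have h'0 : h' 0 = 0.
  by have [[n ->] _] := h'P 0; rewrite addr0 hn subrr.
exists h'; split=> [|w|]; last 1 first.
- have [_ /(_ 1%N)] := h'P (- x); rewrite !mulr1n subrr.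
  by rewrite (sublinear0 sh); lia.
- split=> // n y; apply/eqP; rewrite eq_le; apply/andP; split.
    elim: n => [|n IH]; first by rewrite !mulr0n h'0.
    by rewrite !mulrSr; apply: le_trans (h'D _ _) _; rewrite lerD2r.
  case: n => [|n]; first by rewrite !mulr0n h'0.
  have [[m ->] _] := h'P (y *+ n.+1).
  have [_ /(_ m)] := h'P y => le_m.
  (* Here m attains the minimum for (n + 1) y. The comparison rests on (n + 1) (m x + y) = m n x +
     (m x + (n + 1) y). *)
  have le1 : h' y *+ n.+1 <= (h (x *+ m + y) - h x *+ m) *+ n.+1 by rewrite lerMn2r le_m orbT.
  apply: le_trans le1 _; rewrite mulrnBl.
  have -> : h (x *+ m + y) *+ n.+1 = h (x *+ (m * n) + (x *+ m + y *+ n.+1)).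
    rewrite -hn mulrnDl -mulrnA mulnS mulrnDr -addrA addrCA.
    by rewrite addrA.
  have -> : h x *+ m *+ n.+1 = h (x *+ (m * n)) + h x *+ m.
    by rewrite mulrSr hn mulrnA.
  have := hD (x *+ (m * n)) (x *+ m + y *+ n.+1).
  by lra.
- by have [_ /(_ 0%N)] := h'P w; rewrite !mulr0n add0r subr0.
Qed.

(** Linearity along x, once obtained, persists: later derivatives only decrease the function at x
    and at - x, whose values have a nonnegative sum. *)
Lemma directional_derivatives (xs : seq Q) h : sublinear h ->
  exists h', [/\ sublinear h', forall w, h' w <= h w &
    forall x, x \in xs -> h' (- x) <= - h' x].
Proof.
elim: xs h => [|x xs IH] h sh; first by exists h.
have [h1 [sh1 le1 Hx]] := directional_derivative x sh.
have [h2 [sh2 le2 Hxs]] := IH h1 sh1; exists h2; split=> //.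
  by move=> w; apply: le_trans (le2 w) (le1 w).
move=> y; rewrite inE => /orP[/eqP ->|]; last exact: Hxs.
by have := le2 x; have := le2 (- x); have := le1 x; lia.
Qed.

Variables (s : nat) (e : 'I_s -> Q) (co : Q -> 'I_s -> int).
Hypothesis coB : forall i, {morph co^~ i : x y / x - y}.
Hypothesis coE : forall q, q = \sum_i e i *~ co q i.
Hypothesis co_e : forall i j, co (e j) i = (i == j)%:R.

(** An integral form of the Hahn-Banach theorem. The derivative at x pins the value there; further
    derivatives along a basis leave a function that is linear along every element, hence
    additive. *)
Lemma supporting_functional h x : sublinear h ->
  exists l, [/\ {morph l : y z / y + z}, forall y, l y <= h y & l x = h x].
Proof.
move=> sh; have [h1 [sh1 le1 Hx]] := directional_derivative x sh.
have [l [sl le2 He]] := directional_derivatives (codom e) sh1.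
have [lD _] := sl.
pose lin y := l (- y) <= - l y.
have linD y z : lin y -> lin z -> lin (y + z).
  rewrite /lin opprD => ly lz; have := lD (- y) (- z); have := lD y z.
  by move: ly lz; lra.
have linN y : lin y -> lin (- y).
  by rewrite /lin opprK; lia.
have lin0 : lin 0 by rewrite /lin oppr0 sublinear0.
have linMn y n : lin y -> lin (y *+ n).
  by move=> ly; elim: n => // n IH; rewrite mulrS; apply: linD.
have linMz y (k : int) : lin y -> lin (y *~ k).
  by move=> ly; case: k => n; [apply: linMn | apply/linN/linMn].
have linQ y : lin y.
  rewrite [y]coE; elim/big_rec: _ => // i q _; apply: linD.
  by apply/linMz/He/codom_f.
exists l; split.
- move=> y z; apply/eqP; rewrite eq_le lD /=.
  have := lD (y + z) (- z); rewrite addrK; have := linQ z; rewrite /lin.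
  by lia.
- by move=> y; apply: le_trans (le2 y) (le1 y).
have := sublinear_opp x sl; have := le2 x; have := le2 (- x); have := le1 x.
by lia.
Qed.

Variable h : Q -> int.
Hypothesis sh : sublinear h.

Let B : nat := (\sum_i `|h (e i)| + \sum_i `|h (- e i)|)%N.
Let F : finType := {ffun 'I_s -> 'I_(B + B).+1}.

(* A functional below h takes values between - B and B on the basis, so that
   a finite type codes all the candidates. *)
Definition ev (c : F) (q : Q) : int := \sum_i co q i * ((c i)%:Z - B%:Z).

Lemma evB c : {morph ev c : x y / x - y}.
Proof.
by move=> x y; rewrite -sumrB; apply: eq_bigr => i _; rewrite coB mulrBl.
Qed.

Lemma ev0 c : ev c 0 = 0.
Proof. by rewrite -(subrr 0) evB subrr. Qed.

Lemma evN c x : ev c (- x) = - ev c x.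
Proof. by rewrite -[- x]sub0r evB ev0 sub0r. Qed.

Lemma evD c : {morph ev c : x y / x + y}.
Proof. by move=> x y; rewrite -{1}[y]opprK evB evN opprK. Qed.

Lemma evMn c x n : ev c (x *+ n) = ev c x *+ n.
Proof. by elim: n => [|n IH]; rewrite ?mulr0n ?ev0 // !mulrS evD IH. Qed.

Lemma ev_e c i : ev c (e i) = (c i)%:Z - B%:Z.
Proof.
rewrite /ev (bigD1 i) //= co_e eqxx mul1r big1 ?addr0 // => j ji.
by rewrite co_e (negbTE ji) mul0r.
Qed.

Lemma ev_inj c c' : ev c =1 ev c' -> c = c'.
Proof.
move=> E; apply/ffunP => i; apply/val_inj => /=.
by have := E (e i); rewrite !ev_e => /addIr [->].
Qed.

Definition supp (c : F) x := (forall q, ev c q <= h q) /\ ev c x = h x.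

Lemma supp_ex x : exists c, supp c x.
Proof.
have [l [lD le_l lx]] := supporting_functional x sh.
have l0 : l 0 = 0 by apply: (addrI (l 0)); rewrite -lD !addr0.
have lN y : l (- y) = - l y by apply/eqP; rewrite -addr_eq0 -lD addNr l0.
have lMn y n : l (y *+ n) = l y *+ n.
  by elim: n => [|n IH]; rewrite ?mulr0n // !mulrS lD IH.
have lMz y (k : int) : l (y *~ k) = k * l y.
  rewrite mulrC -mulrzz; case: k => n; first by rewrite -!pmulrn lMn.
  by rewrite NegzE !mulrNz lN -!pmulrn lMn.
have bound i : (`|l (e i)| <= B)%N.
  have le1 : (`|h (e i)| <= \sum_i `|h (e i)|)%N by rewrite (bigD1 i) //= leq_addr.
  have le2 : (`|h (- e i)| <= \sum_i `|h (- e i)|)%N by rewrite (bigD1 i) //= leq_addr.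
  have := le_l (e i); have := le_l (- e i); rewrite lN; rewrite /B.
  by move: (\sum_i _)%N (\sum_i _)%N le1 le2; lia.
pose c : F := [ffun i => inord `|l (e i) + B%:Z|].
have Ec i : (c i)%:Z - B%:Z = l (e i).
  by rewrite ffunE inordK; have := bound i; lia.
have Eev q : ev c q = l q.
  rewrite [q in RHS]coE (big_morph l lD l0); apply: eq_bigr => i _.
  by rewrite Ec lMz.
by exists c; split=> [q|]; rewrite Eev.
Qed.

(** By integrality, a functional below h that misses h at x loses at least n at n x, and n exceeds
    h(y) + h(- y), the most that adding y can make up for. *)
Lemma supp_perturb x y : exists2 n, (0 < n)%N & forall c, supp c (x *+ n + y) -> supp c x.
Proof.
have hy := sublinear_opp y sh; have [hD hn] := sh.
exists (absz (h y + h (- y) + 1)); first by lia.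
set n := absz _ => c [le_c Ec]; split=> //.
apply/eqP; rewrite eq_le le_c /= leNgt; apply/negP => lt_c.
have := hD (x *+ n + y) (- y); rewrite addrK hn -Ec evD evMn => le1.
have le2 : ev c x *+ n <= (h x - 1) *+ n by rewrite lerMn2r; apply/orP; right; lia.
have le3 := le_c y.
have En : (1 : int) *+ n = h y + h (- y) + 1 by rewrite /n natz; lia.
by move: le1 le2; rewrite mulrnBl En; lra.
Qed.

Definition exposed c := exists x, supp c x /\ forall c', supp c' x -> c' = c.

(** If two functionals support h at x and differ at y, those that support h at m x + y form a
    strictly smaller part of the face of x. Faces are finite, so this descent ends at a single
    functional. *)
Lemma exposed_ex x : exists c, exposed c /\ supp c x.
Proof.
pose L y : {set F} := [set c | `[< supp c y >]]%SET.
have LP y c : reflect (supp c y) (c \in L y) by rewrite inE; exact: asboolP.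
have [n] := ubnP #|L x|; elim: n x => // n IH x; rewrite ltnS => leLn.
have [c Lc] := supp_ex x.
have [uniq_c|] := pselect (forall c', supp c' x -> c' = c).
  by exists c; split=> //; exists x.
move=> /existsNP[c' /not_implyP[Lc' cc']].
have [y Ey] : exists y, ev c y != ev c' y.
  apply: contrapT => nE; apply: cc'; apply: ev_inj => y; apply/eqP/negPn/negP => ny.
  by apply: nE; exists y; rewrite eq_sym.
have [m m0 Lm] := supp_perturb x y.
have subL : L (x *+ m + y) \subset L x.
  by apply/fintype.subsetP => d /LP /Lm /LP.
have [|d [exd Ld]] := IH (x *+ m + y); last by exists d; split=> //; apply: Lm.
apply: leq_trans leLn; apply: proper_card; rewrite properE subL.
apply/negP => /fintype.subsetP sub.
have /LP[_ E1] := sub c (introT (LP _ _) Lc).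
have /LP[_ E2] := sub c' (introT (LP _ _) Lc').
move: Lc Lc' => [_ Ex] [_ Ex']; case/eqP: Ey.
by move: E1; rewrite -E2 !evD !evMn Ex Ex' => /addrI.
Qed.

Variables (g : Q -> Q) (a b : nat).
Hypotheses (gB : {morph g : x y / x - y}) (a0 : (0 < a)%N) (b0 : (0 < b)%N).
Hypothesis hg : forall x, h (g x) * b%:Z = h x * a%:Z.
Hypothesis h_gt0 : forall x, x != 0 -> 0 < h x.

Let g0 : g 0 = 0. Proof. by rewrite -{1}(subrr 0) gB subrr. Qed.
Let gN x : g (- x) = - g x. Proof. by rewrite -[- x]sub0r gB g0 sub0r. Qed.
Let gD : {morph g : x y / x + y}.
Proof. by move=> x y; rewrite -{1}[y]opprK gB gN opprK. Qed.
Let gMn x n : g (x *+ n) = g x *+ n.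
Proof. by elim: n => [|n IH]; rewrite ?mulr0n ?g0 // !mulrS gD IH. Qed.

(** As c is the only functional supporting h at x, it still equals h at n x + y for large n. There b
    (c' o g) is at most a c, with equality at x; this gives the inequality at y, and - y gives the
    reverse one. *)
Lemma exposed_image c : exposed c ->
  exists c', exposed c' /\ forall y, ev c' (g y) * b%:Z = ev c y * a%:Z.
Proof.
case=> x [Lc uc]; have [c' [exc' Lc']] := exposed_ex (g x); exists c'; split=> //.
have half y : ev c' (g y) * b%:Z <= ev c y * a%:Z.
  have [n n0 Ln] := supp_perturb x y.
  have [d Ld] := supp_ex (x *+ n + y).
  have Ed := uc d (Ln d Ld); subst d.
  have [_ Ey] := Ld; have [_ Ex] := Lc; have [le_c' Egx] := Lc'.
  have le1 : ev c' (g (x *+ n + y)) * b%:Z <= h (g (x *+ n + y)) * b%:Z.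
    by rewrite ler_wpM2r.
  move: le1; rewrite hg -Ey gD gMn !evD !evMn Egx Ex !mulrDl !mulrnAl hg.
  by rewrite lerD2l.
move=> y; apply/eqP; rewrite eq_le half /=.
by have := half (- y); rewrite gN !evN !mulNr lerN2.
Qed.

(** With k the order of the permutation of the exposed functionals, all of them vanish at b^k g^k(x)
    - a^k x. One of them equals h there, and h is positive off 0. *)
Lemma isometry_power : exists2 k, (0 < k)%N &
  forall x, iter k g x *+ (b ^ k) = x *+ (a ^ k).
Proof.
pose E : finType := {c : F | `[< exposed c >]}.
have T_ex (c : E) : exists c' : E, forall y, ev (val c') (g y) * b%:Z = ev (val c) y * a%:Z.
  have [c' [exc' Ec']] := exposed_image (asboolW (valP c)).
  by exists (exist _ c' (asboolT exc')).
pose T c := sval (cid (T_ex c)).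
have TP c y : ev (val (T c)) (g y) * b%:Z = ev (val c) y * a%:Z := svalP (cid (T_ex c)) y.
have Tinj : injective T.
  move=> c d Ecd; apply/val_inj/ev_inj => y.
  have az : a%:Z != 0 by lia.
  by apply: (mulIf az); rewrite -!TP Ecd.
pose sigma := perm Tinj; exists #[sigma]%g; first exact: order_gt0.
set k := #[sigma]%g => x.
have Tk c : iter k T c = c.
  transitivity ((sigma ^+ k)%g c); last by rewrite expg_order perm1.
  by rewrite permX; apply: eq_iter => d; rewrite permE.
have Titer j c y : ev (val (iter j T c)) (iter j g y) * b%:Z ^+ j = ev (val c) y * a%:Z ^+ j.
  elim: j => [|j IH]; first by rewrite !expr0.
  by rewrite !iterS !exprS mulrA TP mulrAC IH mulrAC -mulrA -exprS exprSr mulrA -mulrA -exprSr exprS.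
apply/eqP; rewrite -subr_eq0; apply/eqP; set z := _ - _.
have [c [exc [_ Ecz]]] := exposed_ex z.
have := Titer k (exist _ c (asboolT exc)) x; rewrite Tk /= => Ek.
have : ev c z = 0.
  have mulrnX (y : int) n j : y *+ (n ^ j) = y * n%:Z ^+ j by rewrite -mulr_natr natrX natz.
  by rewrite /z evB !evMn !mulrnX Ek subrr.
rewrite Ecz => hz0; apply/eqP/negPn/negP => /h_gt0.
by rewrite hz0 ltxx.
Qed.
End IntegralNorm.

(** * Degrees of field extensions *)

Section Basis.
Variables (F K : fieldType) (iota : {rmorphism F -> K}).

Definition free_over (T : finType) (b : T -> K) :=
  forall c : T -> F, \sum_t iota (c t) * b t = 0 -> forall t, c t = 0.

Definition basis_over (T : finType) (b : T -> K) :=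
  (forall z, exists c : T -> F, z = \sum_t iota (c t) * b t) /\ free_over b.

(** The degree belongs to a morphism rather than an inclusion, since one field will be embedded into
    K in two ways. *)
Definition has_degree (n : nat) :=
  exists (T : finType) (b : T -> K), basis_over b /\ #|T| = n.

Lemma free_le_basis (T T' : finType) (b : T -> K) (b' : T' -> K) :
  basis_over b -> free_over b' -> (#|T'| <= #|T|)%N.
Proof.
move=> [span_b _] free_b'.
have /choice[M EM] : forall t', exists c : T -> F, b' t' = \sum_t iota (c t) * b t.
  by move=> t'; exact: span_b.
pose A := \matrix_(i < #|T'|, j < #|T|) M (enum_val i) (enum_val j).
suff /eqP <- : row_free A by exact: rank_leq_col.
apply: inj_row_free => v vA; apply/rowP => i; rewrite mxE.
pose c t' := v ord0 (enum_rank t').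
rewrite -[i]enum_valK -/(c _); apply: free_b'.
under eq_bigr => t' _ do rewrite EM mulr_sumr.
rewrite exchange_big big1 //= => t _.
under eq_bigr => t' _ do rewrite mulrA -rmorphM.
rewrite -mulr_suml -rmorph_sum.
suff -> : \sum_i c i * M i t = 0 by rewrite rmorph0 mul0r.
have := congr1 (fun w : 'rV_ _ => w ord0 (enum_rank t)) vA.
rewrite !mxE => {2}<-; rewrite (reindex (@enum_val T' predT)) /=; last first.
  by apply: onW_bij; exact: enum_val_bij.
by apply: eq_bigr => k _; rewrite mxE enum_rankK /c enum_valK.
Qed.

Lemma has_degree_uniq m n : has_degree m -> has_degree n -> m = n.
Proof.
move=> [T [b [Bb <-]]] [T' [b' [Bb' <-]]]; apply/eqP; rewrite eqn_leq.
by rewrite (free_le_basis Bb Bb'.2) (free_le_basis Bb' Bb.2).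
Qed.

Lemma free_le_degree (T : finType) (b : T -> K) n :
  has_degree n -> free_over b -> (#|T| <= n)%N.
Proof. by move=> [T' [b' [Bb' <-]]] fb; exact: free_le_basis Bb' fb. Qed.

Lemma has_degree_gt0 n : has_degree n -> (0 < n)%N.
Proof.
move=> dn; apply: leq_trans (@free_le_degree unit (fun=> 1) n dn _).
  by rewrite card_unit.
move=> c; rewrite (bigD1 tt) //= big1 ?addr0 ?mulr1; last by case.
by move/eqP; rewrite fmorph_eq0 => /eqP c0 [].
Qed.

End Basis.

Lemma has_degree_comp (F E K : fieldType) (iota : {rmorphism F -> E})
    (sigma : {rmorphism E -> K}) m n :
  has_degree iota m -> has_degree sigma n -> has_degree (sigma \o iota) (m * n).
Proof.
move=> [T [b [[span_b free_b] <-]]] [U [d [[span_d free_d] <-]]].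
exists (T * U)%type, (fun tu => sigma (b tu.1) * d tu.2); split; last exact: card_prod.
have eq_sum (c : T * U -> F) :
    \sum_tu (sigma \o iota) (c tu) * (sigma (b tu.1) * d tu.2) =
    \sum_u sigma (\sum_t iota (c (t, u)) * b t) * d u.
  under [RHS]eq_bigr => u _.
    rewrite rmorph_sum mulr_suml.
    under eq_bigr => t _ do rewrite rmorphM -mulrA.
    over.
  by rewrite exchange_big pair_bigA /=; apply: eq_bigr => -[].
split=> [z|c].
  have [e ->] := span_d z.
  have /choice[f Ef] : forall u, exists c : T -> F, e u = \sum_t iota (c t) * b t.
    by move=> u; exact: span_b.
  exists (fun tu => f tu.2 tu.1); rewrite eq_sum.
  by apply: eq_bigr => u _; rewrite Ef.
by rewrite eq_sum => /free_d H [t u]; apply: (free_b (fun t => c (t, u)) (H u)).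
Qed.

Lemma has_degree_image (F F' K : fieldType) (iota : {rmorphism F -> K})
    (iota' : {rmorphism F' -> K}) n :
  (forall x, exists x', iota' x' = iota x) ->
  (forall x', exists x, iota x = iota' x') ->
  has_degree iota n -> has_degree iota' n.
Proof.
move=> /choice[u Eu] /choice[v Ev] [T [b [[span_b free_b] <-]]].
exists T, b; split=> //; split=> [z|c Ec t].
  by have [c ->] := span_b z; exists (u \o c); apply: eq_bigr => t _; rewrite Eu.
apply: (fmorph_inj iota'); rewrite -Ev.
have -> : v (c t) = 0; last by rewrite !rmorph0.
apply: (free_b (v \o c)); apply: etrans Ec.
by apply: eq_bigr => i _; rewrite /= Ev.
Qed.

(** * Fraction fields of images of rings *)

Section FracIm.
Variables (R0 : comNzRingType) (K : fieldType) (alpha : {rmorphism R0 -> K}).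

Definition in_fracim : {pred K} :=
  fun z => `[< exists u v, alpha v != 0 /\ z = alpha u / alpha v >].

Lemma in_fracim_closed : divring_closed in_fracim.
Proof.
split=> [|x y /asboolP[u [v [v0 ->]]] /asboolP[u' [v' [v'0 ->]]]
         |x y /asboolP[u [v [v0 ->]]] /asboolP[u' [v' [v'0 ->]]]]; apply/asboolP.
- by exists 1, 1; rewrite rmorph1 divr1 oner_neq0.
- exists (u * v' - u' * v), (v * v'); rewrite rmorphB !rmorphM mulf_neq0 //.
  by split=> //; rewrite -[- (_ / alpha _)]mulNr addf_div // mulNr.
- have [u'0|u'0] := eqVneq (alpha u') 0.
    by exists 0, 1; rewrite u'0 mul0r invr0 mulr0 rmorph0 rmorph1 mul0r oner_neq0.
  exists (u * v'), (v * u'); rewrite !rmorphM mulf_neq0 //; split=> //.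
  by rewrite invf_div mulf_div.
Qed.

HB.instance Definition _ := GRing.isDivringClosed.Build K in_fracim in_fracim_closed.

(* The fraction field of the image of alpha, as a subfield of K. *)
Record fracim : Type := FracIm { fival : K; fivalP : fival \in in_fracim }.

HB.instance Definition _ := [isSub for fival].
HB.instance Definition _ := [Choice of fracim by <:].
HB.instance Definition _ := [SubChoice_isSubIntegralDomain of fracim by <:].
HB.instance Definition _ := [SubIntegralDomain_isSubField of fracim by <:].

Lemma in_fracimP z :
  reflect (exists u v, alpha v != 0 /\ z = alpha u / alpha v) (z \in in_fracim).
Proof. exact: asboolP. Qed.

Lemma fracim_gen_in u : alpha u \in in_fracim.
Proof. by apply/in_fracimP; exists u, 1; rewrite rmorph1 divr1 oner_neq0. Qed.

Definition gam_def (u : R0) : fracim := FracIm (fracim_gen_in u).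

Lemma gam_def_zmod : zmod_morphism gam_def.
Proof. by move=> x y; apply/val_inj => /=; rewrite rmorphB. Qed.
Lemma gam_def_monoid : monoid_morphism gam_def.
Proof. by split=> [|x y]; apply/val_inj => /=; rewrite ?rmorph1 ?rmorphM. Qed.
HB.instance Definition _ := GRing.isZmodMorphism.Build R0 fracim gam_def gam_def_zmod.
HB.instance Definition _ := GRing.isMonoidMorphism.Build R0 fracim gam_def gam_def_monoid.

(* Locked, as is fracim_incl, to keep unification from unfolding towers of
   fraction fields. *)
Definition gam : {rmorphism R0 -> fracim} :=
  locked (GRing.RMorphism.clone R0 fracim gam_def _).

Lemma val_gam u : val (gam u) = alpha u.
Proof. by rewrite /gam -lock. Qed.

Lemma gam_eq0 u : (gam u == 0) = (alpha u == 0).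
Proof. by rewrite -(inj_eq val_inj) val_gam. Qed.

Lemma fracimE (z : fracim) : exists u v, gam v != 0 /\ z = gam u / gam v.
Proof.
have /in_fracimP[u [v [v0 Ez]]] := fivalP z.
exists u, v; split; first by rewrite gam_eq0.
by apply/val_inj; rewrite fmorph_div /= !val_gam -Ez.
Qed.
End FracIm.

Section FracImTheory.
Variables (R0 : comNzRingType) (K : fieldType) (alpha : {rmorphism R0 -> K}).

(** Equality of the kernels makes u / v |-> beta(u) / beta(v) well defined. *)
Lemma fracim_lift (K' : fieldType) (beta : {rmorphism R0 -> K'}) :
  (forall u, (alpha u == 0) = (beta u == 0)) ->
  exists j : {rmorphism fracim alpha -> K'}, forall u, j (gam alpha u) = beta u.
Proof.
move=> ab.
have gb v : (gam alpha v == 0) = (beta v == 0) by rewrite gam_eq0 ab.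
have ex z : exists w, exists u v, [/\ beta v != 0, z = gam alpha u / gam alpha v & w = beta u / beta v].
  have [u [v [v0 Ez]]] := fracimE z.
  by exists (beta u / beta v), u, v; rewrite -gb.
pose j z := sval (cid (ex z)).
have jE u v : beta v != 0 -> j (gam alpha u / gam alpha v) = beta u / beta v.
  move=> v0; rewrite /j; case: cid => w /= [u' [v' [v'0 E ->]]].
  move/eqP: E; rewrite eqr_div ?gb // -!rmorphM -subr_eq0 -rmorphB gb rmorphB !rmorphM.
  by rewrite subr_eq0 -eqr_div // => /eqP.
have jzmod : zmod_morphism j.
  move=> x y; have [u [v [v0 ->]]] := fracimE x; have [u' [v' [v'0 ->]]] := fracimE y.
  rewrite gb in v0; rewrite gb in v'0.
  have -> : gam alpha u / gam alpha v - gam alpha u' / gam alpha v' =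
      gam alpha (u * v' - u' * v) / gam alpha (v * v').
    by rewrite rmorphB !rmorphM -[- (_ / gam alpha _)]mulNr addf_div ?gb // mulNr.
  rewrite !jE // ?rmorphM ?mulf_neq0 // rmorphB !rmorphM.
  by rewrite -[- (_ / beta _)]mulNr addf_div ?gb // mulNr.
have jmon : monoid_morphism j.
  split.
    have := jE 1 1; rewrite !rmorph1 !divr1 => -> //; exact: oner_neq0.
  move=> x y; have [u [v [v0 ->]]] := fracimE x; have [u' [v' [v'0 ->]]] := fracimE y.
  rewrite gb in v0; rewrite gb in v'0.
  by rewrite mulf_div -!rmorphM !jE ?rmorphM ?mulf_neq0 // mulf_div.
pose jM : {rmorphism fracim alpha -> K'} := HB.pack j
  (GRing.isZmodMorphism.Build _ _ j jzmod) (GRing.isMonoidMorphism.Build _ _ j jmon).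
exists jM => u; change (j (gam alpha u) = beta u).
have := jE u 1; rewrite !rmorph1 !divr1 => -> //; exact: oner_neq0.
Qed.

(** Clearing denominators reduces independence to coefficients in [R0]. *)
Lemma fracim_free (K' : fieldType) (iota : {rmorphism fracim alpha -> K'})
    (T : finType) (b : T -> K') :
  (forall u : T -> R0, \sum_t iota (gam alpha (u t)) * b t = 0 ->
     forall t, iota (gam alpha (u t)) = 0) ->
  free_over iota b.
Proof.
move=> H c Ec.
have /choice[u Hu] : forall t, exists u, exists v, gam alpha v != 0 /\ c t = gam alpha u / gam alpha v.
  by move=> t; exact: fracimE.
have /choice[v Ev] := Hu.
pose V := \prod_t v t; pose w t := u t * \prod_(s | s != t) v s.
have V0 : gam alpha V != 0.
  by rewrite rmorph_prod; apply/prodf_neq0 => t _; case: (Ev t).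
have Ew t : gam alpha (w t) = c t * gam alpha V.
  rewrite /w /V [in RHS](bigD1 t) //= !rmorphM; have [v0 ->] := Ev t.
  by rewrite mulrA divfK.
move=> t; have /eqP : iota (gam alpha (w t)) = 0.
  apply: H; transitivity ((\sum_t iota (c t) * b t) * iota (gam alpha V)).
    by rewrite mulr_suml; apply: eq_bigr => s _; rewrite Ew rmorphM mulrAC.
  by rewrite Ec mul0r.
by rewrite fmorph_eq0 Ew mulf_eq0 (negbTE V0) orbF => /eqP.
Qed.

Definition fracim_incl := locked (GRing.RMorphism.clone (fracim alpha) K val _).

Lemma fracim_incl_gam u : fracim_incl (gam alpha u) = alpha u.
Proof. by rewrite /fracim_incl -lock; exact: val_gam. Qed.

End FracImTheory.

(* [E : Q(x)] = n, where Q(x) is the fraction field of the image of Z[x]. *)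
Definition degree_of (E : fieldType) (x : E) (n : nat) :=
  has_degree (fracim_incl (adj (intrm E) x)) n.

Lemma adj_int_map (E K : idomainType) (sigma : {rmorphism E -> K}) x p :
  sigma (adj (intrm E) x p) = adj (intrm K) (sigma x) p.
Proof. by rewrite !adjE map_polyZ_horner. Qed.

Lemma degree_of_comp (E K : fieldType) (sigma : {rmorphism E -> K}) x m n :
  has_degree sigma m -> degree_of x n -> degree_of (sigma x) (n * m).
Proof.
move=> dm dn; apply: has_degree_image (has_degree_comp dn dm).
  move=> z; have [u [v [v0 ->]]] := fracimE z.
  exists (gam (adj (intrm K) (sigma x)) u / gam (adj (intrm K) (sigma x)) v).
  by rewrite !fmorph_div /= !fracim_incl_gam -!adj_int_map.
move=> z; have [u [v [v0 ->]]] := fracimE z.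
exists (gam (adj (intrm E) x) u / gam (adj (intrm E) x) v).
by rewrite !fmorph_div /= !fracim_incl_gam -!adj_int_map.
Qed.

(** * Simple and finitely generated algebraic extensions *)

Section SimpleExtension.
Variables (F K : fieldType) (iota : {rmorphism F -> K}) (z : K).

Lemma in_adjoinX : z \in in_fracim (adj iota z).
Proof. by have := fracim_gen_in (adj iota z) 'X; rewrite adjX. Qed.

Lemma in_adjoinC c : iota c \in in_fracim (adj iota z).
Proof. by have := fracim_gen_in (adj iota z) c%:P; rewrite adjC. Qed.

Lemma minimal_relation (P : {poly F}) : P != 0 -> root (map_poly iota P) z ->
  exists m : {poly F}, [/\ m != 0, root (map_poly iota m) z,
    (size m <= size P)%N &
    forall p, p != 0 -> root (map_poly iota p) z -> (size m <= size p)%N].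
Proof.
move=> P0 rP.
pose ok n := `[< exists p : {poly F}, [/\ p != 0, root (map_poly iota p) z & size p = n] >].
have exok : exists n, ok n by exists (size P); apply/asboolP; exists P.
case: (ex_minnP exok) => n /asboolP[m [m0 rm <-]] minm; exists m; split=> //.
  by apply: minm; apply/asboolP; exists P.
by move=> p p0 rp; apply: minm; apply/asboolP; exists p.
Qed.

Variable m : {poly F}.
Hypotheses (m0 : m != 0) (rm : root (map_poly iota m) z).
Hypothesis minm : forall p, p != 0 -> root (map_poly iota p) z -> (size m <= size p)%N.

Lemma adjoin_inv p : (map_poly iota p).[z] != 0 ->
  exists q, (map_poly iota q).[z] = (map_poly iota p).[z]^-1.
Proof.
move=> pz; have cop : coprimep p m.
  apply: contraT; rewrite /coprimep => ncop.
  have /dvdpP[h Eh] := dvdp_gcdr p m; have /dvdpP[k Ek] := dvdp_gcdl p m.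
  set g := gcdp p m in ncop Eh Ek *.
  have gz : (map_poly iota g).[z] != 0.
    apply: contraNneq pz => gz; rewrite Ek rmorphM hornerM gz mulr0.
    by rewrite eqxx.
  have h0 : h != 0 by apply: contraNneq m0 => h0; rewrite Eh h0 mul0r.
  have g0 : g != 0 by apply: contraNneq m0 => g0; rewrite Eh g0 mulr0.
  have : (size m <= size h)%N.
    apply: minm => //; move: rm; rewrite Eh rmorphM rootM => /orP[//|].
    by rewrite /root (negbTE gz).
  rewrite Eh size_mul //; have : (1 < size g)%N.
    by rewrite ltn_neqAle eq_sym ncop size_poly_gt0.
  have : (0 < size h)%N by rewrite size_poly_gt0.
  by move: (size h) (size g) => a b; lia.
have /Bezout_eq1_coprimepP[[u v] /= E] := cop.
exists u; apply: (mulIf pz); rewrite mulVf //.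
have := congr1 (fun q => (map_poly iota q).[z]) E.
rewrite rmorphD !rmorphM rmorph1 hornerD !hornerM hornerC.
by rewrite (rootP rm) mulr0 addr0.
Qed.

Lemma simple_degree : (forall w, w \in in_fracim (adj iota z)) ->
  has_degree iota (size m).-1.
Proof.
move=> gen; exists 'I_(size m).-1, (fun i : 'I_(size m).-1 => z ^+ i); split; last exact: card_ord.
have sm : (0 < size m)%N by rewrite size_poly_gt0.
split=> [w|c Ec t].
  have [p ->] : exists p, w = (map_poly iota p).[z].
    have /in_fracimP[u [v [v0 ->]]] := gen w; have [q Eq] := adjoin_inv v0.
    by exists (u * q); rewrite rmorphM hornerM Eq.
  exists (fun i : 'I_(size m).-1 => (p %% m)`_i); rewrite {1}(divp_eq p m) rmorphD rmorphM hornerD hornerM.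
  rewrite (rootP rm) mulr0 add0r (horner_coef_wide _ (n := (size m).-1)); last first.
    by rewrite size_map_poly -ltnS prednK // ltn_modp.
  by apply: eq_bigr => i _; rewrite coef_map.
pose p := \poly_(i < (size m).-1) (if insub i is Some j then c j else 0).
have pE (i : 'I_(size m).-1) : p`_i = c i.
  by rewrite coef_poly ltn_ord insubT //= => ?; congr c; apply/val_inj.
rewrite -pE; have [->|p0] := eqVneq p 0; first by rewrite coef0.
have /(minm p0) : root (map_poly iota p) z.
  apply/rootP; rewrite (horner_coef_wide _ (n := (size m).-1)).
    by rewrite -[RHS]Ec; apply: eq_bigr => i _; rewrite coef_map /= pE.
  by rewrite size_map_poly size_poly.
by move=> le_m; have := leq_trans le_m (size_poly _ _); rewrite -ltnS prednK // ltnn.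
Qed.
End SimpleExtension.

Lemma simple_extension (F K : fieldType) (iota : {rmorphism F -> K}) (z : K)
    (P : {poly F}) : P != 0 -> root (map_poly iota P) z ->
  (forall w, w \in in_fracim (adj iota z)) ->
  exists2 d, (d <= (size P).-1)%N & has_degree iota d.
Proof.
move=> P0 rP gen; have [m [m0 rm lem minm]] := minimal_relation P0 rP.
exists (size m).-1; last exact: simple_degree gen.
by rewrite -!subn1 leq_sub2r.
Qed.

Section FiniteDegree.
Variables (F K : fieldType) (iota : {rmorphism F -> K}).
Hypothesis char0F : [pchar F] =i pred0.

Lemma primitive_element (l : seq K) : (forall x, x \in l -> algebraicOver iota x) ->
  exists z, algebraicOver iota z /\
    forall x, x \in l -> exists p, (map_poly iota p).[z] = x.
Proof.
elim: l => [|x l IH] alg_l; first by exists 0; split=> //; exact: algebraic0.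
have [|z' [[q q0 rq] Hz']] := IH; first by move=> y yl; apply: alg_l; rewrite inE yl orbT.
have [p p0 rp] := alg_l x (mem_head _ _).
have [n [[px Ex] [py Ey]]] := pchar0_PET p0 rp q0 rq char0F.
exists (z' *+ n - x); split.
  apply: algebraic_sub; last by exists p.
  rewrite -mulr_natr; apply: algebraic_mul; first by exists q.
  by rewrite -(rmorph_nat iota); exact: algebraic_id.
move=> y; rewrite inE => /orP[/eqP ->|/Hz'[r Er]]; first by exists px.
by exists (r \Po py); rewrite map_comp_poly horner_comp Ey.
Qed.

(** A primitive element, available in characteristic 0, reduces the extension generated by [l] to a
    simple one. *)
Lemma finite_degree (l : seq K) :
  (forall x, x \in l -> algebraicOver iota x) ->
  (forall S : divringClosed K, (forall y, iota y \in S) ->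
     (forall x, x \in l -> x \in S) -> forall w, w \in S) ->
  exists d, has_degree iota d.
Proof.
move=> /primitive_element[z [[P P0 rP] Hz]] gen.
have [|d _ dd] := simple_extension P0 rP; last by exists d.
apply: gen => [y|x /Hz[p <-]].
  exact: in_adjoinC.
by rewrite -(adjE iota z); exact: fracim_gen_in.
Qed.
End FiniteDegree.

Lemma rmorph_comp_int (B : idomainType) (g : {rmorphism {poly int} -> B}) p q :
  g (p \Po q) = adj (intrm B) (g q) p.
Proof.
elim/poly_ind: p => [|p c IH]; first by rewrite comp_poly0 !rmorph0.
rewrite comp_polyD comp_polyM comp_polyX comp_polyC !rmorphD !rmorphM IH adjX adjC.
by rewrite -[c in LHS]intz !rmorph_int.
Qed.

Lemma transcendental_int (K : idomainType) (x : K) :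
  transcendental (intrm K) x -> (forall k : int, intrm K k = 0 -> k = 0) ->
  forall p, adj (intrm K) x p = 0 -> p = 0.
Proof.
move=> trx ch0 p px; have : map_poly (intrm K) p == 0.
  by apply: contraT => /trx; rewrite -adjE px eqxx.
move=> /eqP E; apply/polyP => i; rewrite coef0; apply: ch0.
by rewrite -coef_map E coef0.
Qed.

Section Powers.
Variables (K : fieldType) (x : K) (n d : nat).
Hypotheses (trx : transcendental (intrm K) x) (n0 : (0 < n)%N).
Hypothesis ch0 : forall k : int, intrm K k = 0 -> k = 0.
Hypothesis dx : degree_of x d.

Local Notation F := (fracim (adj (intrm K) x)).
Local Notation X := (gam (adj (intrm K) x) 'X).
Local Notation sub := (fracim_incl (adj (intrm F) (X ^+ n))).

Lemma degree_of_gen_power : degree_of (X ^+ n) n.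
Proof.
pose P : {poly fracim (adj (intrm F) (X ^+ n))} := 'X^n - (gam (adj (intrm F) (X ^+ n)) 'X)%:P.
have sP : size P = n.+1.
  by rewrite /P size_polyDl ?size_polyXn // size_polyN size_polyC ltnS; case: (_ == _).
have P0 : P != 0 by rewrite -size_poly_gt0 sP.
have rP : root (map_poly sub P) X.
  rewrite /root /P rmorphB /= map_polyXn map_polyC hornerD hornerN hornerXn hornerC.
  rewrite subr_eq0; apply/eqP/esym; exact: (etrans (fracim_incl_gam _ _) (adjX _ _)).
have [w|d' led' dd'] := simple_extension P0 rP.
  have in_gam u : gam (adj (intrm K) x) u \in in_fracim (adj sub X).
    elim/poly_ind: u => [|u c IH]; first by rewrite rmorph0 rpred0.
    rewrite rmorphD rmorphM rpredD ?rpredM //.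
      exact: in_adjoinX.
    have -> : c%:P = c%:~R by rewrite -[c in LHS]intz rmorph_int.
    by rewrite rmorph_int rpred_int.
  by have [u [v [_ ->]]] := fracimE w; rewrite rpred_div.
rewrite sP /= in led'.
suff led : (n <= d')%N.
  have En : d' = n by apply/eqP; rewrite eqn_leq led led'.
  by rewrite En in dd'.
rewrite -[X in (X <= _)%N]card_ord.
apply: (free_le_degree (b := fun i : 'I_n => X ^+ i) dd'); apply: fracim_free => u Eu t.
(* The i-th summand has only exponents congruent to i modulo n, so no cancellation occurs between
   summands. *)
pose h := \sum_(i < n) (u i \Po 'X^n) * 'X^i.
suff h0 : h = 0.
  suff -> : u t = 0 by rewrite !rmorph0.
  apply/polyP => k; rewrite [RHS]coef0; have := congr1 (fun p : {poly int} => p`_(k * n + t)) h0.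
  rewrite coef_sum coef0 (bigD1 t) //= coefMXn ltnNge leq_addl /= addnK.
  rewrite coef_comp_poly_Xn // dvdn_mull // mulnK // big1 ?addr0 // => i it.
  rewrite coefMXn; case: ltnP => // le_i; rewrite coef_comp_poly_Xn //.
  case: ifP => // /dvdnP[q Eq]; case/eqP: it; apply/val_inj => /=.
  have : (q * n + i = k * n + t)%N by lia.
  by move/(congr1 (modn^~ n)); rewrite !modnMDl !modn_small.
apply: (transcendental_int trx ch0); rewrite -fracim_incl_gam.
have -> : gam (adj (intrm K) x) h = \sum_(i < n) sub (gam (adj (intrm F) (X ^+ n)) (u i)) * X ^+ i.
  rewrite rmorph_sum; apply: eq_bigr => i _.
  rewrite rmorphM rmorphXn fracim_incl_gam; congr (_ * _).
  by rewrite -rmorphXn -rmorph_comp_int.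
by rewrite Eu rmorph0.
Qed.

Lemma degree_of_power : degree_of (x ^+ n) (n * d).
Proof.
have := degree_of_comp dx degree_of_gen_power.
by rewrite rmorphXn fracim_incl_gam adjX.
Qed.
End Powers.

(** * Subadditivity of the degree *)

Section PolyIntPrime.
Variable c : {poly int}.
Hypothesis sc : (1 < size c)%N.

(** A substitute for an irreducible factor of c over the rationals: a prime of Z[X] that contains c
    and no nonzero constant. *)
Lemma poly_int_specialization :
  exists (B : idomainType) (e : {rmorphism {poly int} -> B}),
    e c = 0 /\ forall k : int, e k%:P = 0 -> k = 0.
Proof.
(* J is the contraction to Z[X] of the ideal that c generates over the rationals. *)
pose J : set {poly int} := [set f | exists (k : int) h, k != 0 /\ k%:P * f = h * c].
pose D : set {poly int} := [set f | exists2 k : int, k != 0 & f = k%:P].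
have idJ : ideal_set J.
  split; first by exists 1, 0; rewrite mulr0 mul0r oner_neq0.
  move=> a u v [k [h [k0 E]]] [k' [h' [k'0 E']]].
  exists (k * k'), (k'%:P * a * h + k%:P * h'); rewrite mulf_neq0 //; split=> //.
  rewrite mulrDr mulrDl -[k'%:P * a * h * c]mulrA -E -[k%:P * h' * c]mulrA -E' polyCM.
  by congr (_ + _); rewrite -!mulrA // mulrCA; congr (_ * _); rewrite mulrCA.
have [|||P [idP prP JP DP]] := prime_avoiding (J := J) (D := D) idJ.
- by exists 1; rewrite ?oner_neq0 ?polyC1.
- move=> u v [k k0 ->] [k' k'0 ->]; exists (k * k'); rewrite ?mulf_neq0 //.
  by rewrite polyCM.
- move=> u [k [h [k0 E]]] [k' k'0 Eu]; have := congr1 (fun p : {poly int} => size p) E.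
  rewrite Eu -polyCM size_polyC mulf_neq0 //= => /esym.
  have c0 : c != 0 by rewrite -size_poly_gt0 ltnW.
  have [->|h0] := eqVneq h 0; first by rewrite mul0r size_poly0.
  rewrite size_mul //; move: h0; rewrite -size_poly_gt0.
  by move: (size h) (size c) sc => m n; lia.
have [B [e [_ ke]]] := prime_quotient idP prP; exists B, e; split.
  by apply/eqP; rewrite ke; apply: JP; exists 1, 1.
move=> k /eqP; rewrite ke => kP; apply/eqP/negPn/negP => k0.
by have /negP[] := DP k%:P (ex_intro2 _ _ k k0 erefl).
Qed.
End PolyIntPrime.

Section Divisor.
Variables (B : idomainType) (e : {rmorphism {poly int} -> B}) (c : {poly int}).
Hypotheses (c0 : c != 0) (ec : e c = 0) (ek : forall k : int, e k%:P = 0 -> k = 0).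

(** Pseudo-division by an element of least degree in the kernel of e, which [ek] prevents from being
    constant. *)
Lemma minimal_divisor : exists p : {poly int}, (1 < size p)%N /\
  forall f, e f = 0 -> exists (k : int) h, k != 0 /\ k *: f = h * p.
Proof.
pose ok n := `[< exists p : {poly int}, [/\ p != 0, e p = 0 & size p = n] >].
have exok : exists n, ok n by exists (size c); apply/asboolP; exists c.
case: (ex_minnP exok) => n /asboolP[p [p0 ep <-]] minp; exists p; split.
  rewrite ltnNge; apply/negP => /size1_polyC Ep; move: ep p0; rewrite Ep => /ek ->.
  by rewrite polyC0 eqxx.
move=> f ef; have E := Pdiv.Idomain.divp_eq f p.
have r0 : e (f %% p) = 0.
  have := congr1 e E; rewrite -mul_polyC rmorphD !rmorphM ef ep !mulr0 add0r.
  by move=> <-.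
exists (lead_coef p ^+ scalp f p), (f %/ p).
rewrite expf_neq0 ?lead_coef_eq0 //; split=> //.
suff rr : f %% p = 0 by rewrite E rr addr0.
apply/eqP; apply: contraT => rn0.
have : (size p <= size (f %% p)%R)%N by apply: minp; apply/asboolP; exists (f %% p).
by rewrite leqNgt ltn_modpN0.
Qed.

Lemma minimal_divisor_coefs (p : {poly int}) :
  (forall f, e f = 0 -> exists (k : int) h, k != 0 /\ k *: f = h * p) ->
  forall P : {poly {poly int}}, map_poly e P = 0 ->
  exists (k : int) H, k != 0 /\ k%:P *: P = p *: H.
Proof.
move=> Hp; elim/poly_ind => [|P f IH eP].
  by exists 1, 0; rewrite !scaler0 oner_neq0.
have [eP0 ef0] : map_poly e P = 0 /\ e f = 0.
  split; last by have := congr1 (coefp 0) eP; rewrite /= coef_map coefD coefMX coefC coef0 add0r.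
  apply/polyP => i; have := congr1 (coefp i.+1) eP.
  by rewrite /= !coef_map coefD coefMX coefC !coef0 addr0.
have [k [H [k0 EH]]] := IH eP0; have [k' [h [k'0 Eh]]] := Hp f ef0.
exists (k * k'), (k'%:P *: H * 'X + (k%:P * h)%:P); rewrite mulf_neq0 //; split=> //.
rewrite !scalerDr; congr (_ + _).
  rewrite polyCM mulrC -scalerA [k%:P *: (P * _)]scalerAl EH -!scalerAl.
  by rewrite [LHS]scalerA [RHS]scalerA mulrC.
rewrite -!mul_polyC -!polyCM; congr (_%:P).
by rewrite polyCM -mulrA [k'%:P * f]mul_polyC Eh mulrA mulrC.
Qed.
End Divisor.

Lemma sizeY_scale (p : {poly int}) (P : {poly {poly int}}) :
  p != 0 -> P != 0 -> sizeY (p *: P) = (size p + sizeY P).-1.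
Proof.
move=> p0 P0; rewrite !sizeYE swapXY_is_scalable /= size_mul.
- by rewrite size_map_inj_poly ?polyC0 //; exact: polyC_inj.
- by rewrite map_polyC_eq0.
- by rewrite swapXY_eq0.
Qed.

Lemma sizeY_mul_ge (G P : {poly {poly int}}) :
  G != 0 -> P != 0 -> (sizeY P <= sizeY (G * P))%N.
Proof.
move=> G0 P0; rewrite !sizeYE rmorphM size_mul ?swapXY_eq0 //.
have : (0 < size (swapXY G))%N by rewrite size_poly_gt0 swapXY_eq0.
by move: (size _) (size _) => a b; lia.
Qed.

Section MinimalBivariate.
Variables (K : fieldType) (x y : K).
Hypotheses (ch0 : forall k : int, intrm K k = 0 -> k = 0).
Hypothesis trx : transcendental (intrm K) x.
Local Notation ev2 := (adj (adj (intrm K) x) y).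

Lemma transcendental_adj_neq0 (c : {poly int}) : c != 0 -> adj (intrm K) x c != 0.
Proof. by apply: contraNneq => /(transcendental_int trx ch0) ->. Qed.

(* Gauss' lemma: a relation of minimal degree in the second variable, and then
   in the first, divides all others up to a constant. *)
Lemma minimal_bivariate (P : {poly {poly int}}) : P != 0 -> ev2 P = 0 ->
  exists P : {poly {poly int}}, [/\ P != 0, ev2 P = 0 &
    forall R, R != 0 -> ev2 R = 0 -> (size P <= size R)%N /\ (sizeY P <= sizeY R)%N].
Proof.
move=> P0 eP.
pose ok n := `[< exists P, [/\ P != 0, ev2 P = 0 & size P = n] >].
have exok : exists n, ok n by exists (size P); apply/asboolP; exists P.
case: (ex_minnP exok) => n /asboolP[P1 [P10 eP1 sP1]] min1 {P P0 eP}.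
pose ok2 m := `[< exists P, [/\ P != 0, ev2 P = 0, size P = n & sizeY P = m] >].
have exok2 : exists m, ok2 m by exists (sizeY P1); apply/asboolP; exists P1.
case: (ex_minnP exok2) => m /asboolP[P [P0 eP sP sYP]] min2 {P1 P10 eP1 sP1}.
exists P; split=> // R R0 eR.
split; first by rewrite sP; apply: min1; apply/asboolP; exists R.
have eZ c (Q : {poly {poly int}}) : ev2 (c *: Q) = adj (intrm K) x c * ev2 Q.
  by rewrite -mul_polyC rmorphM adjC.
(* A multiplier c of least degree with P dividing c R is taken. Once c is shown to be constant, the
   degrees in the first variable can be compared. *)
pose okc l := `[< exists c G, [/\ c != 0, c *: R = G * P & size c = l] >].
have exokc : exists l, okc l.
  have E := Pdiv.Idomain.divp_eq R P.
  exists (size (lead_coef P ^+ scalp R P)); apply/asboolP.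
  exists (lead_coef P ^+ scalp R P), (R %/ P); split=> //.
    by rewrite expf_neq0 ?lead_coef_eq0.
  suff rr : R %% P = 0 by rewrite E rr addr0.
  apply/eqP; apply: contraT => rn0.
  have : (n <= size (R %% P)%R)%N.
    apply: min1; apply/asboolP; exists (R %% P); split=> //.
    by have := congr1 ev2 E; rewrite eZ eR mulr0 rmorphD rmorphM eP mulr0 add0r.
  by rewrite leqNgt -sP ltn_modpN0.
case: (ex_minnP exokc) => l /asboolP[c [G [c0 E sc]]] minc.
have G0 : G != 0.
  apply: contraTneq c0 => G0; move: E; rewrite G0 mul0r => /eqP.
  by rewrite scale_poly_eq0 (negbTE R0) orbF => /eqP ->; rewrite eqxx.
have [sc1|sc1] := leqP (size c) 1.
  have := sizeY_mul_ge G0 P0; rewrite -E sizeY_scale //.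
  by move: sc1; move: (size c) (sizeY R) (sizeY P) => a b d; lia.
(* Modulo a prime containing c the product G P vanishes, so p divides G or P up to constants. If it
   divides G, it cancels from c R = G P, against [minc]; if it divides P, then H is a relation of
   the same degree in the second variable and of smaller degree in the first, against [min2]. *)
have [B [e [ec ek]]] := poly_int_specialization sc1.
have [p [sp Hp]] := minimal_divisor c0 ec ek.
have p0 : p != 0 by rewrite -size_poly_gt0 ltnW.
have : map_poly e (G * P) = 0.
  by rewrite -E -mul_polyC rmorphM /= map_polyC /= ec polyC0 mul0r.
rewrite rmorphM => /eqP; rewrite mulf_eq0 => /orP[|] /eqP Q0.
- have [k [H [k0 EH]]] := minimal_divisor_coefs Hp Q0.
  have [k' [h [k'0 Eh]]] := Hp c ec.
  have h0 : h != 0.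
    apply: contraNneq c0 => h0; move/eqP: Eh; rewrite h0 mul0r scale_poly_eq0.
    by rewrite (negbTE k'0).
  have : (l <= size (k *: h)%R)%N.
    apply: minc; apply/asboolP; exists (k *: h), (k'%:P *: H); split=> //.
      by rewrite scale_poly_eq0 negb_or k0 h0.
    have pI : injective (fun Q : {poly {poly int}} => p *: Q).
      move=> Q Q' /= /eqP; rewrite -subr_eq0 -scalerBr scale_poly_eq0 (negbTE p0).
      by rewrite subr_eq0 => /eqP.
    apply: pI => /=.
    rewrite -[k'%:P *: H * P]scalerAl [RHS]scalerA [p * _]mulrC -[RHS]scalerA [p *: (H * P)]scalerAl -EH -scalerAl -E.
    rewrite !scalerA; congr (_ *: _).
    have -> : p * (k *: h) = k%:P * (h * p) by rewrite -mul_polyC mulrCA [p * h]mulrC.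
    by rewrite -Eh -mul_polyC !mulrA [k%:P * k'%:P]mulrC.
  have := congr1 (fun q : {poly int} => size q) Eh.
  rewrite /= !size_scale // size_mul // sc.
  have : (0 < size h)%N by rewrite size_poly_gt0.
  by move: sp; move: (size h) (size p) => a b; lia.
- have [k [H [k0 EH]]] := minimal_divisor_coefs Hp Q0.
  have H0 : H != 0.
    apply: contraNneq P0 => H0; move/eqP: EH; rewrite H0 scaler0 scale_poly_eq0.
    by rewrite polyC_eq0 (negbTE k0).
  have eH : ev2 H = 0.
    have := congr1 ev2 EH; rewrite !eZ eP mulr0 => /esym/eqP.
    by rewrite mulf_eq0 (negbTE (transcendental_adj_neq0 p0)) => /eqP.
  have sH : size H = n.
    have := congr1 (fun q : {poly {poly int}} => size q) EH.
    by rewrite /= !size_scale ?polyC_eq0 // sP.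
  have : (m <= sizeY H)%N by apply: min2; apply/asboolP; exists H.
  have := congr1 sizeY EH; rewrite !sizeY_scale ?polyC_eq0 // size_polyC k0 sYP.
  have : (0 < sizeY H)%N by rewrite lt0n sizeY_eq0.
  by move: sp; move: (size p) (sizeY H) => a b; lia.
Qed.
End MinimalBivariate.

Lemma rmorph_poly_int (B : idomainType) (g : {rmorphism {poly int} -> B}) p :
  g p = adj (intrm B) (g 'X) p.
Proof. by rewrite -{1}[p]comp_polyXr rmorph_comp_int. Qed.

Section Subadditive.
Variables (K : fieldType) (x y : K).
Hypotheses (ch0 : forall k : int, intrm K k = 0 -> k = 0).
Hypotheses (trx : transcendental (intrm K) x) (try : transcendental (intrm K) y).
Hypothesis trxy : transcendental (intrm K) (x * y).
Local Notation ev2 := (adj (adj (intrm K) x) y).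
Variable P0 : {poly {poly int}}.
Hypotheses (P00 : P0 != 0) (eP0 : ev2 P0 = 0).

Local Notation L := (fracim ev2).
Local Notation inc := (fracim_incl ev2).
Local Notation ga := (gam ev2).
Let xL : L := ga ('X)%:P.
Let yL : L := ga 'X.

Let inc_x : inc xL = x.
Proof. by rewrite fracim_incl_gam adjC adjX. Qed.
Let inc_y : inc yL = y.
Proof. by rewrite fracim_incl_gam adjX. Qed.

Let inj_adj (t : L) : transcendental (intrm K) (inc t) ->
  forall p, adj (intrm L) t p = 0 -> p = 0.
Proof.
move=> tr p /(congr1 inc); rewrite adj_int_map rmorph0.
exact: transcendental_int.
Qed.

Let ga_C u : ga u%:P = adj (intrm L) xL u.
Proof. by rewrite -[ga _]/((ga \o polyC) u) rmorph_poly_int. Qed.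

Let ga_map u : ga (map_poly polyC u) = adj (intrm L) yL u.
Proof.
by rewrite -[ga _]/((ga \o map_poly polyC) u) rmorph_poly_int /= map_polyX.
Qed.

Let ga_eq0 u : ga u = 0 -> ev2 u = 0.
Proof. by move/(congr1 inc); rewrite fracim_incl_gam rmorph0. Qed.

Let ga_in (S : divringClosed L) : xL \in S -> yL \in S -> forall u, ga u \in S.
Proof.
move=> xS yS; elim/poly_ind => [|u c IH]; first by rewrite rmorph0 rpred0.
rewrite rmorphD rmorphM rpredD ?rpredM //; elim/poly_ind: c => [|c k IHc].
  by rewrite polyC0 rmorph0 rpred0.
rewrite polyCD polyCM rmorphD rmorphM rpredD ?rpredM //.
by rewrite -[k]intz !rmorph_int rpred_int.
Qed.

Let degree_of_relation (t z : L) (W : {poly {poly int}}) :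
  transcendental (intrm K) (inc t) -> W != 0 -> adj (adj (intrm L) t) z W = 0 ->
  (forall S : divringClosed L, t \in S -> z \in S -> xL \in S /\ yL \in S) ->
  exists2 d, (d <= (size W).-1)%N & degree_of t d.
Proof.
move=> trt W0 eW gen.
pose F := fracim (adj (intrm L) t).
pose W' : {poly F} := map_poly (gam (adj (intrm L) t)) W.
have EW : map_poly (fracim_incl (adj (intrm L) t)) W' = map_poly (adj (intrm L) t) W.
  by rewrite -map_poly_comp; apply: eq_map_poly => u /=; exact: fracim_incl_gam.
have W'0 : W' != 0.
  apply: contraNneq W0 => W'0; apply/eqP/polyP => i; rewrite coef0.
  apply: (inj_adj trt); rewrite -coef_map -EW W'0 rmorph0.
  by rewrite coef0.
have rW : root (map_poly (fracim_incl (adj (intrm L) t)) W') z.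
  by rewrite /root EW; apply/eqP.
have [w|d led dd] := simple_extension W'0 rW.
  have [] := gen [the divringClosed L of in_fracim (adj (fracim_incl (adj (intrm L) t)) z)].
  - have := in_adjoinC (fracim_incl (adj (intrm L) t)) z (gam (adj (intrm L) t) 'X).
    by rewrite fracim_incl_gam adjX.
  - exact: in_adjoinX.
  move=> xS yS; have [u [v [_ ->]]] := fracimE w.
  by rewrite rpred_div //; apply: ga_in.
exists d => //; apply: leq_trans led _; rewrite -!subn1 leq_sub2r //.
exact: size_poly.
Qed.

Lemma degree_subadditive dx dy dxy : degree_of x dx -> degree_of y dy ->
  degree_of (x * y) dxy -> (exists r, has_degree inc r) -> (dxy <= dx + dy)%N.
Proof.
move=> ddx ddy ddxy [r dr].
have [P [Pn0 eP minP]] := minimal_bivariate ch0 trx P00 eP0.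
have gaP : ga P = 0.
  by apply: (fmorph_inj inc); rewrite fracim_incl_gam eP rmorph0.
have xL0 : xL != 0.
  apply: contraTneq isT => xL0; have := @inj_adj xL; rewrite inc_x => /(_ trx 'X).
  by rewrite adjX => /(_ xL0)/eqP; rewrite polyX_eq0.
pose g := (size P).-1; pose h := (sizeY P).-1.
have sP : size P = g.+1 by rewrite prednK // size_poly_gt0.
have sYP : sizeY P = h.+1 by rewrite prednK // lt0n sizeY_eq0.
have [nx _ dnx] : exists2 d, (d <= (size P).-1)%N & degree_of xL d.
  apply: (@degree_of_relation xL yL P) => //; first by rewrite inc_x.
  rewrite -gaP -[in RHS](coefK P) poly_def rmorph_sum adjE horner_poly.
  by apply: eq_bigr => i _; rewrite -mul_polyC rmorphM rmorphXn ga_C.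
have [ny _ dny] : exists2 d, (d <= (size (swapXY P)).-1)%N & degree_of yL d.
  apply: (@degree_of_relation yL xL (swapXY P)) => //; first by rewrite inc_y.
    by rewrite swapXY_eq0.
  rewrite -gaP -[in RHS](swapXYK P) -[in RHS](coefK (swapXY P)) poly_def.
  rewrite !rmorph_sum adjE horner_poly; apply: eq_bigr => i _.
  rewrite /= swapXY_is_scalable /= rmorphM ga_map; congr (_ * _).
  by rewrite rmorphXn /= swapXY_X rmorphXn.
(* Minimality of P in the second variable makes 1, y, ..., y^(g-1) independent over Q(x); [le_h] is
   the same with x and y exchanged. *)
have le_g : (g <= nx)%N.
  rewrite -[g]card_ord; apply: (free_le_degree (b := fun i : 'I_g => yL ^+ i) dnx).
  apply: fracim_free => u Eu t; pose R := \poly_(i < g) (if insub i is Some j then u j else 0).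
  have RE (i : 'I_g) : R`_i = u i.
    by rewrite coef_poly ltn_ord insubT //= => ?; congr u; apply/val_inj.
  have gaR : ga R = 0.
    rewrite -[RHS]Eu /R poly_def rmorph_sum; apply: eq_bigr => i _.
    rewrite -mul_polyC rmorphM rmorphXn ga_C fracim_incl_gam; congr (adj _ _ _ * _).
    by rewrite insubT //= => ?; congr u; apply/val_inj.
  suff R0 : R = 0 by rewrite -RE R0 coef0 !rmorph0.
  apply/eqP; apply: contraT => /minP/(_ (ga_eq0 gaR))[].
  by move/leq_trans/(_ (size_poly _ _)); rewrite sP ltnn.
have le_h : (h <= ny)%N.
  rewrite -[h]card_ord; apply: (free_le_degree (b := fun i : 'I_h => xL ^+ i) dny).
  apply: fracim_free => u Eu t; pose R := \poly_(i < h) (if insub i is Some j then u j else 0).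
  have RE (i : 'I_h) : R`_i = u i.
    by rewrite coef_poly ltn_ord insubT //= => ?; congr u; apply/val_inj.
  have gaR : ga (swapXY R) = 0.
    rewrite -[RHS]Eu /R poly_def !rmorph_sum; apply: eq_bigr => i _.
    rewrite /= swapXY_is_scalable /= rmorphM ga_map fracim_incl_gam.
    rewrite rmorphXn /= swapXY_X rmorphXn; congr (adj _ _ _ * _).
    by rewrite insubT //= => ?; congr u; apply/val_inj.
  suff R0 : R = 0 by rewrite -RE R0 coef0 !rmorph0.
  apply/eqP; rewrite -swapXY_eq0; apply: contraT => /minP/(_ (ga_eq0 gaR))[_].
  by rewrite [sizeY (swapXY R)]sizeYE swapXYK => /leq_trans/(_ (size_poly _ _)); rewrite sYP ltnn.
(* With t standing for x y, this is X^g P(X, t / X), a polynomial in X over Z[t] of degree at most g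
   + h. *)
pose W : {poly {poly int}} :=
  \sum_(i < g.+1) map_poly polyC P`_i * 'X^(g - i) * ('X^i)%:P.
have sW : (size W <= (g + h).+1)%N.
  apply: leq_trans (size_sum _ _ _) _; apply/bigmax_leqP => i _.
  rewrite mulrC mul_polyC; apply: leq_trans (size_scale_leq _ _) _.
  apply: leq_trans (size_polyMleq _ _) _; rewrite size_polyXn addnS /=.
  rewrite size_map_inj_poly ?polyC0 //; last exact: polyC_inj.
  have := max_size_coefXY P i; rewrite sYP; have := ltn_ord i.
  by move: (size _) => a; lia.
(* Only i = g contributes to the coefficient of t^g, which is the leading coefficient of P. *)
have W0 : W != 0.
  apply: contraNneq Pn0 => W0; rewrite -lead_coef_eq0 -[lead_coef _]/(P`_g).
  apply/eqP/polyP => j; rewrite [RHS]coef0.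
  have := congr1 (fun Q : {poly {poly int}} => Q`_j`_g) W0.
  rewrite !coef_sum /= !coef0 (bigD1 ord_max) //= big1 ?addr0.
    by rewrite coefMC subnn expr0 mulr1 coef_map /= coefCM coefXn eqxx mulr1.
  move=> i ig; rewrite coefMC coefMXn; case: ltnP => _; first by rewrite mul0r coef0.
  rewrite coef_map /= coefCM coefXn; case: eqP => [Ei|_]; last by rewrite mulr0.
  by case/eqP: ig; apply/val_inj.
have [nxy le_nxy dnxy] : exists2 d, (d <= (size W).-1)%N & degree_of (xL * yL) d.
  apply: (@degree_of_relation (xL * yL) xL W) => //.
  - by rewrite rmorphM inc_x inc_y.
  - rewrite /W rmorph_sum.
    apply: (etrans (y := xL ^+ g * ga P)); last by rewrite gaP mulr0.
    rewrite -[in RHS](coefK P) poly_def rmorph_sum mulr_sumr sP.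
    apply: eq_bigr => i _; rewrite !rmorphM !rmorphXn adjX adjC adjX.
    have -> : adj (adj (intrm L) (xL * yL)) xL (map_poly polyC P`_i) = adj (intrm L) xL P`_i.
      rewrite -[LHS]/((adj (adj (intrm L) (xL * yL)) xL \o map_poly polyC) P`_i).
      by rewrite rmorph_poly_int /= map_polyX adjX.
    rewrite -mul_polyC rmorphM rmorphXn ga_C exprMn.
    have -> : xL ^+ g = xL ^+ (g - i) * xL ^+ i by rewrite -exprD subnK // -ltnS.
    by rewrite [LHS](AC (2*2) ((2*3)*(1*4))).
  - move=> S xyS xS; split=> //; have -> : yL = xL * yL / xL by rewrite mulrC mulKf.
    exact: rpred_div.
(* All three degrees are those of L, multiplied by r = [K : L]. *)
have Exy : dxy = (nxy * r)%N.
  apply: has_degree_uniq ddxy _; have := degree_of_comp dr dnxy.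
  by rewrite rmorphM inc_x inc_y.
have Ex : dx = (nx * r)%N.
  by apply: has_degree_uniq ddx _; have := degree_of_comp dr dnx; rewrite inc_x.
have Ey : dy = (ny * r)%N.
  by apply: has_degree_uniq ddy _; have := degree_of_comp dr dny; rewrite inc_y.
rewrite Ex Ey Exy -mulnDl leq_mul2r; apply/orP; right.
apply: leq_trans le_nxy _; apply: leq_trans (leq_add le_g le_h).
by rewrite -ltnS prednK // size_poly_gt0.
Qed.
End Subadditive.

(** * Group rings of free abelian groups *)

Section GroupRingTheory.
Variable Q : zmodType.

Lemma mkmalgU_gelt (k : Q) (c : int) : mkmalgU k c = gelt k *~ c :> grpring Q.
Proof.
have addU : {morph (fun c => mkmalgU k c : grpring Q) : a b / a - b}.
  move=> a b; apply: (addIr (mkmalgU k b : grpring Q)); rewrite subrK.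
  by rewrite -[LHS]/(mkmalgU k (a - b) + mkmalgU k b : {malg int[Q]}) -monalgUD subrK.
have addUn n : mkmalgU k n%:Z = gelt k *+ n :> grpring Q.
  elim: n => [|n IH]; first by rewrite mulr0n; exact: monalgU0.
  by rewrite mulrSr -IH intS addrC [LHS]monalgUD.
case: c => n; first exact: addUn.
rewrite NegzE mulrNz -pmulrn -addUn -[- n.+1%:Z]sub0r addU.
by rewrite [mkmalgU k 0]monalgU0 sub0r.
Qed.

Lemma grpring_ind (P : grpring Q -> Prop) :
  P 0 -> (forall u v, P u -> P v -> P (u - v)) -> (forall q, P (gelt q)) ->
  forall u, P u.
Proof.
move=> P0 PB Pg u.
have PN v : P v -> P (- v) by move=> Pv; rewrite -sub0r; apply: PB.
have PD v w : P v -> P w -> P (v + w).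
  by move=> Pv Pw; rewrite -[w]opprK; apply/PB/PN.
have PM v (c : int) : P v -> P (v *~ c).
  move=> Pv; have Pn n : P (v *+ n) by elim: n => // n IH; rewrite mulrS; apply: PD.
  by case: c => n; [exact: Pn | rewrite NegzE mulrNz; apply: PN; exact: Pn].
rewrite [u]monalgE; apply: (big_ind P) => // k _.
by rewrite mkmalgU_gelt; apply: PM.
Qed.

Section Extension.
Variables (S : comNzRingType) (chi : Q -> S).
Hypotheses (chi0 : chi 0 = 1) (chiD : forall q r, chi (q + r) = chi q * chi r).

Definition gext_def (u : grpring Q) : S := \sum_(k <- msupp u) chi k *~ u@_k.

Lemma gext_defw (d : {fset Q}) u : (msupp u `<=` d)%fset ->
  gext_def u = \sum_(k <- d) chi k *~ u@_k.
Proof.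
move=> le_d; rewrite /gext_def (big_fset_incl _ le_d) //= => k _ /mcoeff_outdom ->.
by rewrite mulr0z.
Qed.

Lemma gext_gelt q : gext_def (gelt q) = chi q.
Proof. by rewrite (gext_defw (d := [fset q]%fset)) ?msuppU_le // big_seq_fset1 mcoeffUU. Qed.

Lemma gext_zmod : zmod_morphism gext_def.
Proof.
move=> u v; pose d := (msupp u `|` msupp v)%fset.
rewrite (gext_defw (d := d)); last exact: msuppB_le.
rewrite (gext_defw (fsubsetUl (msupp u) (msupp v))).
rewrite (gext_defw (fsubsetUr (msupp u) (msupp v))).
by rewrite -sumrB; apply: eq_bigr => k _; rewrite mcoeffB mulrzBr.
Qed.

HB.instance Definition _ := GRing.isZmodMorphism.Build (grpring Q) S gext_def gext_zmod.

Lemma gext_monoid : monoid_morphism gext_def.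
Proof.
split=> [|u v]; first by rewrite -chi0 -gext_gelt.
elim/grpring_ind: u => [|u u' IH IH'|q]; first by rewrite mul0r raddf0 mul0r.
  by rewrite mulrBl !gext_zmod IH IH' mulrBl.
elim/grpring_ind: v => [|v v' IH IH'|r]; first by rewrite mulr0 raddf0 mulr0.
  by rewrite mulrBr !gext_zmod IH IH' mulrBr.
by rewrite -geltD !gext_gelt.
Qed.

HB.instance Definition _ := GRing.isMonoidMorphism.Build (grpring Q) S gext_def gext_monoid.

Lemma gext : exists g : {rmorphism grpring Q -> S}, forall q, g (gelt q) = chi q.
Proof.
exists (GRing.RMorphism.clone (grpring Q) S gext_def _) => q.
exact: gext_gelt.
Qed.
End Extension.

Lemma gelt0 : gelt (0 : Q) = 1. Proof. by []. Qed.

Lemma geltN (q : Q) : gelt q * gelt (- q) = 1.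
Proof. by rewrite -geltD subrr gelt0. Qed.

Lemma geltMn (q : Q) n : gelt (q *+ n) = gelt q ^+ n.
Proof. by elim: n => [|n IH]; rewrite ?gelt0 // mulrS geltD IH exprS. Qed.

Lemma grpring_eq (S : pzRingType) (g h : {rmorphism grpring Q -> S}) :
  (forall q, g (gelt q) = h (gelt q)) -> g =1 h.
Proof.
move=> gh; elim/grpring_ind => [|u v Eu Ev|q]; rewrite ?rmorph0 //.
by rewrite !rmorphB Eu Ev.
Qed.

Lemma theta_ex (A : comNzRingType) (pi : {rmorphism grpring Q -> A}) (h : Q -> Q) :
  {morph h : q r / q + r} ->
  exists g : {rmorphism grpring Q -> A}, forall q, g (gelt q) = pi (gelt (h q)).
Proof.
move=> hD; apply: gext => [|q r]; last by rewrite hD geltD rmorphM.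
have h0 : h 0 = 0 by apply: (addrI (h 0)); rewrite -hD !addr0.
by rewrite h0 gelt0 rmorph1.
Qed.

End GroupRingTheory.

Section FreeAbelian.
Variables (Q : zmodType) (s : nat) (coord : {additive Q -> 'rV[int]_s}).
Hypothesis hcoord : bijective coord.

Lemma coord_dual_basis : exists e : 'I_s -> Q,
  (forall q, q = \sum_i e i *~ coord q ord0 i) /\
  (forall i j, coord (e j) ord0 i = (i == j)%:R).
Proof.
have [c ck kc] := hcoord; exists (fun i => c (delta_mx 0 i)); split=> [q|i j].
  apply: (can_inj ck); rewrite raddf_sum [LHS]row_sum_delta.
  by apply: eq_bigr => i _; rewrite raddfMz kc -scaler_int intz.
by rewrite kc mxE eqxx eq_sym.
Qed.

Lemma coord_torsion_free (q : Q) n : (0 < n)%N -> q *+ n = 0 -> q = 0.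
Proof.
move=> n0 qn; apply: (bij_inj hcoord); rewrite raddf0; apply/rowP => i; rewrite mxE.
have := congr1 (fun v : 'rV[int]_s => v ord0 i) (congr1 coord qn).
rewrite raddfMn raddf0 mulmxnE !mxE => /eqP.
by rewrite mulrn_eq0 eqn0Ngt n0 => /eqP.
Qed.

Lemma coord_mulrnI n : (0 < n)%N -> injective (fun q : Q => q *+ n).
Proof.
move=> n0 q r /eqP; rewrite -subr_eq0 -mulrnBl => /eqP/(coord_torsion_free n0)/eqP.
by rewrite subr_eq0 => /eqP.
Qed.

Variable e : 'I_s -> Q.
Hypothesis eE : forall q, q = \sum_i e i *~ coord q ord0 i.

Lemma gelt_generated (A : comNzRingType) (pi : {rmorphism grpring Q -> A})
    (P : A -> Prop) :
  P 1 -> (forall a b, P a -> P b -> P (a * b)) ->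
  (forall i, P (pi (gelt (e i)))) -> (forall i, P (pi (gelt (- e i)))) ->
  forall q, P (pi (gelt q)).
Proof.
move=> P1 PM Pe PeN q; rewrite (eE q).
elim/big_rec: _ => [|i r _ IH]; first by rewrite gelt0 rmorph1.
rewrite geltD rmorphM; apply: (PM) => //.
have PX a n : P a -> P (a ^+ n) by move=> Pa; elim: n => // n IHn; rewrite exprS; apply: PM.
case: (coord q ord0 i) => n; first by rewrite -pmulrn geltMn rmorphXn; apply: PX.
by rewrite NegzE mulrNz -mulNrz -pmulrn geltMn rmorphXn; apply: PX.
Qed.

Lemma pi_generated (A : comNzRingType) (pi : {rmorphism grpring Q -> A})
    (P : A -> Prop) :
  P 1 -> (forall a b, P a -> P b -> P (a - b)) -> (forall a b, P a -> P b -> P (a * b)) ->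
  (forall i, P (pi (gelt (e i)))) -> (forall i, P (pi (gelt (- e i)))) ->
  forall u, P (pi u).
Proof.
move=> P1 PB PM Pe PeN; elim/grpring_ind => [|u v Pu Pv|q].
- by rewrite rmorph0 -(subrr 1); apply: PB.
- by rewrite rmorphB; apply: PB.
- exact: gelt_generated.
Qed.

Lemma pi_ingen (A : idomainType) (pi : {rmorphism grpring Q -> A}) :
  (forall a, exists u, pi u = a) ->
  exists gens, forall z, ingen (GRing.RMorphism.clone int A (intmul 1) _) gens z.
Proof.
move=> pi_surj; pose gens := [seq pi (gelt (e i)) | i : 'I_s] ++ [seq pi (gelt (- e i)) | i : 'I_s].
exists gens => z.
have [R' [rho' [H1 H2 H3]]] := ingen_image gens (GRing.RMorphism.clone int A (intmul 1) _).
apply/H1; have [u <-] := pi_surj z; move: u.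
apply: (pi_generated (P := fun z => exists u, rho' u = z)) => [|a b [u <-] [v <-]|a b [u <-] [v <-]|i|i].
- by exists 1; rewrite rmorph1.
- by exists (u - v); rewrite rmorphB.
- by exists (u * v); rewrite rmorphM.
- by apply: H3; rewrite mem_cat; apply/orP; left; apply/seq.mapP; exists i => //; exact: mem_enum.
- by apply: H3; rewrite mem_cat; apply/orP; right; apply/seq.mapP; exists i => //; exact: mem_enum.
Qed.

End FreeAbelian.

(** * The degree as a norm *)

Section Norm.
Variables (Q : zmodType) (s : nat) (coord : {additive Q -> 'rV[int]_s}).
Hypothesis hcoord : bijective coord.
Variable e : 'I_s -> Q.
Hypothesis eE : forall q, q = \sum_i e i *~ coord q ord0 i.
Hypothesis e_e : forall i j, coord (e j) ord0 i = (i == j)%:R.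
Variables (A : idomainType) (pi : {rmorphism grpring Q -> A}).
Hypothesis pi_surj : forall a, exists u, pi u = a.
Hypothesis chA : forall k : int, intrm A k = 0 -> k = 0.
Hypothesis trA : forall q, q != 0 -> transcendental (intrm A) (pi (gelt q)).
Hypothesis depA : forall x y : A,
  transcendental (intrm A) x -> ~ transcendental (adj (intrm A) x) y.

Let tof := GRing.RMorphism.clone A {fraction A} (@tofrac A) _.
(** [{fraction A}] is wrapped in [fracim], so that [fracimE] presents its elements as quotients of
    images of A. *)
Let K : fieldType := fracim tof.
Let tf : {rmorphism A -> K} := gam tof.
Let xq (q : Q) : K := tf (pi (gelt q)).

Let tf_eq0 a : (tf a == 0) = (a == 0).
Proof. by rewrite gam_eq0 tofrac_eq0. Qed.

Let chK (k : int) : intrm K k = 0 -> k = 0.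
Proof.
move=> k0; apply: chA; apply/eqP; rewrite -tf_eq0; apply/eqP.
by rewrite -[RHS]k0 /= rmorph_int.
Qed.

Let trK q : q != 0 -> transcendental (intrm K) (xq q).
Proof.
move=> q0 p p0; rewrite map_polyZ_horner tf_eq0; apply: trA => //.
apply: contraNneq p0 => p0.
have -> : map_poly (intrm K) p = map_poly tf (map_poly (intrm A) p).
  by rewrite -map_poly_comp; apply: eq_map_poly => n /=; rewrite rmorph_int.
by rewrite p0 rmorph0.
Qed.

Let relK q r : q != 0 -> exists P : {poly {poly int}}, P != 0 /\
  adj (adj (intrm K) (xq q)) (xq r) P = 0.
Proof.
move=> q0; have /existsNP[P /not_implyP[P0 /negP/negPn/eqP Pr]] :=
  depA (y := pi (gelt r)) (trA q0).
exists P; split; first by apply: contraNneq P0 => ->; rewrite rmorph0.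
rewrite adjE -[RHS](rmorph0 tf) -Pr -horner_map -map_poly_comp; congr (_.[_]).
by apply: eq_map_poly => u; rewrite -(adj_int_map tf).
Qed.

Section Model.
Variables (E : fieldType) (eps : {rmorphism grpring Q -> E}).
Variables (sigma : {rmorphism E -> K}) (h : Q -> Q).
Hypothesis sigma_eps : forall q, sigma (eps (gelt q)) = xq (h q).
Hypothesis h_inj : forall q, q != 0 -> h q != 0.
Hypothesis eps_gen : forall w, w \in in_fracim eps.

(** E is generated by the image of Q, and q behaves in it as h(q) does in K: it will be K itself, or
    the common source of two embeddings into K. A subfield containing a nontrivial q has finite
    degree because each generator is algebraic over it by [depA]. *)
Lemma model_degree (F : fieldType) (iota : {rmorphism F -> E}) (t : F) q :
  q != 0 -> iota t = eps (gelt q) -> exists d, has_degree iota d.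
Proof.
move=> q0 Et.
have injF p : adj (intrm F) t p = 0 -> p = 0.
  move/(congr1 (sigma \o iota)); rewrite /= !adj_int_map !rmorph0 Et sigma_eps.
  exact: (transcendental_int (trK (h_inj q0)) chK).
apply: (@finite_degree _ _ iota _ [seq eps (gelt (e i)) | i : 'I_s]).
- move=> p; apply/negbTE/negP => /andP[p_pr /eqP p0].
  have /chK : intrm K p%:Z = 0.
    by rewrite -[LHS]/(p%:R) -(rmorph_nat (sigma \o iota)) p0 rmorph0.
  by move=> [E0]; rewrite E0 in p_pr.
- move=> x /seq.mapP[i _ ->].
  have [P [P0 EP]] := relK (h (e i)) (h_inj q0).
  exists (map_poly (adj (intrm F) t) P).
    apply: contraNneq P0 => P0; apply/eqP/polyP => j; rewrite coef0.
    by apply: injF; rewrite -coef_map P0 coef0.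
  apply/rootP/(fmorph_inj sigma); rewrite rmorph0 -EP adjE.
  rewrite -horner_map -!map_poly_comp sigma_eps; congr (_.[_]).
  by apply: eq_map_poly => u /=; rewrite !adj_int_map Et sigma_eps.
- move=> S _ Se w; have /in_fracimP[u [v [v0 ->]]] := eps_gen w.
  have Su i : eps (gelt (e i)) \in S by apply: Se; apply/seq.mapP; exists i => //; exact: mem_enum.
  have SP : forall u, eps u \in S.
    apply: (pi_generated eE (P := fun z => z \in S)) => [|a b|a b|i|i]; rewrite ?rpred1 //.
    - exact: rpredB.
    - exact: rpredM.
    - have En : eps (gelt (e i)) * eps (gelt (- e i)) = 1 by rewrite -rmorphM geltN rmorph1.
      have e0 : eps (gelt (e i)) != 0.
        by apply: contra_eq_neq En => ->; rewrite mul0r eq_sym oner_neq0.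
      have -> : eps (gelt (- e i)) = (eps (gelt (e i)))^-1.
        by apply: (mulfI e0); rewrite En mulfV.
      by rewrite rpredV.
  by rewrite rpred_div.
Qed.

Lemma model_degree_of q : q != 0 -> exists d, degree_of (eps (gelt q)) d.
Proof.
move=> q0; apply: (model_degree (t := gam _ 'X) q0).
by rewrite fracim_incl_gam adjX.
Qed.
End Model.

Let epsK : {rmorphism grpring Q -> K} := GRing.RMorphism.clone _ _ (tf \o pi) _.

Let epsK_gen w : w \in in_fracim epsK.
Proof.
apply/in_fracimP; have [a [b [b0 ->]]] := fracimE w.
have [u Eu] := pi_surj a; have [v Ev] := pi_surj b.
by exists u, v; rewrite /= Eu Ev.
Qed.

Let degree_ex q : q != 0 -> exists d, degree_of (xq q) d.
Proof.
exact: (@model_degree_of K epsK (GRing.RMorphism.clone K K idfun _) id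
  (fun=> erefl) (fun _ h => h) epsK_gen q).
Qed.

Let norm_ex q : exists n, if q == 0 then n = 0%N else degree_of (xq q) n.
Proof. by case: (eqVneq q 0) => [_|/degree_ex//]; exists 0%N. Qed.

Definition norm q : nat := sval (cid (norm_ex q)).

Let normP q : if q == 0 then norm q = 0%N else degree_of (xq q) (norm q).
Proof. exact: (svalP (cid (norm_ex q))). Qed.

Let norm0 : norm 0 = 0%N. Proof. by have := normP 0; rewrite eqxx. Qed.

Let norm_degree q : q != 0 -> degree_of (xq q) (norm q).
Proof. by have := normP q; case: eqP. Qed.

Let normE q d : q != 0 -> degree_of (xq q) d -> norm q = d.
Proof. by move=> /norm_degree; exact: has_degree_uniq. Qed.

Let xqD q r : xq (q + r) = xq q * xq r.
Proof. by rewrite /xq geltD !rmorphM. Qed.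

Let xqMn q n : xq (q *+ n) = xq q ^+ n.
Proof. by rewrite /xq geltMn !rmorphXn. Qed.

Let normMn q n : norm (q *+ n) = (n * norm q)%N.
Proof.
have [->|q0] := eqVneq q 0; first by rewrite mul0rn norm0 muln0.
case: n => [|n]; first by rewrite mulr0n norm0.
apply: normE; first by apply: contra_neq q0; exact: (coord_torsion_free hcoord).
rewrite xqMn; exact: (degree_of_power (trK q0) _ chK (norm_degree q0)).
Qed.

Let normD q r : (norm (q + r)%R <= norm q + norm r)%N.
Proof.
have [->|q0] := eqVneq q 0; first by rewrite add0r leq_addl.
have [->|r0] := eqVneq r 0; first by rewrite addr0 leq_addr.
have [->|qr0] := eqVneq (q + r) 0; first by rewrite norm0.
have [P [P0 EP]] := relK r q0.
have := norm_degree qr0; rewrite xqD => dqr.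
apply: (degree_subadditive chK (trK q0) (trK r0) _ P0 EP _ _ dqr).
- by rewrite -xqD; exact: trK.
- exact: norm_degree.
- exact: norm_degree.
apply: (@model_degree K epsK (GRing.RMorphism.clone K K idfun _) id
  (fun=> erefl) (fun _ h => h) epsK_gen _ _ (gam _ ('X)%:P) q q0).
by rewrite fracim_incl_gam adjC adjX.
Qed.

Let norm_gt0 q : q != 0 -> (0 < norm q)%N.
Proof. by move=> /norm_degree; exact: has_degree_gt0. Qed.

Section Endomorphism.
Variables (N : nat) (g : Q -> Q) (thN thg : {rmorphism grpring Q -> A}).
Hypotheses (N0 : (0 < N)%N) (gB : {morph g : q r / q - r}).
Hypothesis g_inj : forall q, q != 0 -> g q != 0.
Hypothesis thNE : forall q, thN (gelt q) = pi (gelt (q *+ N)).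
Hypothesis thgE : forall q, thg (gelt q) = pi (gelt (g q)).
Hypothesis ker_sub : forall u, thN u = 0 -> thg u = 0.

Let Nq0 (q : Q) : q != 0 -> q *+ N != 0.
Proof. by apply: contra_neq; exact: (coord_torsion_free hcoord). Qed.

Let thN_lift (x v : A) (w : {poly {poly int}}) :
  (exists u, thN u = x) -> (exists u, thN u = v) ->
  exists u, thN u = adj (adj (intrm A) x) v w.
Proof.
move=> [ux Ex] [uv Ev]; elim/poly_ind: w => [|w c [u Eu]].
  by exists 0; rewrite !rmorph0.
exists (u * uv + (map_poly (intrm _) c).[ux]).
rewrite !rmorphD !rmorphM adjX adjC Eu Ev; congr (_ + _).
by rewrite -map_polyZ_horner Ex.
Qed.

(* An element of the kernel of thg algebraic over Z[x] divides a nonzero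
   polynomial in x, which thg cannot kill as x is transcendental. *)
Lemma ker_eq (q1 : Q) u : q1 != 0 -> thg u = 0 -> thN u = 0.
Proof.
move=> q10 gu; apply/eqP; apply: contraT => v0.
pose x := pi (gelt (q1 *+ N)).
have trx := trA (Nq0 q10).
have /existsNP[P /not_implyP[P0 /negP/negPn/eqP Pr]] := depA (y := thN u) trx.
have [w [c [c0 Ew]]] := multiple_in_base P0 Pr v0.
have [W EW] : exists W, thN W = adj (adj (intrm A) x) (thN u) w.
  by apply: thN_lift; [exists (gelt q1); rewrite thNE | exists u].
pose C := (map_poly (intrm (grpring Q)) c).[gelt q1].
have : thN (u * W - C) = 0.
  rewrite rmorphB rmorphM EW Ew -map_polyZ_horner thNE.
  by rewrite -adjE subrr.
move/ker_sub; rewrite rmorphB rmorphM gu mul0r sub0r => /eqP.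
rewrite oppr_eq0 -map_polyZ_horner thgE -adjE => /eqP.
move/(transcendental_int (trA (g_inj q10)) chA) => cE.
by rewrite cE rmorph0 eqxx in c0.
Qed.

Lemma endomorphism_power (q1 : Q) : q1 != 0 -> exists k a b,
  [/\ (0 < k)%N, (0 < a)%N, (0 < b)%N &
   forall q, iter k g q *+ (a ^ k) = q *+ ((N * b) ^ k)].
Proof.
move=> q10.
pose al : {rmorphism grpring Q -> K} := GRing.RMorphism.clone _ _ (tf \o thN) _.
pose be : {rmorphism grpring Q -> K} := GRing.RMorphism.clone _ _ (tf \o thg) _.
have alE q : al (gelt q) = xq (q *+ N) by rewrite /= thNE.
have beE q : be (gelt q) = xq (g q) by rewrite /= thgE.
have ab u : (al u == 0) = (be u == 0).
  rewrite /= !tf_eq0; apply/eqP/eqP; [exact: ker_sub | exact: ker_eq q10].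
have [j jE] := fracim_lift ab.
pose inc := fracim_incl al.
have [a da] : exists a, has_degree inc a.
  apply: (@model_degree K epsK (GRing.RMorphism.clone K K idfun _) id
    (fun=> erefl) (fun _ h => h) epsK_gen _ _ (gam al (gelt q1)) _ (Nq0 q10)).
  by rewrite /inc fracim_incl_gam alE.
have [b db] : exists b, has_degree j b.
  apply: (@model_degree K epsK (GRing.RMorphism.clone K K idfun _) id
    (fun=> erefl) (fun _ h => h) epsK_gen _ _ (gam al (gelt q1)) _ (g_inj q10)).
  by rewrite jE beE.
(* With n the degree of the common source over the field generated by q, the embeddings [inc] and
   [j] give |N q| = n a and |g(q)| = n b, while |N q| = N |q|. *)
have norm_g q : (norm (g q) * a = norm q * (N * b))%N.
  have [->|q0] := eqVneq q 0.
    by have -> : g 0 = 0; [rewrite -{1}(subrr 0) gB subrr | rewrite norm0].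
  have [|||n dn] := @model_degree_of _ (gam al) inc (fun q => q *+ N) _ _ _ q q0.
  - by move=> r; rewrite /inc fracim_incl_gam alE.
  - exact: Nq0.
  - by move=> w; apply/in_fracimP; have [u [v ?]] := fracimE w; exists u, v.
  have Ea : norm (q *+ N) = (n * a)%N.
    apply: normE; first exact: Nq0.
    by have := degree_of_comp da dn; rewrite /inc fracim_incl_gam alE.
  have Eb : norm (g q) = (n * b)%N.
    apply: normE; first exact: g_inj.
    by have := degree_of_comp db dn; rewrite jE beE.
  by rewrite Eb mulnA [(norm q * N)%N]mulnC -normMn Ea mulnAC.
have a0 := has_degree_gt0 da; have b0 := has_degree_gt0 db.
have coB i : {morph (fun q => coord q ord0 i) : q r / q - r}.
  by move=> q r /=; rewrite raddfB !mxE.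
have sub_norm : sublinear (fun q => (norm q)%:Z).
  split=> [q r|n q]; first by rewrite -PoszD lez_nat normD.
  by rewrite normMn PoszM mulrC -mulrzz -pmulrn.
have Nb0 : (0 < N * b)%N by rewrite muln_gt0 N0.
have hg q : (norm (g q))%:Z * a%:Z = (norm q)%:Z * (N * b)%N%:Z by rewrite -!PoszM norm_g.
have [k k0 Ek] := isometry_power coB eE e_e sub_norm gB Nb0 a0 hg norm_gt0.
by exists k, a, b; split.
Qed.

End Endomorphism.
End Norm.

(** * Ideals of finite index *)

Section IsolatedSubgroups.
Variable Q : zmodType.

(** Apart from the empty case, a proper subgroup with torsion-free quotient. *)
Definition isolated (T : Q -> Prop) :=
  [/\ forall x y, T x -> T y -> T (x - y),
      forall x n, (0 < n)%N -> T (x *+ n) -> T x & exists x, ~ T x].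

Lemma isolatedMn T x n : isolated T -> T x -> T (x *+ n).
Proof.
move=> [TB _ _] Tx; have T0 : T 0 by rewrite -(subrr x); apply: TB.
have TN y : T y -> T (- y) by move=> Ty; rewrite -sub0r; apply: TB.
have TD y z : T y -> T z -> T (y + z).
  by move=> Ty Tz; rewrite -[z]opprK; apply/TB/TN.
by elim: n => // n IH; rewrite mulrSr; apply: TD.
Qed.

Lemma avoid_isolated (Ts : seq (Q -> Prop)) :
  (forall i, (i < size Ts)%N -> isolated (nth (fun=> False) Ts i)) ->
  exists x, forall i, (i < size Ts)%N -> ~ nth (fun=> False) Ts i x.
Proof.
(* If x avoids Ts but lies in T and y avoids T, then c x + y avoids both for some c. *)
elim: Ts => [|T Ts IH] iso; first by exists 0.
have [|x Hx] := IH; first by move=> i; exact: (iso i.+1).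
have isoT := iso 0%N isT; rewrite /= in isoT.
have [Tx|nTx] := pselect (T x); last first.
  by exists x => -[|i] //= ilt; exact: Hx.
have [TB Tn [y ny]] := isoT.
have notT c : ~ T (x *+ c + y).
  move=> Tc; apply: ny; rewrite -[y](addKr (x *+ c)) addrC.
  by apply: TB => //; exact: isolatedMn.
suff [c Hc] : exists c, forall i, (i < size Ts)%N ->
    ~ nth (fun=> False) Ts i (x *+ c + y).
  by exists (x *+ c + y) => -[|i] //= ilt; exact: Hc.
suff [c Hc] : exists c, forall d i, (c <= d)%N -> (i < size Ts)%N ->
    ~ nth (fun=> False) Ts i (x *+ d + y).
  by exists c => i; exact: Hc.
(* For each subgroup at most one c fails: two of them would put a multiple of x, hence x, into
   it. *)
have ex i : exists c, forall d, (c <= d)%N -> (i < size Ts)%N ->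
    ~ nth (fun=> False) Ts i (x *+ d + y).
  have [ilt|?] := ltnP i (size Ts); last by exists 0%N.
  have [UB Un _] := iso i.+1 ilt; rewrite /= in UB Un.
  have [[c Uc]|nU] := pselect (exists c, nth (fun=> False) Ts i (x *+ c + y)); last first.
    by exists 0%N => d _ _ Ud; apply: nU; exists d.
  exists c.+1 => d ltcd _ Ud; apply: (Hx i ilt).
  apply: (Un x (d - c)%N); first by rewrite subn_gt0.
  have := UB _ _ Ud Uc; rewrite opprD addrACA subrr addr0.
  by rewrite mulrnBr // ltnW.
have /choice[c Hc] := ex.
exists (\max_(i < size Ts) c i)%N => d i led ilt.
apply: Hc => //; apply: leq_trans led.
exact: (leq_bigmax (Ordinal ilt)).
Qed.

(** By pigeonhole some (j - i) q with 0 < j - i <= [size r] lies in H, and the factorial is a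
    multiple of all these differences. *)
Lemma finite_index_exponent (H : {pred Q}) : zmod_closed H -> finite_index H predT ->
  exists2 N, (0 < N)%N & forall q, q *+ N \in H.
Proof.
move=> [H0 HB] [_ [r Hr]]; exists (size r)`!; first exact: fact_gt0.
move=> q.
have HN x : x \in H -> - x \in H by move=> Hx; rewrite -sub0r; apply: HB.
have HM x n : x \in H -> x *+ n \in H.
  move=> Hx; elim: n => // n IH; rewrite mulrSr -[x *+ n + x]/(x *+ n + x).
  by have := HB _ _ IH (HN _ Hx); rewrite opprK.
have /choice[c Hc] : forall n, exists i, (i < size r)%N /\ q *+ n - nth 0 r i \in H.
  move=> n; have [y /(nthP 0)[i ilt <-] Hi] := Hr (q *+ n) isT.
  by exists i.
have /injectivePn[i [j ij Eij]] : ~~ injectiveb (fun n : 'I_(size r).+1 => Ordinal (Hc n).1).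
  by apply/negP => /injectiveP/leq_card; rewrite !card_ord ltnn.
wlog ltij : i j ij Eij / (i < j)%N.
  move=> W; case: (ltngtP i j) => [l|l|/val_inj E]; first exact: (W i j).
    by apply: (W j i) => //; rewrite eq_sym.
  by rewrite E eqxx in ij.
have Hij : q *+ (j - i) \in H.
  have := HB _ _ (Hc j).2 (Hc i).2; have [->] := Eij.
  by rewrite opprB addrA subrK -mulrnBr // ltnW.
have /dvdnP[k ->] : (j - i %| (size r)`!)%N.
  by apply: dvdn_fact; have := ltn_ord j; lia.
by rewrite mulnC mulrnA; apply: HM.
Qed.
End IsolatedSubgroups.

Section FiniteQuotient.
Variables (Q : zmodType) (s : nat) (coord : {additive Q -> 'rV[int]_s}).
Variable e : 'I_s -> Q.
Hypothesis eE : forall q, q = \sum_i e i *~ coord q ord0 i.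
Variables (A : comNzRingType) (pi : {rmorphism grpring Q -> A}).
Hypothesis pi_surj : forall a, exists u, pi u = a.
Variables (J : set A) (p : nat).
Hypotheses (idJ : ideal_set J) (p0 : (0 < p)%N) (Jp : J p%:R).
Hypothesis ordJ : forall i, exists2 N, (0 < N)%N & J (pi (gelt (e i)) ^+ N - 1).

Let eqJ a b := J (a - b).
Let J0 : J 0. Proof. by case: idJ. Qed.
Let JN a : J a -> J (- a).
Proof. by move=> Ja; rewrite -sub0r; apply: (ideal_setB idJ). Qed.
Let eqJ_refl a : eqJ a a. Proof. by rewrite /eqJ subrr. Qed.
Let eqJ_sym a b : eqJ a b -> eqJ b a.
Proof. by move=> /JN; rewrite opprB. Qed.
Let eqJ_trans b a c : eqJ a b -> eqJ b c -> eqJ a c.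
Proof. by move=> ab bc; rewrite /eqJ -(subrK b a) -addrA; apply: (ideal_setD idJ). Qed.
Let eqJM a b c d : eqJ a b -> eqJ c d -> eqJ (a * c) (b * d).
Proof.
move=> ab cd; rewrite /eqJ.
have -> : a * c - b * d = c * (a - b) + b * (c - d).
  by rewrite !mulrBr [c * a]mulrC [c * b]mulrC addrA subrK.
by apply: (ideal_setD idJ); apply: ideal_setM.
Qed.
Let eqJB a b c d : eqJ a b -> eqJ c d -> eqJ (a - c) (b - d).
Proof.
move=> ab cd; rewrite /eqJ.
have -> : a - c - (b - d) = (a - b) - (c - d).
  by rewrite !opprB addrACA [RHS]addrACA; congr (_ + _); rewrite addrC.
exact: ideal_setB.
Qed.
Let eqJX a b n : eqJ a b -> eqJ (a ^+ n) (b ^+ n).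
Proof. by move=> ab; elim: n => [|n IH]; rewrite ?expr0 // !exprS; apply: eqJM. Qed.

Let common_order : exists2 N, (0 < N)%N & forall i, eqJ (pi (gelt (e i)) ^+ N) 1.
Proof.
have /choice[N HN] : forall i, exists N, (0 < N)%N /\ J (pi (gelt (e i)) ^+ N - 1).
  by move=> i; have [N] := ordJ i; exists N.
exists (\prod_i N i)%N.
  by rewrite prodn_gt0 // => i; case: (HN i).
move=> i; rewrite (bigD1 i) //= exprM -[X in eqJ _ X](expr1n _ (\prod_(j | j != i) N j)%N).
by apply: eqJX; case: (HN i).
Qed.

Lemma finite_quotient : exists r : seq A, forall a, exists2 y, y \in r & J (a - y).
Proof.
have [N N0 HN] := common_order.
(* [N.-1.+1] equals N and is visibly a successor, as [inord] requires. *)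
pose F : finType := {ffun 'I_s -> 'I_N.-1.+1}.
pose mono (t : F) : A := \prod_i pi (gelt (e i)) ^+ t i.
pose G : finType := {ffun F -> 'I_p.-1.+1}.
exists [seq \sum_t (c t)%:R * mono t | c : G] => a.
have [u <-] := pi_surj a.
suff [c Hc] : exists c : F -> int, eqJ (pi u) (\sum_t (c t)%:~R * mono t).
  pose d : G := [ffun t => inord `|(c t %% p%:Z)%Z|%N].
  exists (\sum_t (d t)%:R * mono t); first by apply/seq.mapP; exists d => //; exact: mem_enum.
  apply: (eqJ_trans Hc); rewrite /eqJ -sumrB; apply: (big_ind J) => //.
    by move=> x y; exact: ideal_setD.
  move=> t _; rewrite -mulrBl mulrC; apply: ideal_setM => //.
  have pz : p%:Z != 0 by lia.
  have Ed : (d t)%:Z = (c t %% p%:Z)%Z.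
    rewrite ffunE inordK; first by rewrite gez0_abs // modz_ge0.
    by rewrite prednK // -ltz_nat gez0_abs ?modz_ge0 // ltz_pmod.
  rewrite -[(d t)%:R]/((d t)%:Z%:~R) Ed {1}(divz_eq (c t) p) -rmorphB addrK rmorphM.
  exact: ideal_setM.
elim/grpring_ind: u => [|u v [c Hc] [d Hd]|q].
- by exists (fun=> 0); rewrite rmorph0 big1 // => t _; rewrite mul0r.
- exists (fun t => c t - d t); rewrite rmorphB.
  have -> : \sum_t (c t - d t)%:~R * mono t =
      \sum_t (c t)%:~R * mono t - \sum_t (d t)%:~R * mono t.
    by rewrite -sumrB; apply: eq_bigr => t _; rewrite rmorphB mulrBl.
  exact: eqJB.
have Nz : N%:Z != 0 by lia.
pose t0 : F := [ffun i => inord `|(coord q ord0 i %% N%:Z)%Z|%N].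
exists (fun t => (t == t0)%:R); rewrite (bigD1 t0) //= eqxx mul1r big1 ?addr0; last first.
  by move=> t /negbTE ->; rewrite mul0r.
rewrite {1}(eE q) /mono.
have geltS : {morph (fun x : Q => pi (gelt x)) : x y / x + y >-> x * y}.
  by move=> x y; rewrite geltD rmorphM.
rewrite (big_morph _ geltS (etrans (congr1 pi (gelt0 Q)) (rmorph1 pi))).
apply: (big_ind2 eqJ) => [|a1 a2 b1 b2|i _]; [exact: eqJ_refl|exact: eqJM|].
set z := coord q ord0 i.
have Et : (t0 i)%:Z = (z %% N%:Z)%Z.
  rewrite ffunE inordK; first by rewrite gez0_abs // modz_ge0.
  by rewrite prednK // -ltz_nat gez0_abs ?modz_ge0 // ltz_pmod.
rewrite {1}(divz_eq z N) -Et mulrzDr geltD rmorphM -pmulrn geltMn rmorphXn.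
rewrite -[X in eqJ _ X]mul1r; apply: eqJM => //.
have powN n : eqJ (pi (gelt (e i *+ (n * N)))) 1.
  rewrite geltMn rmorphXn mulnC exprM -(expr1n A n); exact: eqJX.
rewrite mulrC; case: (z %/ N)%Z => n.
  by rewrite -PoszM -pmulrn mulnC; exact: powN.
have := powN n.+1; rewrite NegzE mulrN mulrNz -PoszM -pmulrn mulnC.
set y := e i *+ _ => y1.
have := eqJM y1 (eqJ_refl (pi (gelt (- y)))).
by rewrite mul1r -rmorphM geltN rmorph1 => /eqJ_sym.
Qed.
End FiniteQuotient.

(** * Morphisms between group rings of power subgroups *)

Lemma rmorph_factor (R X Y : comNzRingType) (al : {rmorphism R -> X})
    (be : {rmorphism R -> Y}) :
  (forall x, exists u, al u = x) -> (forall u, al u = 0 -> be u = 0) ->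
  exists phi : {rmorphism X -> Y}, forall u, phi (al u) = be u.
Proof.
move=> /choice[sec alK] ker; pose phi x := be (sec x).
have phiE u : phi (al u) = be u.
  apply/eqP; rewrite -subr_eq0 -rmorphB; apply/eqP/ker.
  by rewrite rmorphB alK subrr.
have phiB : zmod_morphism phi.
  by move=> x y; rewrite -(alK x) -(alK y) -rmorphB !phiE rmorphB.
have phiM : monoid_morphism phi.
  split; first by rewrite -(rmorph1 al) phiE rmorph1.
  by move=> x y; rewrite -(alK x) -(alK y) -rmorphM !phiE rmorphM.
pose phiR : {rmorphism X -> Y} := HB.pack phi
  (GRing.isZmodMorphism.Build _ _ phi phiB) (GRing.isMonoidMorphism.Build _ _ phi phiM).
by exists phiR.
Qed.

Section PowerSubring.
Variables (Q : zmodType) (I : idealr (grpring Q)) (s : nat) (e : 'I_s -> Q).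
Hypothesis eE : forall q, exists k : 'I_s -> int, q = \sum_i e i *~ k i.
Variables (n : nat) (push : {rmorphism grpring Q -> grpring Q}).
Hypothesis pushE : forall q, push (gelt q) = gelt (q *+ n).

Local Notation H := (gen_subgroup (fun j => e j *+ n)).

Lemma mem_multiple q : (q *+ n \in H) /\ (q \in H -> exists r, q = r *+ n).
Proof.
split.
  have [k ->] := eE q; apply/gen_subgroupP; exists k.
  by rewrite -sumrMnl; apply: eq_bigr => i _; rewrite !pmulrn mulrzAC.
move=> /gen_subgroupP[k ->]; exists (\sum_i e i *~ k i).
by rewrite -sumrMnl; apply: eq_bigr => i _; rewrite !pmulrn mulrzAC.
Qed.

Lemma mem_push v : push v \in grpring_on H.
Proof.
elim/grpring_ind: v => [|u v Hu Hv|q]; first by rewrite rmorph0 rpred0.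
  by rewrite rmorphB rpredB.
by rewrite pushE; apply: gelt_on; case: (mem_multiple q).
Qed.

Lemma push_onto w : w \in grpring_on H -> exists v, push v = w.
Proof.
move=> /allP Hw; rewrite [w]monalgE big_seq.
apply: (big_ind (fun w => exists v, push v = w)).
- by exists 0; rewrite rmorph0.
- by move=> _ _ [u <-] [v <-]; exists (u + v); rewrite rmorphD.
- move=> k kw; have [r Er] := (mem_multiple k).2 (Hw k kw).
  by exists (gelt r *~ w@_k); rewrite rmorphMz pushE mkmalgU_gelt Er.
Qed.

(** ZQ serves as a model of the group ring of the n-th powers, through [push]. A morphism between
    two such quotients then amounts to an inclusion of kernels in ZQ. *)
Lemma class_morphism : exists cl : {rmorphism grpring Q -> subquot H I},
  [/\ forall x, exists v, cl v = x, forall v, (cl v == 0) = (push v \in I) &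
      forall i, cl (gelt (e i)) = power_class I e (fun=> n) i].
Proof.
pose f v : subgrpring H := SubGrpring (mem_push v).
have fB : zmod_morphism f.
  by move=> u v; apply/val_inj; rewrite raddfB /= rmorphB.
have fM : monoid_morphism f.
  by split=> [|u v]; apply/val_inj; rewrite ?rmorph1 ?rmorphM /= ?rmorph1 ?rmorphM.
pose fR : {rmorphism grpring Q -> subgrpring H} := HB.pack f
  (GRing.isZmodMorphism.Build _ _ f fB) (GRing.isMonoidMorphism.Build _ _ f fM).
pose piq := GRing.RMorphism.clone (subgrpring H) (subquot H I)
  (\pi_({ideal_quot (restr_ideal I : {pred subgrpring H})})%qT) _.
exists (GRing.RMorphism.clone _ _ (piq \o fR) _); split.
- move=> x; have [v Ev] := push_onto (sgvalP (repr x)).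
  exists v; rewrite /= -[RHS]reprK; congr (\pi_ _ _)%qT.
  by apply/val_inj; rewrite /= Ev.
- move=> v; rewrite -(rmorph0 piq) /=.
  rewrite -(Quotient.idealrBE (restr_ideal I : {pred subgrpring H})) subr0.
  by rewrite inE.
- move=> i; rewrite /= /power_class /subquot_elt; congr (\pi_ _ _)%qT.
  by apply/val_inj; rewrite /= pushE.
Qed.
End PowerSubring.

Lemma power_morphism (Q : zmodType) (I : idealr (grpring Q)) (s : nat) (e : 'I_s -> Q)
    (n c : nat) (pn pc : {rmorphism grpring Q -> grpring Q}) :
  (forall q, exists k : 'I_s -> int, q = \sum_i e i *~ k i) ->
  (forall q, pn (gelt q) = gelt (q *+ n)) -> (forall q, pc (gelt q) = gelt (q *+ c)) ->
  (forall v, pn v \in I -> pc v \in I) ->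
  exists phi : {rmorphism subquot (gen_subgroup (fun j => e j *+ n)) I ->
                          subquot (gen_subgroup (fun j => e j *+ c)) I},
    forall i, phi (power_class I e (fun=> n) i) = power_class I e (fun=> c) i.
Proof.
move=> eE pnE pcE ker.
have [cln [cln_onto cln0 clnE]] := class_morphism I eE pnE.
have [clc [clc_onto clc0 clcE]] := class_morphism I eE pcE.
have [|phi phiE] := rmorph_factor (al := cln) (be := clc) cln_onto.
  by move=> u /eqP; rewrite cln0 => /ker; rewrite -clc0 => /eqP.
by exists phi => i; rewrite -clnE phiE clcE.
Qed.

(** Since y permutes the finite group A/A_0, two of the elements b y^i with i <= [size r] agree
    modulo A_0, and the smaller power of y cancels. The factorial makes N independent of y and b. *)
Lemma unit_power_index (A : idomainType) (A0 : {pred A}) :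
  zmod_closed A0 -> finite_index A0 predT ->
  exists2 N, (0 < N)%N & forall y y' b : A, y * y' = 1 ->
    (forall a, a \in A0 -> a * y \in A0) -> (forall a, a \in A0 -> a * y' \in A0) ->
    b * (y ^+ N - 1) \in A0.
Proof.
move=> [H0 HB] [_ [r Hr]]; exists (size r)`!; first exact: fact_gt0.
move=> y y' b yy' Hy Hy'.
have HN x : x \in A0 -> - x \in A0 by move=> Hx; rewrite -sub0r; apply: HB.
have HD x z : x \in A0 -> z \in A0 -> x + z \in A0.
  by move=> Hx Hz; rewrite -[z]opprK; apply: HB => //; apply: HN.
have HX z x n : (forall a, a \in A0 -> a * z \in A0) -> x \in A0 -> x * z ^+ n \in A0.
  by move=> Hz Hx; elim: n => [|n IH]; rewrite ?expr0 ?mulr1 // exprSr mulrA; apply: Hz.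
have /choice[c Hc] : forall n, exists i, (i < size r)%N /\ b * y ^+ n - nth 0 r i \in A0.
  move=> n; have [z /(nthP 0)[i ilt <-] Hi] := Hr (b * y ^+ n) isT.
  by exists i.
have /injectivePn[i [j ij Eij]] : ~~ injectiveb (fun n : 'I_(size r).+1 => Ordinal (Hc n).1).
  by apply/negP => /injectiveP/leq_card; rewrite !card_ord ltnn.
wlog ltij : i j ij Eij / (i < j)%N.
  move=> W; case: (ltngtP i j) => [l|l|/val_inj E]; first exact: (W i j).
    by apply: (W j i) => //; rewrite eq_sym.
  by rewrite E eqxx in ij.
have Hij : b * (y ^+ (j - i) - 1) \in A0.
  have -> : b * (y ^+ (j - i) - 1) = (b * y ^+ j - b * y ^+ i) * y' ^+ i.
    rewrite -mulrBr -mulrA mulrBl -exprMn yy' expr1n; congr (_ * (_ - _)).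
    by rewrite -{2}(subnK (ltnW ltij)) exprD -mulrA -exprMn yy' expr1n mulr1.
  apply: HX => //; have := HB _ _ (Hc j).2 (Hc i).2; have [->] := Eij.
  by rewrite opprB addrA subrK.
have /dvdnP[k ->] : (j - i %| (size r)`!)%N.
  by apply: dvdn_fact; have := ltn_ord j; lia.
rewrite mulnC exprM -[1](expr1n A k) subrXX mulrA mulr_sumr.
apply: (big_ind (fun x => x \in A0)) => // t _.
by rewrite expr1n mulr1 -exprM; apply: HX.
Qed.

(** * The ideal generated by m and a product of elements x^N - 1 *)

Section TwoGeneratorIdeal.
Variables (Q : zmodType) (s : nat) (coord : {additive Q -> 'rV[int]_s}).
Variable e : 'I_s -> Q.
Hypothesis eE : forall q, q = \sum_i e i *~ coord q ord0 i.
Variables (A : idomainType) (pi : {rmorphism grpring Q -> A}).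
Hypothesis pi_surj : forall a, exists u, pi u = a.
Hypothesis tfA : forall (a : A) (n : nat), (0 < n)%N -> a *+ n = 0 -> a = 0.
Hypothesis dimA : forall P l, @prime_chain A P l -> (l <= 2)%N.
Hypothesis h2 : forall p : nat, prime p ->
     exists (B : idomainType) (g : {rmorphism A -> B}),
       is_quotient [set a | exists b, a = b *+ p] g /\
       infinite_set [set: B].

Lemma mulrnAI (n : nat) : (0 < n)%N -> injective (fun a : A => a *+ n).
Proof.
move=> n0 a b /eqP; rewrite -subr_eq0 -mulrnBl => /eqP/(tfA n0)/eqP.
by rewrite subr_eq0 => /eqP.
Qed.

Definition div_by (p : nat) (a : A) := exists b, a = b *+ p.

Lemma div_by_prime p a b : prime p -> div_by p (a * b) -> div_by p a \/ div_by p b.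
Proof.
move=> /h2[B [g [[_ gk] _]]] /gk /eqP; rewrite rmorphM mulf_eq0.
by case/orP => /eqP/gk; [left|right].
Qed.

Lemma div_by_ideal p : ideal_set (div_by p).
Proof.
split; first by exists 0; rewrite mul0rn.
by move=> a _ _ [b ->] [c ->]; exists (a * b + c); rewrite mulrnDl mulrnAr.
Qed.

Definition finord p q := exists2 n, (0 < n)%N & div_by p (pi (gelt q) ^+ n - 1).

Lemma div_by_exprM p (a : A) n k : div_by p (a ^+ n - 1) -> div_by p (a ^+ (n * k) - 1).
Proof.
move=> d; rewrite exprM -[1](expr1n A k) subrXX mulrC.
exact: ideal_setM (div_by_ideal p) d.
Qed.

(** Properness is where the infinity of A/pA enters: if every element of Q had finite order modulo
    p, [finite_quotient] would make A/pA finite. *)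
Lemma finord_isolated p : prime p -> isolated (finord p).
Proof.
move=> p_pr; split.
- move=> x y [n n0 dx] [m m0 dy]; exists (n * m)%N; first by rewrite muln_gt0 n0.
  have -> : pi (gelt (x - y)) ^+ (n * m) - 1 =
      pi (gelt (- y)) ^+ (n * m) * ((pi (gelt x) ^+ (n * m) - 1) -
                                   (pi (gelt y) ^+ (n * m) - 1)).
    rewrite opprB addrA subrK mulrBr -!exprMn -!rmorphM -!geltD addNr gelt0 rmorph1 expr1n.
    by rewrite [- y + x]addrC.
  apply: ideal_setM (div_by_ideal p) _; apply: ideal_setB (div_by_ideal p) _ _.
    exact: div_by_exprM.
  by rewrite mulnC; exact: div_by_exprM.
- move=> x n n0 [m m0 d]; exists (n * m)%N; first by rewrite muln_gt0 n0.
  by rewrite exprM -rmorphXn -geltMn.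
- apply: contrapT => nall.
  have fin q : finord p q by apply: contrapT => nq; apply: nall; exists q.
  have [B [g [[gs gk] []]]] := h2 p_pr.
  have pJ : div_by p p%:R by exists 1.
  have [|r Hr] := finite_quotient eE pi_surj (div_by_ideal p) (prime_gt0 p_pr) pJ.
    by move=> i; exact: fin.
  apply: (sub_finite_set _ (finite_seq [seq g y | y <- r])) => b _ /=.
  have [a <-] := gs b; have [y yr] := Hr a; rewrite -/(div_by _ _) => /gk /eqP.
  by rewrite rmorphB subr_eq0 => /eqP ->; apply/seq.mapP; exists y.
Qed.

Lemma finord_multiple p q n : prime p -> (0 < n)%N -> ~ finord p q -> ~ finord p (q *+ n).
Proof. by move=> p_pr n0 nq /(let: And3 _ H _ := finord_isolated p_pr in H q n n0). Qed.

(** Induction on the prime factors of m. For p dividing m, the quotient by (p, mu) is finite by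
    [algebraic_mod] and [finite_order_mod]; writing a = y + p b + mu c, the induction hypothesis for
    m / p reduces b. *)
Lemma finite_two_gen (m : nat) (mu : A) : (0 < m)%N ->
  (forall p, prime p -> (p %| m)%N -> ~ div_by p mu) ->
  exists r : seq A, forall a, exists2 y, y \in r & a - y \in two_gen_ideal m mu.
Proof.
have [gens genA] := pi_ingen eE pi_surj.
elim/ltn_ind: m => m IH m0 Hm.
have [m1|m1] := leqP m 1.
  have -> : m = 1%N by lia.
  exists [:: 0] => a; exists 0; rewrite ?mem_head //; apply/asboolP.
  by exists a, 0; rewrite subr0 mulr1n mulr0 addr0.
have p_pr := pdiv_prime m1; set p := pdiv m in p_pr.
have pm : (p %| m)%N := pdiv_dvd m.
pose J : set A := [set a | exists b c, a = b *+ p + mu * c].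
have idJ : ideal_set J.
  split; first by exists 0, 0; rewrite mul0rn mulr0 addr0.
  move=> a u v [b [c ->]] [b' [c' ->]]; exists (a * b + b'), (a * c + c').
  by rewrite mulrDr mulrnAr mulrnDl mulrDr addrACA mulrCA.
have Jp : J p%:R by exists 1, 0; rewrite mulr0 addr0.
have [B0 [g0 [[_ g0P] _]]] := h2 p_pr.
have mu0 : g0 mu != 0 by apply/eqP => /g0P; exact: Hm.
have pA0 : p%:R != 0 :> A.
  apply/eqP => p0; have /eqP := tfA (prime_gt0 p_pr) p0.
  by rewrite oner_eq0.
have ordJ i : exists2 N, (0 < N)%N & J (pi (gelt (e i)) ^+ N - 1).
  have [f [f0 Jf]] := algebraic_mod p_pr genA dimA g0P pA0 (pi (gelt (e i))) mu0.
  apply: (finite_order_mod p_pr idJ Jp (x' := pi (gelt (- e i))) _ f0 Jf).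
  by rewrite -rmorphM geltN rmorph1.
have [r Hr] := finite_quotient eE pi_surj idJ (prime_gt0 p_pr) Jp ordJ.
have [||q q_pr qm|r' Hr'] := IH (m %/ p)%N.
- by rewrite ltn_Pdiv // prime_gt1.
- by rewrite divn_gt0 ?prime_gt0 // dvdn_leq.
- by apply: Hm => //; apply: dvdn_trans qm (dvdn_div pm).
exists [seq y + y' *+ p | y <- r, y' <- r'] => a.
have [y yr [b [c Ea]]] := Hr a.
have [y' y'r /asboolP[b' [c' Eb]]] := Hr' b.
exists (y + y' *+ p); first exact: allpairs_f.
apply/asboolP; exists b', (c + c' *+ p).
rewrite opprD addrA Ea -{1}(subrK y' b) Eb !mulrnDl -mulrnA divnK //.
by rewrite mulrDr mulrnAr addrAC addrK -addrA [mu * c + _]addrC.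
Qed.

Variables (Q0 : zmodClosed Q) (A0 : {pred A}).
Hypothesis hA0 : is_submodule pi (grpring_on Q0) A0.
Variables (m N : nat).
Hypotheses (m0 : (0 < m)%N) (Am : forall a, a *+ m \in A0).
Hypothesis AN : forall y y' b : A, y * y' = 1 ->
    (forall a, a \in A0 -> a * y \in A0) -> (forall a, a \in A0 -> a * y' \in A0) ->
    b * (y ^+ N - 1) \in A0.
Hypothesis N0 : (0 < N)%N.

Let A0_0 : 0 \in A0. Proof. by case: hA0 => [[]]. Qed.
Let A0_B a b : a \in A0 -> b \in A0 -> a - b \in A0.
Proof. by case: hA0 => [[_]] H _; exact: H. Qed.
Let A0_D a b : a \in A0 -> b \in A0 -> a + b \in A0.
Proof. by move=> Ha Hb; rewrite -[b]opprK A0_B // -sub0r A0_B. Qed.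
Let A0_M a q : a \in A0 -> q \in Q0 -> a * pi (gelt q) \in A0.
Proof. by case: hA0 => _ H Ha Hq; apply: H => //; exact: gelt_on. Qed.

Definition unitm1 (q : Q) : A := pi (gelt q) ^+ N - 1.

Lemma unitm1_in q b : q \in Q0 -> b * unitm1 q \in A0.
Proof.
move=> qQ; apply: (AN (y' := pi (gelt (- q)))).
- by rewrite -rmorphM geltN rmorph1.
- by move=> a aA; apply: A0_M.
- by move=> a aA; apply: A0_M => //; rewrite rpredN.
Qed.

Definition unit_prod (k : nat) (F : nat -> Q) : A := \prod_(j < k) unitm1 (F j).

Lemma not_div_unit_prod p k F : prime p ->
  (forall j, (j < k)%N -> ~ finord p (F j)) -> ~ div_by p (unit_prod k F).
Proof.
move=> p_pr nF; have [B [g [[_ gk] _]]] := h2 p_pr.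
move=> /gk /eqP; rewrite rmorph_prod; apply/negP/prodf_neq0 => j _.
by apply/eqP => /gk H; apply: (nF j (ltn_ord j)); exists N.
Qed.

Lemma submodule_two_gen k F : (0 < k)%N -> (forall j, (j < k)%N -> F j \in Q0) ->
  (forall p j, prime p -> (p %| m)%N -> (j < k)%N -> ~ finord p (F j)) ->
  is_submodule pi predT (two_gen_ideal m (unit_prod k F)) /\
  finite_index (two_gen_ideal m (unit_prod k F)) A0.
Proof.
case: k => // k _ FQ nF; set mu := unit_prod _ _; split; first split; first split.
- by apply/asboolP; exists 0, 0; rewrite mul0rn mulr0 addr0.
- move=> _ _ /asboolP[b [c ->]] /asboolP[b' [c' ->]]; apply/asboolP.
  by exists (b - b'), (c - c'); rewrite mulrnBl mulrBr opprD addrACA.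
- move=> _ u /asboolP[b [c ->]] _; apply/asboolP; exists (b * pi u), (c * pi u).
  by rewrite mulrDl mulrnAl mulrA.
split.
  move=> _ /asboolP[b [c ->]]; apply: A0_D => //.
  (* A single factor [unitm1 (F 0)] already brings every multiple into [A0]. *)
  rewrite /mu /unit_prod big_ord_recl -mulrA mulrC; apply: unitm1_in.
  exact: FQ.
have [|r Hr] := finite_two_gen (mu := mu) m0.
  by move=> p p_pr pm; apply: not_div_unit_prod => // j jk; exact: nF.
by exists r => a _; exact: Hr.
Qed.

Variable f : A -> A.
Hypothesis hf : {in A0 &, {morph f : a b / a + b}}.

Let f0 : f 0 = 0.
Proof. by apply: (addrI (f 0)); rewrite -hf // !addr0. Qed.
Let fB a b : a \in A0 -> b \in A0 -> f (a - b) = f a - f b.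
Proof.
move=> Ha Hb; apply: (addIr (f b)); rewrite -hf ?subrK //; exact: A0_B.
Qed.
Let fMn a n : a \in A0 -> a *+ n \in A0 /\ f (a *+ n) = f a *+ n.
Proof.
move=> Ha; elim: n => [|n [IH1 IH2]]; first by rewrite !mulr0n.
by rewrite !mulrS hf // IH2; split=> //; apply: A0_D.
Qed.

Variable f0' : Q -> Q.
Hypothesis hff : forall a q, a \in A0 -> q \in Q0 ->
  f (a * pi (gelt q)) = f a * pi (gelt (f0' q)).

Lemma semilinear_power a q n : a \in A0 -> q \in Q0 ->
  f (a * pi (gelt q) ^+ n) = f a * pi (gelt (f0' q)) ^+ n.
Proof.
move=> Ha Hq; suff [] : a * pi (gelt q) ^+ n \in A0 /\
  f (a * pi (gelt q) ^+ n) = f a * pi (gelt (f0' q)) ^+ n by [].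
elim: n => [|n [IH1 IH2]]; first by rewrite !expr0 !mulr1.
by rewrite !exprSr !mulrA hff // IH2; split=> //; apply: A0_M.
Qed.

Lemma semilinear_unitm1 a q : a \in A0 -> q \in Q0 ->
  f (a * unitm1 q) = f a * unitm1 (f0' q).
Proof.
move=> Ha Hq; rewrite /unitm1 !mulrBr !mulr1 fB //; first by rewrite semilinear_power.
by rewrite -[_ * _](subrK a) -{2}[a]mulr1 -mulrBr; apply: A0_D => //; apply: unitm1_in.
Qed.

Lemma semilinear_unit_prod k F a : a \in A0 -> (forall j, (j < k)%N -> F j \in Q0) ->
  f (a * unit_prod k F) = f a * unit_prod k (f0' \o F).
Proof.
move=> Ha FQ; suff [] : a * unit_prod k F \in A0 /\
  f (a * unit_prod k F) = f a * unit_prod k (f0' \o F) by [].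
elim: k FQ => [|k IH] FQ; first by rewrite /unit_prod !big_ord0 !mulr1.
have [IH1 IH2] := IH (fun j jk => FQ j (ltnW jk)).
rewrite /unit_prod !big_ord_recr /= !mulrA; split.
  by apply: unitm1_in; exact: FQ.
by rewrite semilinear_unitm1 //; [rewrite IH2 | exact: FQ].
Qed.

(* The product mu over a cycle of f0' satisfies f (a mu) = f a * mu; and
   f (b m) (z - 1) is divisible by m for a z such that z - 1 is not a zero divisor
   modulo the primes dividing m. *)
Lemma cyclic_two_gen k F : (0 < k)%N -> (forall j, (j < k)%N -> F j \in Q0) ->
  (forall j, (j < k)%N -> f0' (F j) = F j.+1) -> F k = F 0%N ->
  (forall p j, prime p -> (p %| m)%N -> (j < k)%N -> ~ finord p (F j)) ->
  (forall b, exists c, f (b *+ m) = c *+ m) /\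
  (forall b, exists c, f (unit_prod k F * b) = unit_prod k F * c).
Proof.
move=> k0 FQ fF Fk nF.
(* When k = 1 the index 1 is outside the range of [nF], but then F 1 = F k = F 0. *)
have nF1 p : prime p -> (p %| m)%N -> ~ finord p (F 1%N).
  move=> p_pr pm; have [k1|k1] := ltnP 1 k; first exact: nF.
  by have -> : 1%N = k by [lia]; rewrite Fk; exact: nF.
(* The prime factors of n are cancelled one at a time, none of them dividing [unitm1 (F 1)]. *)
have divm z n : (0 < n)%N -> (n %| m)%N -> (exists c, z * unitm1 (F 1%N) = c *+ n) -> exists c, z = c *+ n.
  elim/ltn_ind: n z => n IH z n0 nm [c Ec].
  have [n1|n1] := leqP n 1; first by exists z; have -> : n = 1%N by [lia]; rewrite mulr1n.
  have p_pr := pdiv_prime n1; set p := pdiv n in p_pr.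
  have pn : (p %| n)%N := pdiv_dvd n.
  have [|[z' Ez]|[d Ed]] := @div_by_prime p z (unitm1 (F 1%N)) p_pr.
  - by exists (c *+ (n %/ p)); rewrite Ec -mulrnA divnK.
  - have [||||c' Ec'] := IH (n %/ p)%N _ z'.
    + by rewrite ltn_Pdiv // prime_gt1.
    + by rewrite divn_gt0 ?prime_gt0 // dvdn_leq.
    + exact: dvdn_trans (dvdn_div pn) nm.
    + exists c; apply: (mulrnAI (prime_gt0 p_pr)).
      by rewrite -mulrnAl -Ez Ec -mulrnA divnK.
    by exists c'; rewrite Ez Ec' -mulrnA divnK.
  - by case: (nF1 p p_pr (dvdn_trans pn nm)); exists N => //; exists d.
have fm b : exists c, f (b *+ m) = c *+ m.
  apply: (divm _ m) => //; exists (f (b * unitm1 (F 0%N))).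
  rewrite -(fF 0%N k0) -semilinear_unitm1 //; last exact: FQ.
  have [_ <-] := fMn m (unitm1_in b (FQ 0%N k0)).
  by rewrite mulrnAl.
(* As b may lie outside [A0], semilinearity is applied to m b, and m is cancelled at the end. *)
split=> // b; have [c Ec] := fm b; exists c.
have muA : unit_prod k F * b \in A0.
  case: (k) k0 FQ => // k' _ FQ.
  by rewrite /unit_prod big_ord_recl -mulrA mulrC; apply: unitm1_in; exact: FQ.
apply: (mulrnAI m0); have [_ <-] := fMn m muA.
rewrite mulrC -mulrnAl semilinear_unit_prod // Ec mulrnAl [unit_prod k F * c]mulrC; congr (_ * _ *+ _).
case: (k) k0 Fk fF => // k' _ Fk fF.
rewrite /unit_prod big_ord_recr /= fF // Fk [RHS]big_ord_recl mulrC; congr (_ * _).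
by apply: eq_bigr => j _; rewrite lift0 /= fF // ltnS ltnW.
Qed.
End TwoGeneratorIdeal.

Lemma avoid_isolated_family (Q : zmodType) (T : nat -> Q -> Prop) n :
  (forall i, (i < n)%N -> isolated (T i)) -> exists x, forall i, (i < n)%N -> ~ T i x.
Proof.
move=> iso; have [|x Hx] := @avoid_isolated Q (mkseq T n).
  by move=> i; rewrite size_mkseq => ilt; rewrite nth_mkseq //; exact: iso.
exists x => i ilt; have := Hx i; rewrite size_mkseq nth_mkseq //.
exact.
Qed.

Lemma isolated_preimage (Q : zmodType) (T : Q -> Prop) (h : Q -> Q) :
  {morph h : q r / q - r} -> isolated T -> (exists x, ~ T (h x)) ->
  isolated (fun x => T (h x)).
Proof.
move=> hB [TB Tn _] nT; split=> // [x y Tx Ty|x n n0]; first by rewrite hB; apply: TB.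
have h0 : h 0 = 0 by rewrite -{1}(subrr 0) hB subrr.
have hN y : h (- y) = - h y by rewrite -[- y]sub0r hB h0 sub0r.
have hD y z : h (y + z) = h y + h z by rewrite -{1}[z]opprK hB hN opprK.
have -> : h (x *+ n) = h x *+ n; last exact: Tn.
elim: n {n0} => [|n IH]; first by rewrite !mulr0n.
by rewrite !mulrSr hD IH.
Qed.

Section FreeAbelianIndex.
Variables (Q : zmodType) (s : nat) (coord : {additive Q -> 'rV[int]_s}).
Variable e : 'I_s -> Q.
Hypothesis eE : forall q, q = \sum_i e i *~ coord q ord0 i.

Lemma coord_ex q : exists k : 'I_s -> int, q = \sum_i e i *~ k i.
Proof. by exists (fun i => coord q ord0 i); exact: eE. Qed.

Lemma multiples_finite_index (M : nat) (K : {pred Q}) : (0 < M)%N ->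
  (forall q, q *+ M \in K) -> finite_index (gen_subgroup (fun j => e j *+ M)) K.
Proof.
move=> M0 MK; split=> [q /(mem_multiple coord_ex M q).2[r ->] //|].
pose G : finType := {ffun 'I_s -> 'I_M.-1.+1}.
exists [seq \sum_i e i *+ c i | c : G] => x _.
have Mz : M%:Z != 0 by lia.
pose d : G := [ffun i => inord `|(coord x ord0 i %% M%:Z)%Z|%N].
exists (\sum_i e i *+ d i); first by apply/seq.mapP; exists d => //; exact: mem_enum.
have -> : x - \sum_i e i *+ d i = (\sum_i e i *~ (coord x ord0 i %/ M)%Z) *+ M.
  rewrite {1}[x]eE -sumrB -sumrMnl; apply: eq_bigr => i _.
  have Ed : (d i)%:Z = (coord x ord0 i %% M%:Z)%Z.
    rewrite ffunE inordK; first by rewrite gez0_abs // modz_ge0.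
    by rewrite prednK // -ltz_nat gez0_abs ?modz_ge0 // ltz_pmod.
  by rewrite {1}(divz_eq (coord x ord0 i) M) -Ed mulrzDr -pmulrn addrK mulrzA pmulrn.
by case: (mem_multiple coord_ex M (\sum_i e i *~ (coord x ord0 i %/ M)%Z)).
Qed.
End FreeAbelianIndex.

Lemma transcendental_of_algebraic (A : idomainType) (x : A) :
  (forall k : int, intrm A k = 0 -> k = 0) ->
  ~ algebraicOver (@ratr {fraction A}) (tofrac x) -> transcendental (intrm A) x.
Proof.
move=> chA nalg p p0; apply/negP => /eqP px; apply: nalg.
exists (map_poly (intrm rat) p).
  apply: contraNneq p0 => p0; suff -> : p = 0 by rewrite rmorph0.
  apply/polyP => i; rewrite coef0; apply/eqP; rewrite -(intr_eq0 rat).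
  by rewrite -[_%:~R]/(intrm rat _) -coef_map p0 coef0.
apply/rootP; rewrite -map_poly_comp_id0; last exact: (ratr_int _ 0).
have -> : map_poly (@ratr {fraction A} \o intrm rat) p =
    map_poly (@tofrac A) (map_poly (intrm A) p).
  by rewrite -map_poly_comp; apply: eq_map_poly => k; rewrite /= ratr_int rmorph_int.
by rewrite horner_map px rmorph0.
Qed.

Theorem theorem4p3
  (R : realType) (s : nat) (hs : (2 <= s)%N)
  (Q : zmodType) (coord : {additive Q -> 'rV[int]_s}) (hcoord : bijective coord)
  (Q0 : zmodClosed Q) (hQ0 : finite_index Q0 predT)
  (A : idomainType) (I : idealr (grpring Q)) (pi : {rmorphism grpring Q -> A})
  (hA : is_quotient [set u | u \in I] pi)
  (A0 : {pred A}) (hA0 : is_submodule pi (grpring_on Q0) A0)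
  (hA0fin : finite_index A0 predT)
  (f0 : Q -> Q) (hf0 : {in Q0 &, {morph f0 : q r / q + r}})
  (hf0inj : {in Q0 &, injective f0})
  (f : A -> A) (hf : {in A0 &, {morph f : a b / a + b}})
  (hff0 : forall a0 q0, a0 \in A0 -> q0 \in Q0 ->
     f (a0 * pi (gelt q0)) = f a0 * pi (gelt (f0 q0)))
  (h1tf : forall (a : A) (n : nat), (0 < n)%N -> a *+ n = 0 -> a = 0)
  (h1dim : krull_dim A 2)
  (h2 : forall p : nat, prime p ->
     exists (B : idomainType) (g : {rmorphism A -> B}),
       is_quotient [set a | exists b, a = b *+ p] g /\
       infinite_set [set: B])
  (h3 : forall x : 'I_s -> Q, (forall q, q \in gen_subgroup x) ->
     forall (n : nat) (c : 'I_s -> nat), (0 < n)%N -> (forall i, (0 < c i)%N) ->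
     (exists phi : {rmorphism
          subquot (gen_subgroup (fun j => x j *+ n)) I ->
          subquot (gen_subgroup (fun j => x j *+ c j)) I},
        forall i, phi (power_class I x (fun=> n) i) = power_class I x c i) ->
     forall i, c i = n)
  (h4 : forall q : Q, q != 0 ->
     ~ algebraicOver (@ratr {fraction A}) (tofrac (pi (gelt q))))
  (h5 : forall V : {vspace 'rV[R]_s}, \dim V = 2%N ->
     ~ (great_circle coord V `<=` Sigma_c pi R)) :
  exists (m : nat) (mu : A), (0 < m)%N /\
    let M := two_gen_ideal m mu in
    [/\ is_submodule pi predT M,
        finite_index M A0 &
        (forall a, a \in M -> f a = 0)
        \/
        exists (k : nat) (Q1 : zmodClosed Q),
          [/\ (0 < k)%N,
              finite_index Q1 Q0,
              (forall q, q \in Q1 ->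
                 (forall j, (j < k)%N -> iter j f0 q \in Q0) /\
                 iter k f0 q = q),
              (forall b, exists c, f (b *+ m) = c *+ m) &
              (forall b, exists c, f (mu * b) = mu * c)]].
Proof.
have [e [eE e_e]] := coord_dual_basis hcoord.
have [pi_surj kerI] := hA; have [_ dimA] := h1dim.
have chA (k : int) : intrm A k = 0 -> k = 0.
  have nat0 n : n%:R = 0 :> A -> n = 0%N.
    case: n => // n n0; have /eqP := h1tf 1 n.+1 isT n0.
    by rewrite oner_eq0.
  by case: k => n; [move/nat0 -> | rewrite /= NegzE mulrNz => /eqP; rewrite oppr_eq0 => /eqP/nat0].
have trA q (q0 : q != 0) : transcendental (intrm A) (pi (gelt q)).
  exact: transcendental_of_algebraic chA (h4 q q0).
have [gens genA] := pi_ingen eE pi_surj.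
have depA (x y : A) := @algebraic_dependence A gens genA dimA x y chA.
have Q0c : zmod_closed Q0 by split; [exact: rpred0 | move=> x y; exact: rpredB].
have [N0 N00 QN0] := finite_index_exponent Q0c hQ0.
have [m m0 Am] := finite_index_exponent hA0.1 hA0fin.
have [N N_gt0 AN] := unit_power_index hA0.1 hA0fin.
have pr_isolated i : (i < size (primes m))%N -> prime (nth 0%N (primes m) i).
  by move=> ilt; have := mem_nth 0%N ilt; rewrite mem_primes => /andP[].
have f_0 : f 0 = 0.
  by have A00 := hA0.1.1; apply: (addrI (f 0)); rewrite -hf // !addr0.
have submod := submodule_two_gen eE pi_surj h1tf dimA h2 hA0 m0 Am AN N_gt0.
have [fz|/existsNP[a0 /not_implyP[a0A /eqP fa0]]] := pselect (forall a, a \in A0 -> f a = 0).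
  (* When f vanishes no orbit is required: one factor suffices, with x moved into [Q0] by the
     exponent [N0]. *)
  have [x Hx] := @avoid_isolated_family Q (fun i => finord pi (nth 0%N (primes m) i))
    (size (primes m)) (fun i ilt => finord_isolated eE pi_surj h2 (pr_isolated i ilt)).
  have [||subM finM] := submod 1%N (fun=> x *+ N0) isT.
  - by move=> j _; exact: QN0.
  - move=> p j p_pr pm _; apply: (finord_multiple eE pi_surj h2) => //.
    have pin : p \in primes m by rewrite mem_primes p_pr m0.
    by have := Hx (index p (primes m)); rewrite index_mem nth_index //; exact.
  exists m, (unit_prod pi N 1 (fun=> x *+ N0)); split=> //=; split=> //.
  by left => a aM; apply: fz; case: finM => sub _; exact: sub.
pose g q := f0 (q *+ N0).
have f0_0 : f0 0 = 0 by apply: (addrI (f0 0)); rewrite -hf0 ?rpred0 // !addr0.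
have f0B : {in Q0 &, {morph f0 : q r / q - r}}.
  by move=> q r q0 r0; apply: (addIr (f0 r)); rewrite -hf0 ?rpredB // !subrK.
have f0Mn q n : q \in Q0 -> f0 (q *+ n) = f0 q *+ n.
  move=> qQ; elim: n => [|n IH]; first by rewrite !mulr0n.
  by rewrite !mulrS hf0 ?rpredMn // IH.
have gB : {morph g : q r / q - r} by move=> q r; rewrite /g mulrnBl f0B.
have gMn q n : g (q *+ n) = g q *+ n.
  rewrite /g -mulrnA mulnC mulrnA. by rewrite (f0Mn _ n (QN0 q)).
have g_inj q : q != 0 -> g q != 0.
  apply: contra_neq => gq; apply: (coord_torsion_free hcoord N00).
  by apply: hf0inj; rewrite ?rpred0 // f0_0.
have morphD (h : Q -> Q) : {morph h : q r / q - r} -> {morph h : q r / q + r}.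
  move=> hB q r; have h0 : h 0 = 0 by rewrite -{1}(subrr 0) hB subrr.
  by rewrite -{1}[r]opprK hB -[- r]sub0r hB h0 sub0r opprK.
have mulnD n : {morph (fun q : Q => q *+ n) : q r / q + r} by move=> q r; rewrite mulrnDl.
have [thN thNE] := theta_ex pi (mulnD N0).
have [thg thgE] := theta_ex pi (morphD g gB).
have semi u a : a \in A0 -> a * thN u \in A0 /\ f (a * thN u) = f a * thg u.
  have [[_ A0B] A0M] := hA0; move=> aA.
  elim/grpring_ind: u => [|u v [Hu Eu] [Hv Ev]|q].
  - by rewrite !rmorph0 !mulr0 f_0; split=> //; exact: hA0.1.1.
  - rewrite !rmorphB !mulrBr -Eu -Ev; split; first exact: A0B.
    apply: (addIr (f (a * thN v))); rewrite -hf ?subrK //; exact: A0B.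
  - rewrite thNE thgE hff0 //; split=> //; apply: A0M => //.
    by apply: gelt_on; exact: QN0.
have ker_sub u : thN u = 0 -> thg u = 0.
  move=> u0; have [_ /eqP] := semi u a0 a0A; rewrite u0 mulr0 f_0 eq_sym mulf_eq0.
  by rewrite (negbTE fa0) => /eqP.
pose i0 : 'I_s := Ordinal (ltnW hs).
have e0 : e i0 != 0.
  apply/eqP => e0; have := e_e i0 i0; rewrite e0 raddf0 mxE eqxx => /eqP.
  by rewrite eq_sym oner_eq0.
have [k [a [b [k0 a_gt0 b_gt0 Ek]]]] :=
  endomorphism_power hcoord eE e_e pi_surj chA trA depA N00 gB g_inj thNE thgE ker_sub e0.
have iterB j : {morph iter j g : q r / q - r}.
  by elim: j => [|j IH] q r //=; rewrite IH gB.
have iterMn j q n : iter j g (q *+ n) = iter j g q *+ n.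
  by elim: j => //= j ->; rewrite gMn.
(* Since g commutes with multiples, [ker_sub] applies to the image of u under multiplication by
   N0^j, and the induction hypothesis to its image under g. *)
have ker_iter j : forall al be : {rmorphism grpring Q -> A},
    (forall q, al (gelt q) = pi (gelt (q *+ N0 ^ j))) ->
    (forall q, be (gelt q) = pi (gelt (iter j g q))) ->
    forall u, al u = 0 -> be u = 0.
  elim: j => [|j IH] al be alE beE u u0.
    by rewrite -u0; apply: grpring_eq => q; rewrite alE beE expn0 mulr1n.
  have [pN pNE] := theta_ex (GRing.RMorphism.clone (grpring Q) _ idfun _) (mulnD (N0 ^ j)%N).
  have [pg pgE] := theta_ex (GRing.RMorphism.clone (grpring Q) _ idfun _) (morphD g gB).
  have [al' al'E] := theta_ex pi (mulnD (N0 ^ j)%N).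
  have [be' be'E] := theta_ex pi (morphD _ (iterB j)).
  have E1 : thN \o pN =1 al.
    by apply: grpring_eq => q; rewrite /= pNE thNE alE -mulrnA -expnSr.
  have E2 : thg \o pN =1 al' \o pg.
    by apply: grpring_eq => q; rewrite /= pNE thgE pgE al'E gMn.
  have E3 : be' \o pg =1 be.
    by apply: grpring_eq => q; rewrite /= pgE be'E beE -iterSr.
  rewrite -E3; apply: (IH al' be') => //.
  by rewrite -[al' _]/((al' \o pg) u) -E2; apply: ker_sub; rewrite -E1 in u0.
(* A further factor a^k turns g^k into multiplication by (N0 b)^k, so that hypothesis 3 can compare
   the powers x^n and x^c. *)
pose n := (N0 ^ k * a ^ k)%N; pose c := ((N0 * b) ^ k)%N.
have n_gt0 : (0 < n)%N by rewrite muln_gt0 !expn_gt0 N00 a_gt0.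
have c_gt0 : (0 < c)%N by rewrite expn_gt0 muln_gt0 N00 b_gt0.
have Ecn : c = n.
  apply: (h3 e _ n (fun=> c) n_gt0 (fun=> c_gt0) _ i0).
    by move=> q; apply/gen_subgroupP; exact: coord_ex eE q.
  have [pn pnE] := theta_ex (GRing.RMorphism.clone (grpring Q) _ idfun _) (mulnD n).
  have [pc pcE] := theta_ex (GRing.RMorphism.clone (grpring Q) _ idfun _) (mulnD c).
  have [pa paE] := theta_ex (GRing.RMorphism.clone (grpring Q) _ idfun _) (mulnD (a ^ k)%N).
  have [al alE] := theta_ex pi (mulnD (N0 ^ k)%N).
  have [be beE] := theta_ex pi (morphD _ (iterB k)).
  apply: (power_morphism (coord_ex eE) (pnE) (pcE)) => v /(kerI (pn v)) pv; apply/(kerI (pc v)).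
  have E1 : al \o pa =1 pi \o pn.
    by apply: grpring_eq => q; rewrite /= paE alE pnE -mulrnA mulnC.
  have E2 : be \o pa =1 pi \o pc.
    by apply: grpring_eq => q; rewrite /= paE beE pcE iterMn Ek.
  rewrite -[pi _]/((pi \o pc) v) -E2; apply: (ker_iter k al be alE beE).
  by rewrite -[al _]/((al \o pa) v) E1.
have iterk q : iter k g q = q *+ N0 ^ k.
  have ak0 : (0 < a ^ k)%N by rewrite expn_gt0 a_gt0.
  apply: (coord_mulrnI hcoord ak0).
  by rewrite /= Ek -/c Ecn mulrnA.
(* Each application of f0 trades one factor N0 for one application of g; hence k applications are
   defined on N0^k Q. *)
have iterf0 q j : (j <= k)%N -> iter j f0 (q *+ N0 ^ k) = iter j g q *+ N0 ^ (k - j).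
  elim: j => [|j IH] jk; first by rewrite subn0.
  rewrite /= IH ?(ltnW jk) //; have -> : (k - j)%N = (k - j.+1).+1 by lia.
  by rewrite expnS mulrnA f0Mn ?QN0.
have iterQ0 q j : (j < k)%N -> iter j f0 (q *+ N0 ^ k) \in Q0.
  move=> jk; rewrite iterf0 ?(ltnW jk) //; have -> : (k - j)%N = (k - j.+1).+1 by lia.
  by rewrite expnSr mulrnA QN0.
pose h j q := iter j f0 (q *+ N0 ^ k).
have hE j q : (j <= k)%N -> h j q = iter j g q *+ N0 ^ (k - j) by exact: iterf0.
(* The number i codes a prime factor of m, by i / k, together with a position i mod k on the
   orbit. *)
pose T i q := finord pi (nth 0%N (primes m) (i %/ k)) (h (i %% k)%N q).
have [i|x Hx] := @avoid_isolated_family Q T (size (primes m) * k).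
  move=> ilt; have ik : (i %/ k < size (primes m))%N by rewrite ltn_divLR.
  have p_pr := pr_isolated _ ik; have jk : (i %% k < k)%N by rewrite ltn_mod.
  have iso := finord_isolated eE pi_surj h2 p_pr.
  apply: isolated_preimage => //.
    by move=> q r; rewrite !hE ?(ltnW jk) // iterB mulrnBl.
  (* With j = i mod k, the map h_j sends g^(k-j)(y) to a multiple of y, which stays outside the
     isolated subgroup. *)
  have [_ _ [y ny]] := iso; exists (iter (k - i %% k) g y).
  rewrite hE ?(ltnW jk) // -iterD subnKC ?(ltnW jk) // iterk -mulrnA.
  apply: (finord_multiple eE pi_surj h2) => //.
  by rewrite muln_gt0 !expn_gt0 N00.
have nF p j : prime p -> (p %| m)%N -> (j < k)%N -> ~ finord pi p (h j x).
  move=> p_pr pm jk; have pin : p \in primes m by rewrite mem_primes p_pr m0.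
  have := Hx (index p (primes m) * k + j)%N.
  rewrite /T divnMDl // divn_small // addn0 modnMDl modn_small // nth_index //.
  apply; have : (index p (primes m) < size (primes m))%N by rewrite index_mem.
  by move: (index _ _) (size _) => i t it; nia.
have FQ j : (j < k)%N -> h j x \in Q0 by exact: iterQ0.
have hk : h k x = h 0%N x by rewrite /h /= iterf0 // iterk subnn expn0 mulr1n.
have [subM finM] := submod k (h^~ x) k0 FQ nF.
exists m, (unit_prod pi N k (h^~ x)); split=> //=; split=> //; right.
exists k, (GRing.ZmodClosed.clone Q (gen_subgroup (fun j => e j *+ N0 ^ k)) _).
have [fm fmu] := cyclic_two_gen h1tf h2 hA0 m0 Am AN N_gt0 hf hff0 k0 FQ (fun j _ => erefl) hk nF.
split=> //.
- apply: (multiples_finite_index eE); first by rewrite expn_gt0 N00.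
  by move=> q; rewrite -[q *+ _]/(iter 0 f0 (q *+ _)); exact: iterQ0.
- move=> q /(mem_multiple (coord_ex eE) (N0 ^ k) q).2[r ->]; split.
    by move=> j; exact: iterQ0.
  by rewrite iterf0 // subnn expn0 mulr1n iterk.
Qed.
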